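(* Let $\mathbb{F}$ be a real closed field. Up to isometric isomorphism, the complete list of indecomposable solvable quadratic Lie algebras over $\mathbb{F}$ of dimension at least $1$ and at most $7$ is the following (each described by a basis, its nonzero brackets of basis elements up to skew-symmetry, and the form $q(v)=\varphi(v,v)$; a sign $\pm$ in front of a form means that the algebra occurs with each of the two forms, and $\epsilon\in\{1,-1\}$). (1) $\mathfrak{r}_1$: basis $x$; zero bracket; $q=\pm X^2$. (2) Basis $a,x,y,z$: $\mathfrak{r}_{4,1}$: $[a,x]=x$, $[a,y]=-y$, $[x,y]=z$; $q=2AZ+2XY$. $\mathfrak{r}_{4,2}^{-1}$: $[a,x]=-y$, $[a,y]=x$, $[x,y]=-z$; $q=\pm(2AZ+X^2+Y^2)$. (3) $\mathfrak{r}_5$ (basis $x_1,x_2,y,z_1,z_2$): $[x_1,x_2]=y$, $[x_1,y]=z_1$, $[x_2,y]=z_2$; $q=\pm(2X_1Z_2-2X_2Z_1+Y^2)$. $\mathfrak{r}_{6,1}$ (basis $a,x_1,x_2,y_1,y_2,z$): $[a,x_1]=x_2$, $[a,y_1]=-y_2$, $[x_1,y_1]=z$; $q=2AZ+2X_1Y_2+2X_2Y_1$. (4) Basis $a,x_1,x_2,y_1,y_2,z$: $\mathfrak{r}_{6,2}^{\lambda}$, $\lambda\geq1$: $[a,x_1]=x_1$, $[a,x_2]=-x_2$, $[a,y_1]=\lambda y_1$, $[a,y_2]=-\lambda y_2$, $[x_1,x_2]=z$, $[y_1,y_2]=\lambda z$; $q=2AZ+2X_1X_2+2Y_1Y_2$.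 $\mathfrak{r}_{6,3}$: $[a,x_1]=x_1+x_2$, $[a,x_2]=x_2$, $[a,y_1]=-y_1-y_2$, $[a,y_2]=-y_2$, $[x_1,y_1]=[x_1,y_2]=[x_2,y_1]=z$; $q=2AZ+2X_1Y_2+2X_2Y_1$. $(\mathfrak{r}_{6,4}^{\lambda})^\dagger$, $\lambda>0$: $[a,x_1]=x_1$, $[a,x_2]=-x_2$, $[a,y_1]=\lambda y_2$, $[a,y_2]=-\lambda y_1$, $[x_1,x_2]=z$, $[y_1,y_2]=\lambda z$; $q=\pm(2AZ+2X_1X_2+Y_1^2+Y_2^2)$. $(\mathfrak{r}_{6,5}^{\lambda})^\dagger(\epsilon)$, $\lambda\geq1$, $\epsilon=\pm1$: $[a,x_1]=x_2$, $[a,x_2]=-x_1$, $[a,y_1]=\lambda y_2$, $[a,y_2]=-\lambda y_1$, $[x_1,x_2]=z$, $[y_1,y_2]=\epsilon\lambda z$; $q=\pm(2AZ+X_1^2+X_2^2+\epsilon Y_1^2+\epsilon Y_2^2)$. $(\mathfrak{r}_{6,6})^\dagger$: $[a,x_1]=y_1+x_2$, $[a,y_1]=-x_1-y_2$, $[a,x_2]=-y_2$, $[a,y_2]=x_2$, $[x_1,x_2]=[x_1,y_1]=z$, $[y_1,y_2]=-z$; $q=\pm(2AZ+2X_1Y_2+2X_2Y_1)$. $(\mathfrak{r}_{6,7}^{\lambda})^\dagger$, $\lambda>0$: $[a,x_1]=x_1-\lambda y_1$, $[a,y_1]=\lambda x_1+y_1$, $[a,x_2]=-x_2+\lambda y_2$,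 $[a,y_2]=-\lambda x_2-y_2$, $[x_1,x_2]=-\lambda z$, $[x_1,y_2]=[y_1,x_2]=z$, $[y_1,y_2]=\lambda z$; $q=2AZ+2X_1Y_2+2X_2Y_1$. (5) $\mathfrak{r}_{7,1}$ (basis $a,x_1,\dots,x_5,z$): $[a,x_i]=x_{i+1}$ for $i=1,2,3,4$, $[x_1,x_4]=z$, $[x_2,x_3]=-z$; $q=\pm(2AZ-2X_1X_5+2X_2X_4-X_3^2)$. $\mathfrak{r}_{7,2}$ (basis $a,x_1,x_2,y_1,y_2,y_3,z$): $[a,x_1]=x_1$, $[a,x_2]=-x_2$, $[a,y_1]=y_2$, $[a,y_2]=y_3$, $[x_1,x_2]=[y_1,y_2]=z$; $q=\pm(2AZ+2X_1X_2-2Y_1Y_3+Y_2^2)$. $\mathfrak{r}_{7,3}^\dagger(\epsilon)$, $\epsilon=\pm1$ (basis $a,x_1,x_2,x_3,y_1,y_2,z$): $[a,x_1]=x_2$, $[a,x_2]=x_3$, $[a,y_1]=y_2$, $[a,y_2]=-y_1$, $[x_1,x_2]=z$, $[y_1,y_2]=\epsilon z$; $q=\pm(2AZ-2X_1X_3+X_2^2+\epsilon Y_1^2+\epsilon Y_2^2)$. $\mathfrak{r}_{7,5}$ (basis $a,x_1,x_2,y,w_1,w_2,z$): $[a,x_1]=x_1$, $[a,x_2]=-x_2$, $[a,w_1]=w_1$, $[a,w_2]=-w_2$, $[x_1,x_2]=y$, $[x_1,y]=w_1$, $[x_2,y]=w_2$, $[x_1,w_2]=[x_2,w_1]=-z$;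 $q=\pm(-2AZ+2X_1W_2-2X_2W_1+Y^2)$. $(\mathfrak{r}_{7,6})^\dagger$ (basis $a,x_1,x_2,y,w_1,w_2,z$): $[a,x_1]=x_2$, $[a,x_2]=-x_1$, $[a,w_1]=w_2$, $[a,w_2]=-w_1$, $[x_1,x_2]=y$, $[x_1,y]=w_1$, $[x_2,y]=w_2$, $[x_1,w_1]=[x_2,w_2]=z$; $q=\pm(-2AZ+2X_1W_2-2X_2W_1+Y^2)$. Moreover, the quadratic Lie algebras in the list are pairwise non-isometrically isomorphic.
   Context: All vector spaces are finite-dimensional. A quadratic Lie algebra is a pair $(L,\varphi)$ with $L$ a Lie algebra over $\mathbb{F}$ and $\varphi$ a nondegenerate symmetric bilinear form on $L$ that is invariant: $\varphi([x,y],z)=\varphi(x,[y,z])$. It is decomposable if it contains a proper nonzero ideal $I$ with $\varphi|_I$ nondegenerate, and indecomposable otherwise. $L$ is solvable if its derived series reaches $0$. An isometric isomorphism $(L_1,\varphi_1)\to(L_2,\varphi_2)$ is a Lie algebra isomorphism $f$ with $\varphi_2(f(x),f(y))=\varphi_1(x,y)$ for all $x,y$. In the forms $q$, a capital letter denotes the coordinate of the vector $v$ with respect to the basis element denoted by the corresponding lower-case letter (e.g. $A$ is the $a$-coordinate, $X_1$ the $x_1$-coordinate); $q$ determines the symmetric bilinear form $\varphi$. Brackets of basis elements not listed (and not obtained by skew-symmetry) are zero. ''Complete list up to isometric isomorphism'' means: each listed algebra is an indecomposable solvable quadratic Lie algebra, and every indecomposable solvable quadratic Lie algebra of dimension between $1$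 and $7$ is isometrically isomorphic to a listed one.
   Formalization: The pairwise non-isometry claim exempts one pair for which it is false: (r_{6,5}^λ)^†(ε) with λ=1, ε=−1 and its two signs ± of the form, which are isometrically isomorphic via a↦a, x_k↔y_k, z↦−z. *)

(* Defs.v *)
From HB Require Import structures.
From mathcomp Require Import all_boot all_order all_algebra.
From mathcomp Require Import ring.

Set Implicit Arguments.
Unset Strict Implicit.
Unset Printing Implicit Defensive.

Import Order.TTheory GRing.Theory Num.Theory.
Local Open Scope ring_scope.

(* Raw data only: the axioms are the predicate [quadratic_lie]. *)
Record quad_datum (F : fieldType) := QuadDatum {
  carrier :> vectType F;
  br : carrier -> carrier -> carrier;
  frm : carrier -> carrier -> F
}.

Definition lie_algebra (F : fieldType) (L : quad_datum F) : Prop :=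
  [/\ bilinear_for *:%R *:%R (@br F L),
      forall x : L, br x x = 0
    & forall x y z : L,
        br x (br y z) + br y (br z x) + br z (br x y) = 0].

Definition invariant_form (F : fieldType) (L : quad_datum F) : Prop :=
  forall x y z : L, frm (br x y) z = frm x (br y z).

Definition nondegenerate_on (F : fieldType) (L : quad_datum F)
    (U : {vspace L}) : Prop :=
  forall x, x \in U -> (forall y, y \in U -> frm x y = 0) -> x = 0.

Definition quadratic_lie (F : fieldType) (L : quad_datum F) : Prop :=
  [/\ lie_algebra L,
      bilinear_for *%R *%R (@frm F L),
      forall x y : L, frm x y = frm y x,
      nondegenerate_on (fullv : {vspace L})
    & invariant_form L].

Definition lie_ideal (F : fieldType) (L : quad_datum F)
    (I : {vspace L}) : Prop :=
  forall x y : L, y \in I -> br x y \in I.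

Definition decomposable (F : fieldType) (L : quad_datum F) : Prop :=
  exists I : {vspace L},
    [/\ lie_ideal I, I != 0%VS, I != fullv & nondegenerate_on I].

Definition indecomposable (F : fieldType) (L : quad_datum F) : Prop :=
  ~ decomposable L.

(* As for [prodv] in falgebra, bases suffice to span [U, V], by bilinearity. *)
Definition lie_prod (F : fieldType) (L : quad_datum F)
    (U V : {vspace L}) : {vspace L} :=
  <<[seq br u v | u <- vbasis U, v <- vbasis V]>>%VS.

Definition derived_series (F : fieldType) (L : quad_datum F) (k : nat) :
    {vspace L} :=
  iter k (fun U => lie_prod U U) fullv.

Definition solvable_lie (F : fieldType) (L : quad_datum F) : Prop :=
  exists k, derived_series L k = 0%VS.

Definition isometric (F : fieldType) (L1 L2 : quad_datum F) : Prop :=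
  exists f : {linear L1 -> L2},
    [/\ bijective f,
        forall x y, f (br x y) = br (f x) (f y)
      & forall x y, frm (f x) (f y) = frm x y].

(* A row (i, j, w) of the table [t] means that the bracket of the i-th and j-th
   basis vectors is w, hence that of the j-th and i-th is - w. *)
Definition table_br (F : fieldType) (n : nat)
    (t : seq ('I_n * 'I_n * 'rV[F]_n)) (u v : 'rV[F]_n) : 'rV[F]_n :=
  \sum_(r <- t)
    (u 0 r.1.1 * v 0 r.1.2 - u 0 r.1.2 * v 0 r.1.1) *: r.2.

(* The argument of [q] is the coordinate function of a vector. *)
Definition polar_form (F : fieldType) (n : nat) (q : ('I_n -> F) -> F)
    (u v : 'rV[F]_n) : F :=
  (q (fun i => (u + v) 0 i) - q (fun i => u 0 i) - q (fun i => v 0 i)) / 2.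

Definition table_datum (F : fieldType) (n : nat)
    (t : seq ('I_n * 'I_n * 'rV[F]_n)) (q : ('I_n -> F) -> F) : quad_datum F :=
  @QuadDatum F 'rV[F]_n (table_br t) (polar_form q).

Notation ix n k := (@Ordinal n k isT) (only parsing).

(* Signs are booleans b, standing for (-1) ^+ b: [false] is +1, [true] is -1.
   [s] is the sign in front of the form and [e] is epsilon. *)
Inductive label (F : Type) : Type :=
| R1 (s : bool)
| R41
| R42 (s : bool)
| R5 (s : bool)
| R61
| R62 (l : F)
| R63
| R64 (l : F) (s : bool)
| R65 (l : F) (e s : bool)
| R66 (s : bool)
| R67 (l : F)
| R71 (s : bool)
| R72 (s : bool)
| R73 (e s : bool)
| R75 (s : bool)
| R76 (s : bool).

Arguments R1 {F}.
Arguments R41 {F}.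
Arguments R42 {F}.
Arguments R5 {F}.
Arguments R61 {F}.
Arguments R63 {F}.
Arguments R66 {F}.
Arguments R71 {F}.
Arguments R72 {F}.
Arguments R73 {F}.
Arguments R75 {F}.
Arguments R76 {F}.

Definition admissible (F : rcfType) (i : label F) : bool :=
  match i with
  | R62 l => 1 <= l
  | R64 l _ => 0 < l
  | R65 l _ _ => 1 <= l
  | R67 l => 0 < l
  | _ => true
  end.

Definition r1 (F : fieldType) (s : bool) : quad_datum F :=
  let x := ix 1 0 in
  table_datum [::] (fun c => (-1) ^+ s * c x ^+ 2).

Definition r41 (F : fieldType) : quad_datum F :=
  let a := ix 4 0 in let x := ix 4 1 in let y := ix 4 2 in let z := ix 4 3 in
  table_datum
    [:: (a, x, 'e_x); (a, y, - 'e_y); (x, y, 'e_z)]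
    (fun c => 2 * c a * c z + 2 * c x * c y).

Definition r42 (F : fieldType) (s : bool) : quad_datum F :=
  let a := ix 4 0 in let x := ix 4 1 in let y := ix 4 2 in let z := ix 4 3 in
  table_datum
    [:: (a, x, - 'e_y); (a, y, 'e_x); (x, y, - 'e_z)]
    (fun c => (-1) ^+ s * (2 * c a * c z + c x ^+ 2 + c y ^+ 2)).

Definition r5 (F : fieldType) (s : bool) : quad_datum F :=
  let x1 := ix 5 0 in let x2 := ix 5 1 in let y := ix 5 2 in
  let z1 := ix 5 3 in let z2 := ix 5 4 in
  table_datum
    [:: (x1, x2, 'e_y); (x1, y, 'e_z1); (x2, y, 'e_z2)]
    (fun c => (-1) ^+ s * (2 * c x1 * c z2 - 2 * c x2 * c z1 + c y ^+ 2)).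

Definition r61 (F : fieldType) : quad_datum F :=
  let a := ix 6 0 in let x1 := ix 6 1 in let x2 := ix 6 2 in
  let y1 := ix 6 3 in let y2 := ix 6 4 in let z := ix 6 5 in
  table_datum
    [:: (a, x1, 'e_x2); (a, y1, - 'e_y2); (x1, y1, 'e_z)]
    (fun c => 2 * c a * c z + 2 * c x1 * c y2 + 2 * c x2 * c y1).

Definition r62 (F : fieldType) (l : F) : quad_datum F :=
  let a := ix 6 0 in let x1 := ix 6 1 in let x2 := ix 6 2 in
  let y1 := ix 6 3 in let y2 := ix 6 4 in let z := ix 6 5 in
  table_datum
    [:: (a, x1, 'e_x1); (a, x2, - 'e_x2);
        (a, y1, l *: 'e_y1); (a, y2, - (l *: 'e_y2));
        (x1, x2, 'e_z); (y1, y2, l *: 'e_z)]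
    (fun c => 2 * c a * c z + 2 * c x1 * c x2 + 2 * c y1 * c y2).

Definition r63 (F : fieldType) : quad_datum F :=
  let a := ix 6 0 in let x1 := ix 6 1 in let x2 := ix 6 2 in
  let y1 := ix 6 3 in let y2 := ix 6 4 in let z := ix 6 5 in
  table_datum
    [:: (a, x1, 'e_x1 + 'e_x2); (a, x2, 'e_x2);
        (a, y1, - 'e_y1 - 'e_y2); (a, y2, - 'e_y2);
        (x1, y1, 'e_z); (x1, y2, 'e_z); (x2, y1, 'e_z)]
    (fun c => 2 * c a * c z + 2 * c x1 * c y2 + 2 * c x2 * c y1).

Definition r64 (F : fieldType) (l : F) (s : bool) : quad_datum F :=
  let a := ix 6 0 in let x1 := ix 6 1 in let x2 := ix 6 2 in
  let y1 := ix 6 3 in let y2 := ix 6 4 in let z := ix 6 5 in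
  table_datum
    [:: (a, x1, 'e_x1); (a, x2, - 'e_x2);
        (a, y1, l *: 'e_y2); (a, y2, - (l *: 'e_y1));
        (x1, x2, 'e_z); (y1, y2, l *: 'e_z)]
    (fun c => (-1) ^+ s *
       (2 * c a * c z + 2 * c x1 * c x2 + c y1 ^+ 2 + c y2 ^+ 2)).

Definition r65 (F : fieldType) (l : F) (e s : bool) : quad_datum F :=
  let eps : F := (-1) ^+ e in
  let a := ix 6 0 in let x1 := ix 6 1 in let x2 := ix 6 2 in
  let y1 := ix 6 3 in let y2 := ix 6 4 in let z := ix 6 5 in
  table_datum
    [:: (a, x1, 'e_x2); (a, x2, - 'e_x1);
        (a, y1, l *: 'e_y2); (a, y2, - (l *: 'e_y1));
        (x1, x2, 'e_z); (y1, y2, (eps * l) *: 'e_z)]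
    (fun c => (-1) ^+ s *
       (2 * c a * c z + c x1 ^+ 2 + c x2 ^+ 2
        + eps * c y1 ^+ 2 + eps * c y2 ^+ 2)).

Definition r66 (F : fieldType) (s : bool) : quad_datum F :=
  let a := ix 6 0 in let x1 := ix 6 1 in let x2 := ix 6 2 in
  let y1 := ix 6 3 in let y2 := ix 6 4 in let z := ix 6 5 in
  table_datum
    [:: (a, x1, 'e_y1 + 'e_x2); (a, y1, - 'e_x1 - 'e_y2);
        (a, x2, - 'e_y2); (a, y2, 'e_x2);
        (x1, x2, 'e_z); (x1, y1, 'e_z); (y1, y2, - 'e_z)]
    (fun c => (-1) ^+ s *
       (2 * c a * c z + 2 * c x1 * c y2 + 2 * c x2 * c y1)).

Definition r67 (F : fieldType) (l : F) : quad_datum F :=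
  let a := ix 6 0 in let x1 := ix 6 1 in let x2 := ix 6 2 in
  let y1 := ix 6 3 in let y2 := ix 6 4 in let z := ix 6 5 in
  table_datum
    [:: (a, x1, 'e_x1 - l *: 'e_y1); (a, y1, l *: 'e_x1 + 'e_y1);
        (a, x2, - 'e_x2 + l *: 'e_y2); (a, y2, - (l *: 'e_x2) - 'e_y2);
        (x1, x2, - (l *: 'e_z)); (x1, y2, 'e_z); (y1, x2, 'e_z);
        (y1, y2, l *: 'e_z)]
    (fun c => 2 * c a * c z + 2 * c x1 * c y2 + 2 * c x2 * c y1).

Definition r71 (F : fieldType) (s : bool) : quad_datum F :=
  let a := ix 7 0 in let x1 := ix 7 1 in let x2 := ix 7 2 in
  let x3 := ix 7 3 in let x4 := ix 7 4 in let x5 := ix 7 5 in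
  let z := ix 7 6 in
  table_datum
    [:: (a, x1, 'e_x2); (a, x2, 'e_x3); (a, x3, 'e_x4); (a, x4, 'e_x5);
        (x1, x4, 'e_z); (x2, x3, - 'e_z)]
    (fun c => (-1) ^+ s *
       (2 * c a * c z - 2 * c x1 * c x5 + 2 * c x2 * c x4 - c x3 ^+ 2)).

Definition r72 (F : fieldType) (s : bool) : quad_datum F :=
  let a := ix 7 0 in let x1 := ix 7 1 in let x2 := ix 7 2 in
  let y1 := ix 7 3 in let y2 := ix 7 4 in let y3 := ix 7 5 in
  let z := ix 7 6 in
  table_datum
    [:: (a, x1, 'e_x1); (a, x2, - 'e_x2); (a, y1, 'e_y2); (a, y2, 'e_y3);
        (x1, x2, 'e_z); (y1, y2, 'e_z)]
    (fun c => (-1) ^+ s *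
       (2 * c a * c z + 2 * c x1 * c x2 - 2 * c y1 * c y3 + c y2 ^+ 2)).

Definition r73 (F : fieldType) (e s : bool) : quad_datum F :=
  let eps : F := (-1) ^+ e in
  let a := ix 7 0 in let x1 := ix 7 1 in let x2 := ix 7 2 in
  let x3 := ix 7 3 in let y1 := ix 7 4 in let y2 := ix 7 5 in
  let z := ix 7 6 in
  table_datum
    [:: (a, x1, 'e_x2); (a, x2, 'e_x3); (a, y1, 'e_y2); (a, y2, - 'e_y1);
        (x1, x2, 'e_z); (y1, y2, eps *: 'e_z)]
    (fun c => (-1) ^+ s *
       (2 * c a * c z - 2 * c x1 * c x3 + c x2 ^+ 2
        + eps * c y1 ^+ 2 + eps * c y2 ^+ 2)).

Definition r75 (F : fieldType) (s : bool) : quad_datum F :=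
  let a := ix 7 0 in let x1 := ix 7 1 in let x2 := ix 7 2 in
  let y := ix 7 3 in let w1 := ix 7 4 in let w2 := ix 7 5 in
  let z := ix 7 6 in
  table_datum
    [:: (a, x1, 'e_x1); (a, x2, - 'e_x2); (a, w1, 'e_w1); (a, w2, - 'e_w2);
        (x1, x2, 'e_y); (x1, y, 'e_w1); (x2, y, 'e_w2);
        (x1, w2, - 'e_z); (x2, w1, - 'e_z)]
    (fun c => (-1) ^+ s *
       (- 2 * c a * c z + 2 * c x1 * c w2 - 2 * c x2 * c w1 + c y ^+ 2)).

Definition r76 (F : fieldType) (s : bool) : quad_datum F :=
  let a := ix 7 0 in let x1 := ix 7 1 in let x2 := ix 7 2 in
  let y := ix 7 3 in let w1 := ix 7 4 in let w2 := ix 7 5 in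
  let z := ix 7 6 in
  table_datum
    [:: (a, x1, 'e_x2); (a, x2, - 'e_x1); (a, w1, 'e_w2); (a, w2, - 'e_w1);
        (x1, x2, 'e_y); (x1, y, 'e_w1); (x2, y, 'e_w2);
        (x1, w1, 'e_z); (x2, w2, 'e_z)]
    (fun c => (-1) ^+ s *
       (- 2 * c a * c z + 2 * c x1 * c w2 - 2 * c x2 * c w1 + c y ^+ 2)).

Definition algebra (F : rcfType) (i : label F) : quad_datum F :=
  match i with
  | R1 s => r1 F s
  | R41 => r41 F
  | R42 s => r42 F s
  | R5 s => r5 F s
  | R61 => r61 F
  | R62 l => r62 l
  | R63 => r63 F
  | R64 l s => r64 l s
  | R65 l e s => r65 l e s
  | R66 s => r66 F s
  | R67 l => r67 l
  | R71 s => r71 F s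
  | R72 s => r72 F s
  | R73 e s => r73 F e s
  | R75 s => r75 F s
  | R76 s => r76 F s
  end.

Lemma table_brE (F : fieldType) (n : nat) (t : seq ('I_n * 'I_n * 'rV[F]_n))
    (u v : 'rV[F]_n) (i : 'I_n) :
  table_br t u v 0 i =
  foldr (fun (r : 'I_n * 'I_n * 'rV[F]_n) x =>
           (u 0 r.1.1 * v 0 r.1.2 - u 0 r.1.2 * v 0 r.1.1) * r.2 0 i + x) 0 t.
Proof.
rewrite /table_br; elim: t => [|r t IH]; first by rewrite big_nil mxE.
by rewrite big_cons mxE IH mxE.
Qed.

(* The two forms of r65 with l = 1 and epsilon = -1 are isometric: exchange
   each x_k with y_k and change the sign of z. These two labels therefore have
   to be exempted when one says that distinct labels are not isometric. *)
Lemma r65_swap (F : rcfType) (s : bool) :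
  isometric (algebra (R65 (1 : F) true s)) (algebra (R65 (1 : F) true (~~ s))).
Proof.
pose p (v : 'rV[F]_6) : 'rV[F]_6 := \row_(i < 6)
  [:: v 0 (ix 6 0); v 0 (ix 6 3); v 0 (ix 6 4); v 0 (ix 6 1); v 0 (ix 6 2);
      - v 0 (ix 6 5)]`_i.
have pE v i : p v 0 i =
  [:: v 0 (ix 6 0); v 0 (ix 6 3); v 0 (ix 6 4); v 0 (ix 6 1); v 0 (ix 6 2);
      - v 0 (ix 6 5)]`_i by rewrite mxE.
have DE (u v : 'rV[F]_6) i : (u + v) 0 i = u 0 i + v 0 i by rewrite mxE.
have NE (u : 'rV[F]_6) i : (- u) 0 i = - u 0 i by rewrite mxE.
have ZE k (u : 'rV[F]_6) i : (k *: u) 0 i = k * u 0 i by rewrite mxE.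
have eE (j i : 'I_6) : ('e_j : 'rV[F]_6) 0 i = (val i == val j)%:R.
  by rewrite mxE eqxx.
have p_lin : linear p.
  move=> k u v; apply/rowP=> -[[|[|[|[|[|[|//]]]]]] i6];
  by rewrite DE ZE !pE /= !DE !ZE // opprD mulrN.
have pK : cancel p p.
  move=> v; apply/rowP=> -[[|[|[|[|[|[|//]]]]]] i6];
  by rewrite !pE /= ?opprK; congr (v _ _); apply: val_inj.
pose f : {linear 'rV[F]_6 -> 'rV[F]_6} :=
  HB.pack p (GRing.isLinear.Build F _ _ *:%R p p_lin).
exists f; split; first by exists p.
- move=> u v; change (p (@br F (algebra (R65 1 true s)) u v) =
                      @br F (algebra (R65 1 true (~~ s))) (p u) (p v)).
  apply/rowP=> -[[|[|[|[|[|[|//]]]]]] i6];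
    rewrite pE /br /= !table_brE /= !pE /= ?(eE, NE, ZE) /= expr1; ring.
- move=> u v; change (@frm F (algebra (R65 1 true (~~ s))) (p u) (p v) =
                      @frm F (algebra (R65 1 true s)) u v).
  rewrite /frm /= /polar_form !DE !pE /=.
  move: (u 0) (v 0) => {u v p pE p_lin pK f} u v.
  by case: s; rewrite /= ?expr0 ?expr1; field; rewrite ?pnatr_eq0.
Qed.

(* Main.v *)
(* In an indecomposable solvable quadratic Lie algebra L of dimension at least 2 the center is
   isotropic. Choose a central z and an isotropic a with phi(a, z) = 1: then L is determined by
   V = <a, z>^perp, the skew operator ad a on V and the alternating form phi([x, y], t) on V.
   As dim V <= 5, solvability lets one choose z such that this 3-form vanishes on V, unless V is
   spanned by an isotropic plane <c1, c2>, its dual and a vector y, with ad a invertible on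
   the plane; the exception gives r_{7,5} and r_{7,6}. When the 3-form vanishes, L depends only on
   the conjugacy class, up to scaling, of a skew operator with isotropic kernel, and these have
   the listed normal forms. Conversely a listed algebra is indecomposable because its center is
   isotropic, whereas a decomposition would have a summand of dimension at most 3, and a solvable
   quadratic Lie algebra of that dimension is abelian, hence equal to its center. Distinct labels are
   separated by the real eigenvalues of (ad u)^2, the signs of phi on eigenvectors, nilpotency of
   ad u, and the position of [[L, L], [L, L]]. *)

From HB Require Import structures.
Require Import Defs.
From mathcomp Require Import all_boot all_order all_algebra.
From mathcomp Require Import ring lra.
From Stdlib Require Import Classical.

Set Implicit Arguments.
Unset Strict Implicit.
Unset Printing Implicit Defensive.

Import Order.TTheory GRing.Theory Num.Theory.
Local Open Scope ring_scope.

(** * Bilinear calculus in a quadratic Lie algebra *)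

(** All computations stay in F: real closedness enters only through the order and square roots of
    nonnegative elements. This suffices because a skew operator has an even characteristic
    polynomial, so in dimension 4 its eigenvalues are governed by a quadratic equation in its
    square, and in odd dimension it has a kernel vector that lowers the dimension. The obstacle is
    the choice of z, since z^perp / z need not be abelian for the first central vector found. If the
    3-form on V is nonzero, its radical is stable under ad a; a suitable radical vector c killed by
    ad a is a second central vector, and z is replaced by c - m z, with m cancelling the one value
    of the 3-form that survives. The exception is exactly the case where ad a has no kernel on a
    two-dimensional radical. The separating properties are existential or universal statements about
    brackets and lengths, so that isometries carry them over. In coordinates a sign survives as
    (-1)^s times a sum of squares, and a parameter as a ratio of eigenvalues attained by one and the
    same ad u, which removes the freedom of rescaling u. *)

Section QuadraticLie.

Variables (F : rcfType) (L : quad_datum F).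
Hypothesis QL : quadratic_lie L.

Implicit Types (x y t v : L) (k : F) (U : {vspace L}).

Lemma frmC x y : frm x y = frm y x.
Proof. by case: QL. Qed.

Lemma frmDl x y t : frm (x + y) t = frm x t + frm y t.
Proof. by case: QL => _ [H _] _ _ _; have := H t 1 x y; rewrite /= !(scale1r, mul1r). Qed.

Lemma frm0l t : frm (0 : L) t = 0.
Proof. by apply: (addIr (frm 0 t)); rewrite -frmDl !add0r. Qed.

Lemma frmZl k x t : frm (k *: x) t = k * frm x t.
Proof.
by case: QL => _ [H _] _ _ _; have := H t k x 0; rewrite /= frm0l !addr0.
Qed.

Lemma frmNl x t : frm (- x) t = - frm x t.
Proof. by rewrite -scaleN1r frmZl mulN1r. Qed.

Lemma frmDr x y t : frm t (x + y) = frm t x + frm t y.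
Proof. by rewrite ![frm t _]frmC frmDl. Qed.

Lemma frm0r t : frm t (0 : L) = 0.
Proof. by rewrite frmC frm0l. Qed.

Lemma frmZr k x t : frm t (k *: x) = k * frm t x.
Proof. by rewrite ![frm t _]frmC frmZl. Qed.

Lemma frmNr x t : frm t (- x) = - frm t x.
Proof. by rewrite ![frm t _]frmC frmNl. Qed.

Definition frmE := (frmDl, frmDr, frmZl, frmZr, frmNl, frmNr, frm0l, frm0r).

Lemma br_xx x : br x x = 0.
Proof. by case: QL => -[]. Qed.

Lemma brDl x y t : br (x + y) t = br x t + br y t.
Proof.
by case: QL => -[[H _] _ _] _ _ _ _; have := H t 1 x y; rewrite /= !scale1r.
Qed.

Lemma br0l t : br (0 : L) t = 0.
Proof. by apply: (addIr (br 0 t)); rewrite -brDl !add0r. Qed.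

Lemma brZl k x t : br (k *: x) t = k *: br x t.
Proof.
by case: QL => -[[H _] _ _] _ _ _ _; have := H t k x 0; rewrite /= br0l !addr0.
Qed.

Lemma brNl x t : br (- x) t = - br x t.
Proof. by rewrite -scaleN1r brZl scaleN1r. Qed.

Lemma brDr x y t : br t (x + y) = br t x + br t y.
Proof.
by case: QL => -[[_ H] _ _] _ _ _ _; have := H t 1 x y; rewrite /= !scale1r.
Qed.

Lemma br0r t : br t (0 : L) = 0.
Proof. by apply: (addIr (br t 0)); rewrite -brDr !add0r. Qed.

Lemma brZr k x t : br t (k *: x) = k *: br t x.
Proof.
by case: QL => -[[_ H] _ _] _ _ _ _; have := H t k x 0; rewrite /= br0r !addr0.
Qed.

Lemma brNr x t : br t (- x) = - br t x.
Proof. by rewrite -scaleN1r brZr scaleN1r. Qed.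

Definition brE := (brDl, brDr, brZl, brZr, brNl, brNr, br0l, br0r).

Lemma brC x y : br x y = - br y x.
Proof.
apply/eqP; rewrite -addr_eq0; apply/eqP; have := br_xx (x + y).
by rewrite !brE !br_xx add0r addr0 addrC.
Qed.

Lemma jacobi x y t : br x (br y t) = br (br x y) t + br y (br x t).
Proof.
case: QL => -[_ _ J] _ _ _ _; have := J x y t.
rewrite (brC t x) (brC t (br x y)) brNr => /eqP.
by rewrite addr_eq0 opprK subr_eq addrC => /eqP.
Qed.

Lemma br_skew x y t : frm (br x y) t = - frm y (br x t).
Proof.
rewrite (brC x y) frmNl; congr (- _); by case: QL => _ _ _ _ /(_ y x t).
Qed.

(* The bracket is recovered from the alternating form phi([x, y], t). *)
Definition tri x y t := frm (br x y) t.

Lemma tri_xx x t : tri x x t = 0. Proof. by rewrite /tri br_xx frm0l. Qed.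
Lemma tri_xt x t : tri x t x = 0.
Proof. by rewrite /tri br_skew br_xx frm0r oppr0. Qed.
Lemma tri_tx t x : tri t x x = 0.
Proof. by rewrite /tri brC frmNl br_skew br_xx frm0r !oppr0. Qed.
Lemma triC x y t : tri x y t = - tri y x t.
Proof. by rewrite /tri brC frmNl. Qed.
Lemma triCr x y t : tri x y t = - tri x t y.
Proof. by rewrite /tri br_skew frmC. Qed.
Lemma triR x y t : tri x y t = tri y t x.
Proof. by rewrite triC triCr opprK. Qed.

Lemma triDl x y t s : tri (x + y) t s = tri x t s + tri y t s.
Proof. by rewrite /tri brDl frmDl. Qed.
Lemma triDm x y t s : tri t (x + y) s = tri t x s + tri t y s.
Proof. by rewrite /tri brDr frmDl. Qed.
Lemma triDr x y t s : tri t s (x + y) = tri t s x + tri t s y.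
Proof. by rewrite /tri frmDr. Qed.
Lemma triZl k y t s : tri (k *: y) t s = k * tri y t s.
Proof. by rewrite /tri brZl frmZl. Qed.
Lemma triZm k y t s : tri t (k *: y) s = k * tri t y s.
Proof. by rewrite /tri brZr frmZl. Qed.
Lemma triZr k y t s : tri t s (k *: y) = k * tri t s y.
Proof. by rewrite /tri frmZr. Qed.
Lemma triNl y t s : tri (- y) t s = - tri y t s.
Proof. by rewrite /tri brNl frmNl. Qed.
Lemma triNm y t s : tri t (- y) s = - tri t y s.
Proof. by rewrite /tri brNr frmNl. Qed.
Lemma triNr y t s : tri t s (- y) = - tri t s y.
Proof. by rewrite /tri frmNr. Qed.
Lemma tri0l t s : tri 0 t s = 0. Proof. by rewrite /tri br0l frm0l. Qed.
Lemma tri0m t s : tri t 0 s = 0. Proof. by rewrite /tri br0r frm0l. Qed.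
Lemma tri0r t s : tri t s 0 = 0. Proof. by rewrite /tri frm0r. Qed.

Definition triE := (triDl, triDm, triDr, triZl, triZm, triZr, triNl, triNm,
                    triNr, tri0l, tri0m, tri0r).

Lemma frm_nondeg x : (forall y, frm x y = 0) -> x = 0.
Proof. by move=> H; case: QL => _ _ _ + _; apply => //; rewrite memvf. Qed.

(** Pairing with an arbitrary [t] turns a vector identity into a scalar one, where [ring] and
    [field] apply; this is how most vector identities below are closed. *)
Lemma frm_eq x y : (forall t, frm x t = frm y t) -> x = y.
Proof.
move=> H; apply/eqP; rewrite -subr_eq0; apply/eqP/frm_nondeg => t.
by rewrite !frmE H subrr.
Qed.

(** [linfun] accepts the bare function [frm v]; its linearity is supplied in [mem_perp], where the
    kernel acquires its meaning. *)
Definition perp U v : {vspace L} :=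
  (U :&: lker (linfun (frm v : L -> F^o)))%VS.

Lemma mem_perp U v x : (x \in perp U v) = (x \in U) && (frm v x == 0).
Proof.
have lin_v : linear (frm v : L -> F^o) by move=> k y t; rewrite !frmE.
pose f : {linear L -> F^o} := HB.pack (frm v : L -> F^o)
  (GRing.isLinear.Build F _ _ *:%R (frm v : L -> F^o) lin_v).
by rewrite /perp memv_cap memv_ker (lfunE f).
Qed.

Lemma perp_sub U v : (perp U v <= U)%VS.
Proof. exact: capvSl. Qed.

Lemma perp_memW U v x : x \in perp U v -> x \in U.
Proof. by rewrite mem_perp => /andP[]. Qed.

Lemma perp_frm U v x : x \in perp U v -> frm v x = 0.
Proof. by rewrite mem_perp => /andP[_ /eqP]. Qed.

Lemma perpI U v x : x \in U -> frm v x = 0 -> x \in perp U v.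
Proof. by move=> xU /eqP vx; rewrite mem_perp xU. Qed.

Lemma dim_perp U v : (\dim U <= (\dim (perp U v)).+1)%N.
Proof.
rewrite -(limg_ker_dim (linfun (frm v : L -> F^o)) U) -addn1 leq_add2l.
by rewrite (leq_trans (dimvS (subvf _))) // dimvf.
Qed.

Lemma dim_perp_eq U v u :
  u \in U -> frm v u <> 0 -> \dim U = (\dim (perp U v)).+1.
Proof.
move=> uU vu; apply/eqP; rewrite eqn_leq dim_perp /= ltnNge; apply/negP => le.
have /eqP E : perp U v == U by rewrite eqEdim perp_sub.
by apply: vu; apply: (@perp_frm U); rewrite E.
Qed.

Lemma mem_dim0 U x : \dim U = 0%N -> x \in U -> x = 0.
Proof. by move/eqP; rewrite dimv_eq0 => /eqP ->; rewrite memv0 => /eqP. Qed.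

Lemma dim_gt0 U : (0 < \dim U)%N -> exists2 x, x \in U & x <> 0.
Proof.
rewrite lt0n dimv_eq0 => U0; exists (vpick U); first exact: memv_pick.
by apply/eqP; rewrite vpick0.
Qed.

Lemma frm_proj v y : frm v v <> 0 -> frm v (y - (frm v y / frm v v) *: v) = 0.
Proof. by move/eqP=> v0; rewrite !frmE divfK ?subrr. Qed.

Lemma perp_proj U v y : v \in U -> y \in U -> frm v v <> 0 ->
  y - (frm v y / frm v v) *: v \in perp U v.
Proof. by move=> vU yU v0; apply: perpI; rewrite ?frm_proj ?rpredB ?rpredZ. Qed.

Lemma perp_cases U v :
  (forall u, u \in U -> frm v u = 0) \/ (exists2 u, u \in U & frm v u <> 0).
Proof.
have [/subvP sub|/subvPn[u uU uN]] := boolP (U <= perp U v)%VS.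
  by left=> u /sub /perp_frm.
by right; exists u => // vu; rewrite mem_perp uU vu eqxx in uN.
Qed.

Lemma exists_nonperp U v : nondegenerate_on U -> v \in U -> v <> 0 ->
  exists2 u, u \in U & frm v u <> 0.
Proof.
move=> ndU vU v0; have [H|//] := perp_cases U v.
by case: v0; apply: ndU.
Qed.

Lemma exists_dual U v : nondegenerate_on U -> v \in U -> v <> 0 ->
  exists2 u, u \in U & frm v u = 1.
Proof.
move=> ndU vU v0; have [u uU /eqP vu] := exists_nonperp ndU vU v0.
by exists ((frm v u)^-1 *: u); rewrite ?rpredZ // frmE mulVf.
Qed.

Lemma nondeg_perp U v : nondegenerate_on U -> v \in U -> frm v v <> 0 ->
  nondegenerate_on (perp U v).
Proof.
move=> ndU vU vv x xP xn; apply: ndU => [|y yU]; first exact: perp_memW xP.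
rewrite -[y](subrK ((frm v y / frm v v) *: v)) frmDr xn ?perp_proj //.
by rewrite frmZr (frmC x) (perp_frm xP) mulr0 addr0.
Qed.

Lemma frm_polar x y : frm x y = (frm (x + y) (x + y) - frm x x - frm y y) / 2.
Proof. by rewrite !frmE (frmC y x); field. Qed.

Lemma isotropic_sub U : (forall x, x \in U -> frm x x = 0) ->
  forall x y, x \in U -> y \in U -> frm x y = 0.
Proof. by move=> H x y xU yU; rewrite frm_polar !H ?rpredD // !subr0 mul0r. Qed.

Lemma exists_aniso U : nondegenerate_on U -> (0 < \dim U)%N ->
  exists2 v, v \in U & frm v v <> 0.
Proof.
move=> ndU /dim_gt0[x xU x0]; have [y yU xy] := exists_nonperp ndU xU x0.
have [/eqP xx|/eqP xx] := boolP (frm x x == 0); last by exists x.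
have [/eqP yy|/eqP yy] := boolP (frm y y == 0); last by exists y.
exists (x + y); first exact: rpredD.
by move=> xyxy; apply: xy; rewrite frm_polar xyxy xx yy !subr0 mul0r.
Qed.

Lemma sqr_sign (b : bool) : ((-1) ^+ b) ^+ 2 = 1 :> F.
Proof. by case: b; rewrite ?expr0 ?expr1; ring. Qed.

(** Dividing by the square root of the absolute length leaves only a sign; the signs in front of the
    listed forms originate here. *)
Lemma normalize_frm v : frm v v <> 0 ->
  exists k (b : bool), k <> 0 /\ frm (k *: v) (k *: v) = (-1) ^+ b.
Proof.
move/eqP => v0; have p0 : 0 < `|frm v v| by rewrite normr_gt0.
exists (Num.sqrt `|frm v v|)^-1, (frm v v < 0); split.
  by apply/eqP; rewrite invr_eq0 sqrtr_eq0 -ltNge.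
rewrite !frmE mulrA -expr2 exprVn sqr_sqrtr ?ltW //.
by rewrite {2}[frm v v]realEsign ?num_real // mulrC mulfK // normr_eq0.
Qed.

Lemma exists_unit U : nondegenerate_on U -> (0 < \dim U)%N ->
  exists v (b : bool), v \in U /\ frm v v = (-1) ^+ b.
Proof.
move=> ndU /(exists_aniso ndU)[v vU /normalize_frm[k [b [_ kv]]]].
by exists (k *: v), b; rewrite rpredZ.
Qed.

Lemma isotropic_partner U h : nondegenerate_on U -> h \in U -> h <> 0 ->
  frm h h = 0 -> exists h', [/\ h' \in U, frm h h' = 1 & frm h' h' = 0].
Proof.
move=> ndU hU h0 hh; have [u uU hu] := exists_dual ndU hU h0.
(* As h is isotropic, this shift changes the length of u by -phi(u, u) and leaves phi(h, u) = 1
   untouched. *)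
exists (u - (frm u u / 2) *: h); split; rewrite ?rpredB ?rpredZ //.
  by rewrite !frmE hh hu mulr0 subr0.
by rewrite !frmE hh (frmC u h) hu; field.
Qed.

Lemma nondeg_hyp U h h' : nondegenerate_on U -> h \in U -> h' \in U ->
  frm h h = 0 -> frm h' h' = 0 -> frm h h' = 1 ->
  nondegenerate_on (perp (perp U h) h') /\
  \dim U = (\dim (perp (perp U h) h')).+2.
Proof.
move=> ndU hU h'U hh h'h' hh1; have n10 : (1 : F) <> 0 by apply/eqP/oner_neq0.
split; last first.
  rewrite (@dim_perp_eq U h h') ?hh1 //; congr _.+1.
  by apply: (@dim_perp_eq _ h' h); rewrite ?(frmC h') ?hh1 //; apply: perpI.
move=> x xP xn; have xU := perp_memW (perp_memW xP).
have xh := perp_frm (perp_memW xP); have xh' := perp_frm xP.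
(* [y'] is the part of y orthogonal to the hyperbolic plane; x is orthogonal to that plane, so it
   only sees [y']. *)
apply: ndU => // y yU; pose y' := y - frm h y *: h' - frm h' y *: h.
have y'P : y' \in perp (perp U h) h'.
  apply: perpI; first apply: perpI; rewrite ?(rpredB, rpredZ) // !frmE.
    by rewrite hh hh1; ring.
  by rewrite (frmC h' h) h'h' hh1; ring.
have -> : y = y' + frm h' y *: h + frm h y *: h' by rewrite /y' !subrK.
clearbody y'; by rewrite !frmE (xn y') // ![frm x _]frmC xh xh' !mulr0 !addr0.
Qed.

Lemma mem_hyp U h h' x :
  (x \in perp (perp U h) h') = [&& x \in U, frm h x == 0 & frm h' x == 0].
Proof. by rewrite !mem_perp andbA. Qed.

Lemma dim1_scal U v x : \dim U = 1%N -> v \in U -> frm v v <> 0 -> x \in U ->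
  x = (frm v x / frm v v) *: v.
Proof.
move=> dU vU v0 xU; apply/eqP; rewrite -subr_eq0; apply/eqP.
apply: (@mem_dim0 (perp U v)); last exact: perp_proj.
by have := dim_perp_eq vU v0; rewrite dU => -[].
Qed.

Lemma dim2_scal U v1 v2 x : \dim U = 2 -> v1 \in U -> v2 \in U ->
  frm v1 v1 <> 0 -> frm v2 v2 <> 0 -> frm v1 v2 = 0 -> x \in U ->
  x = (frm v1 x / frm v1 v1) *: v1 + (frm v2 x / frm v2 v2) *: v2.
Proof.
move=> dU v1U v2U v10 v20 v12 xU.
have d1 : \dim (perp U v1) = 1%N by have := dim_perp_eq v1U v10; rewrite dU => -[].
have := @dim1_scal _ v2 _ d1 _ v20 (perp_proj v1U xU v10).
rewrite perpI // => /(_ isT); rewrite !frmE (frmC v2 v1) v12 mulr0 subr0 => <-.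
by rewrite addrC subrK.
Qed.

Lemma ortho2 U : nondegenerate_on U -> \dim U = 2 ->
  exists v1 v2 (b1 b2 : bool), [/\ v1 \in U, v2 \in U, frm v1 v1 = (-1) ^+ b1,
    frm v2 v2 = (-1) ^+ b2 & frm v1 v2 = 0].
Proof.
move=> ndU dU; have [|v1 [b1 [v1U v1b]]] := exists_unit ndU; first by rewrite dU.
have v10 : frm v1 v1 <> 0 by rewrite v1b; apply/eqP; rewrite signr_eq0.
have d1 : \dim (perp U v1) = 1%N by have := dim_perp_eq v1U v10; rewrite dU => -[].
have [|v2 [b2 [v2U v2b]]] := exists_unit (nondeg_perp ndU v1U v10).
  by rewrite d1.
by exists v1, v2, b1, b2; split; rewrite ?(perp_memW v2U) ?(perp_frm v2U).
Qed.

Lemma frm_expand U v x : v \in U -> frm v v <> 0 -> x \in U ->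
  exists2 x', x' \in perp U v & x = (frm v x / frm v v) *: v + x'.
Proof.
move=> vU v0 xU; exists (x - (frm v x / frm v v) *: v); last by rewrite addrC subrK.
exact: perp_proj.
Qed.

End QuadraticLie.

(** * Isometries onto a table, from Gram and 3-form values on a frame *)

Section Frame.

Variables (F : rcfType) (L : quad_datum F) (n : nat).
Variables (t : seq ('I_n * 'I_n * 'rV[F]_n)) (q : ('I_n -> F) -> F).
Local Notation T := (table_datum t q).
Hypotheses (QL : quadratic_lie L) (QT : quadratic_lie T).
Variable e : 'I_n -> L.

Definition of_coord (u : 'rV[F]_n) : L := \sum_i u 0 i *: e i.

Fact of_coord_linear : linear of_coord.
Proof.
move=> k u v; rewrite /of_coord scaler_sumr -big_split /=.
by apply: eq_bigr => i _; rewrite !mxE scalerA scalerDl.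
Qed.

HB.instance Definition _ :=
  GRing.isLinear.Build F 'rV[F]_n L *:%R of_coord of_coord_linear.

Lemma of_coord_delta i : of_coord 'e_i = e i.
Proof.
rewrite /of_coord (bigD1 i) //= !mxE !eqxx scale1r big1 ?addr0 // => j ji.
by rewrite !mxE eqxx /= (negPf ji) scale0r.
Qed.

Lemma coord_fun_eq (f g : 'rV[F]_n -> F) :
  (forall k u v, f (k *: u + v) = k * f u + f v) ->
  (forall k u v, g (k *: u + v) = k * g u + g v) ->
  (forall i, f 'e_i = g 'e_i) -> f =1 g.
Proof.
move=> fl gl fg u.
have z (h : 'rV[F]_n -> F) : (forall k u v, h (k *: u + v) = k * h u + h v) -> h 0 = 0.
  move=> hl; have /eqP := hl 1 0 0.
  by rewrite scale1r addr0 mul1r -subr_eq subrr eq_sym => /eqP.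
rewrite [u]row_sum_delta; elim: (index_enum _) => [|i r IH].
  by rewrite !big_nil !z.
by rewrite !big_cons fl gl fg IH.
Qed.

Hypothesis frm_e : forall i j : 'I_n, (i <= j)%N ->
  frm (e i) (e j) = frm ('e_i : T) ('e_j : T).
Hypothesis tri_e : forall i j k : 'I_n, (i < j < k)%N ->
  tri (e i) (e j) (e k) = tri ('e_i : T) ('e_j : T) ('e_k : T).

Lemma of_coord_frm u v : frm (of_coord u) (of_coord v) = frm (u : T) (v : T).
Proof.
move: v; apply: coord_fun_eq => [k v w|k v w|j]; rewrite ?linearP ?(frmE QL) ?(frmE QT) //.
move: u; apply: coord_fun_eq => [k v w|k v w|i]; rewrite ?linearP ?(frmE QL) ?(frmE QT) //.
rewrite !of_coord_delta; case: (leqP i j) => [|/ltnW] ij; first exact: frm_e.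
by rewrite (frmC QL) (frmC QT) frm_e.
Qed.

(** Trilinearity reduces to basis triples; these are sorted by transpositions, and a repeated index
    gives 0 on both sides. *)
Lemma of_coord_tri u v w :
  tri (of_coord u) (of_coord v) (of_coord w) = tri (u : T) (v : T) (w : T).
Proof.
move: w; apply: coord_fun_eq => [k a b|k a b|k]; rewrite ?linearP ?(triE QL) ?(triE QT) //.
move: v; apply: coord_fun_eq => [l a b|l a b|j]; rewrite ?linearP ?(triE QL) ?(triE QT) //.
move: u; apply: coord_fun_eq => [l a b|l a b|i]; rewrite ?linearP ?(triE QL) ?(triE QT) //.
rewrite !of_coord_delta.
have [ij|ji|/val_inj ->] := ltngtP i j; last by rewrite (tri_xx QL) (tri_xx QT).
- have [jk|kj|/val_inj ->] := ltngtP j k; last by rewrite (tri_tx QL) (tri_tx QT).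
    by rewrite tri_e ?ij.
  rewrite (triCr QL) (triCr QT).
  have [ik|ki|/val_inj ->] := ltngtP i k; last by rewrite (tri_xx QL) (tri_xx QT).
    by rewrite tri_e ?ik.
  by rewrite (triC QL) (triC QT) tri_e ?ki.
rewrite (triC QL) (triC QT).
have [ik|ki|/val_inj ->] := ltngtP i k; last by rewrite (tri_tx QL) (tri_tx QT).
  by rewrite tri_e ?ji.
rewrite (triCr QL) (triCr QT).
have [jk|kj|/val_inj ->] := ltngtP j k; last by rewrite (tri_xx QL) (tri_xx QT).
  by rewrite tri_e ?jk.
by rewrite (triC QL) (triC QT) tri_e ?kj.
Qed.

(** Equal Gram matrices and nondegeneracy of T make [of_coord] injective, hence bijective by
    dimension. Brackets are compared only through [tri], which determines them. *)
Lemma table_isometric : \dim {: L} = n -> isometric L T.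
Proof.
move=> dL; pose f := linfun of_coord.
have fE u : f u = of_coord u by rewrite lfunE.
have f0 : lker f == 0%VS.
  rewrite -subv0; apply/subvP=> u; rewrite memv_ker fE memv0 => /eqP u0.
  apply/eqP/(frm_nondeg QT) => v.
  by rewrite -of_coord_frm u0 (frm0l QL).
have fi x : f (f^-1%VF x) = x.
  apply: limg_lfunVK; suff -> : limg f = fullv by rewrite memvf.
  apply/eqP; rewrite eqEdim subvf dL limg_dim_eq; last by rewrite (eqP f0) capv0.
  by rewrite dimvf /dim /= mul1n.
have fk : cancel f f^-1%VF := lker0_lfunK f0.
have ffrm x y : frm (f^-1%VF x : T) (f^-1%VF y : T) = frm x y.
  by rewrite -of_coord_frm -!fE !fi.
exists (f^-1%VF); split=> //; first by exists f.
move=> x y; apply: (frm_eq QT) => w.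
have -> : frm (br (f^-1%VF x : T) (f^-1%VF y : T)) w = tri x y (f w).
  by rewrite -[LHS]/(tri _ _ _) -of_coord_tri -!fE !fi.
by rewrite -[w in LHS]fk ffrm.
Qed.

End Frame.

(** * Centers and decompositions *)

Section Solvable.

Variables (F : rcfType) (L : quad_datum F).
Hypothesis QL : quadratic_lie L.
Implicit Types (x y t v : L) (U V W K Z P I : {vspace L}).

Definition central x := forall y, br x y = 0.

(** Built one basis vector at a time, so that [dim_perp] bounds the loss of dimension by the
    dimension of W. *)
Definition orth U W : {vspace L} := foldr (fun v V => perp V v) U (vbasis W).

Lemma orthP U W x :
  reflect (x \in U /\ forall w, w \in W -> frm w x = 0) (x \in orth U W).
Proof.
have foldP (s : seq L) : reflect (x \in U /\ forall w, w \in s -> frm w x = 0)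
    (x \in foldr (fun v V => perp V v) U s).
  elim: s => [|v s IH] /=; first by apply: (iffP idP) => [xU|[]//].
  rewrite (mem_perp QL); apply: (iffP andP) => [[/IH[xU H] /eqP vx]|[xU H]].
    by split=> // w; rewrite inE => /predU1P[->|/H].
  split; last by apply/eqP/H/mem_head.
  by apply/IH; split=> // w ws; apply: H; rewrite inE ws orbT.
apply: (iffP (foldP _)) => -[xU H]; split=> // w wW.
  rewrite (coord_vbasis wW); elim/big_rec: _ => [|i y _ IH].
    by rewrite (frmE QL).
  by rewrite !(frmE QL) H ?IH ?mulr0 ?addr0 // mem_nth ?size_tuple.
by apply: H; apply: vbasis_mem.
Qed.

Lemma dim_orth U W : (\dim U <= \dim (orth U W) + \dim W)%N.
Proof.
have H (s : seq L) :
    (\dim U <= \dim (foldr (fun v V => perp V v) U s) + size s)%N.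
  elim: s => [|v s IH] /=; first by rewrite addn0.
  by rewrite addnS -addSn (leq_trans IH) // leq_add2r dim_perp.
by have := H (vbasis W); rewrite size_tuple.
Qed.

Lemma proper_orth U W : (\dim W < \dim U)%N ->
  exists2 c, c \in U & c <> 0 /\ forall w, w \in W -> frm w c = 0.
Proof.
move=> lt_WU; have [|c /orthP[cU H] c0] := @dim_gt0 _ _ (orth U W).
  by rewrite -(ltn_add2r (\dim W)) add0n (leq_trans lt_WU) ?dim_orth.
by exists c.
Qed.

Lemma orth_sum U : nondegenerate_on U -> (U + orth fullv U = fullv)%VS.
Proof.
move=> ndU; apply/eqP; rewrite eqEdim subvf dimv_disjoint_sum.
  by rewrite addnC dim_orth.
apply/eqP; rewrite -subv0; apply/subvP=> x; rewrite memv_cap memv0.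
case/andP=> xU /orthP[_ H]; apply/eqP; apply: ndU => // y yU.
by rewrite (frmC QL) H.
Qed.

Lemma orth_nondeg U : nondegenerate_on U -> nondegenerate_on (orth fullv U).
Proof.
move=> ndU x xO H; apply: (frm_nondeg QL) => y.
have /memv_addP[u uU [v vO ->]] : y \in (U + orth fullv U)%VS.
  by rewrite orth_sum ?memvf.
have /orthP[_ xU] := xO.
by rewrite (frmE QL) (H v) // (frmC QL) xU // addr0.
Qed.

Lemma mem_lie_prod U V x y : x \in U -> y \in V -> br x y \in lie_prod U V.
Proof.
move=> xU yV; rewrite (coord_vbasis xU) (coord_vbasis yV).
elim/big_rec: _ => [|i a _ IH]; first by rewrite (brE QL) mem0v.
rewrite (brDl QL) (brZl QL) memvD // memvZ //.
elim/big_rec: _ {a IH} => [|j b _ IH]; first by rewrite (brE QL) mem0v.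
rewrite (brDr QL) (brZr QL) memvD // memvZ // memv_span //.
by apply/allpairsP; exists ((vbasis U)`_i, (vbasis V)`_j); rewrite !mem_nth ?size_tuple.
Qed.

Lemma lie_prod_sub U V W :
  (forall x y, x \in U -> y \in V -> br x y \in W) -> (lie_prod U V <= W)%VS.
Proof.
move=> H; apply/span_subvP=> _ /allpairsP[[x y] /= [xU yV ->]].
by apply: H; apply: vbasis_mem.
Qed.

Lemma lie_prodS U V U' V' :
  (U <= U')%VS -> (V <= V')%VS -> (lie_prod U V <= lie_prod U' V')%VS.
Proof.
move=> /subvP UU /subvP VV; apply: lie_prod_sub => x y /UU xU /VV yV.
exact: mem_lie_prod.
Qed.

(** Such a U lies in every term of the derived series, by induction on the term. *)
Lemma solvable_perfect U : solvable_lie L -> (U <= lie_prod U U)%VS -> U = 0%VS.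
Proof.
move=> [k k0] UP; apply/eqP; rewrite -subv0 -k0.
elim: k {k0} => [|k IH]; first exact: subvf.
exact: subv_trans UP (lie_prodS IH IH).
Qed.

(* The solvable algebra is (U + K) / K, represented by the nondegenerate subspace U. *)
Lemma solvable_center U K Z : solvable_lie L -> nondegenerate_on U ->
  (0 < \dim U)%N ->
  (forall x y, x \in U -> y \in U -> br x y \in (U + K)%VS) ->
  (forall x y, x \in K -> y \in (U + K)%VS -> br x y \in Z) ->
  (forall x, x \in Z -> central x) ->
  (forall x y, x \in U -> y \in K -> frm x y = 0) ->
  (Z <= K)%VS ->
  exists2 c, c \in U & c <> 0 /\ (forall x y, x \in U -> y \in U -> tri c x y = 0).
Proof.
move=> sol ndU U0 UU KU Zc UK ZK; pose P := lie_prod U U.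
have PUK : (P <= U + K)%VS by apply: lie_prod_sub.
have PP x y : x \in U -> y \in U -> br x y \in P by apply: mem_lie_prod.
(* If the derived part does not fill U modulo K, some nonzero c in U is orthogonal to it, and then
   tri c x y = phi([x, y], c) vanishes. *)
have [UPK|NUPK] := boolP (U <= P + K)%VS; last first.
  have [|c cU [c0 cH]] := @proper_orth U ((P + K) :&: U)%VS.
    rewrite ltnNge; apply: contra NUPK => le.
    have /eqP <- : ((P + K) :&: U == U)%VS by rewrite eqEdim capvSr.
    exact: capvSl.
  exists c => //; split=> // x y xU yU; rewrite (triR QL) /tri.
  have /memv_addP[u uU [k kK E]] := subvP PUK _ (PP _ _ xU yU).
  rewrite E (frmDl QL) [frm k c](frmC QL) (UK c) // addr0 cH // memv_cap uU andbT.
  have -> : u = br x y - k by rewrite E addrK.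
  by rewrite memvB // ?(subvP (addvSl _ _) _ (PP _ _ xU yU)) ?(subvP (addvSr _ _)).
(* Otherwise U is perfect modulo K. Brackets with K are central, so [P, P] is perfect on the nose
   and vanishes by solvability; then P lies in Z, U lies in K, and U is orthogonal to itself. *)
exfalso; have PZ : (P <= lie_prod P P + Z)%VS.
  apply: lie_prod_sub => x y /(subvP UPK)/memv_addP[p pP [k kK ->]].
  move=> /(subvP UPK)/memv_addP[p' p'P [k' k'K ->]].
  have Kin w w' : w \in K -> w' \in (U + K)%VS -> br w w' \in (lie_prod P P + Z)%VS.
    by move=> wK w'U; apply: (subvP (addvSr _ _)); apply: KU.
  rewrite !(brE QL) !memvD //.
  - by apply: (subvP (addvSl _ _)); apply: mem_lie_prod.
  - by rewrite (brC QL) memvN Kin // (subvP PUK).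
  - by rewrite Kin // (subvP PUK).
  - by rewrite Kin // (subvP (addvSr _ _)).
have P20 : lie_prod P P = 0%VS.
  apply: (solvable_perfect sol); apply: lie_prod_sub => x y.
  move=> /(subvP PZ)/memv_addP[p pP [z zZ ->]].
  move=> /(subvP PZ)/memv_addP[p' p'P [z' z'Z ->]].
  rewrite !(brE QL) (Zc _ zZ) [br p z'](brC QL) (Zc _ z'Z) (Zc _ zZ) oppr0 !addr0.
  exact: mem_lie_prod.
have PK : (P <= K)%VS by rewrite (subv_trans PZ) // P20 add0v.
have UsK : (U <= K)%VS by rewrite (subv_trans UPK) // subv_add PK subvv.
have [x xU] := dim_gt0 U0; apply.
by apply: ndU => // y yU; apply: UK => //; apply: (subvP UsK).
Qed.

Lemma tri_central x : (forall y t, tri x y t = 0) -> central x.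
Proof. by move=> H y; apply: (frm_nondeg QL) => t; apply: H. Qed.

Lemma central_tri x y t : central x -> tri x y t = 0.
Proof. by move=> cx; rewrite /tri cx (frm0l QL). Qed.

Lemma exists_central : solvable_lie L -> (0 < \dim {: L})%N ->
  exists2 z : L, z <> 0 & central z.
Proof.
move=> sol L0; have ndL : nondegenerate_on (fullv : {vspace L}) by case: QL.
have [] := @solvable_center fullv 0%VS 0%VS => //.
- by move=> x y _ _; rewrite addv0 memvf.
- by move=> x y; rewrite memv0 => /eqP -> _; rewrite (br0l QL) mem0v.
- by move=> x; rewrite memv0 => /eqP -> y; rewrite (br0l QL).
- by move=> x y _; rewrite memv0 => /eqP ->; rewrite (frmE QL).
move=> z _ [z0 H]; exists z => //; apply: tri_central => y t.
by rewrite H ?memvf.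
Qed.

Definition isotropic_center := forall x, central x -> frm x x = 0.

Lemma isotropic_center_frm x y : isotropic_center -> central x -> central y ->
  frm x y = 0.
Proof.
move=> H cx cy; rewrite (frm_polar QL) !H ?subr0 ?mul0r //.
by move=> t; rewrite (brDl QL) cx cy addr0.
Qed.

(** A central vector of nonzero length spans a nondegenerate ideal, proper because the dimension
    exceeds 1. *)
Lemma indecomposable_center : indecomposable L -> (1 < \dim {: L})%N ->
  isotropic_center.
Proof.
move=> ind L1 x cx; apply/eqP/negPn/negP => /eqP xx; apply: ind.
exists <[x]>%VS; split.
- move=> u _ /vlineP[k ->]; rewrite (brZr QL) (brC QL) cx oppr0 scaler0.
  exact: mem0v.
- by rewrite -dimv_eq0 dim_vline; apply/negP; rewrite eqb0 negbK => /eqP x0;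
    by apply: xx; rewrite x0 (frmE QL).
- by apply/negP => /eqP E; rewrite -E dim_vline in L1; case: (x != 0) L1.
- move=> _ /vlineP[k ->] /(_ x (memv_line x)); rewrite (frmZl QL) => /eqP.
  by rewrite mulf_eq0 (introF eqP xx) orbF => /eqP ->; rewrite scale0r.
Qed.

(** I contains a central z, which is isotropic and has a partner b in I. In dimension at most 3 the
    complement of z and b in I is at most a line, so no alternating 3-form on I avoids z; hence b is
    central too, and phi(z, b) = 1 contradicts isotropy of the center. *)
Lemma small_ideal I : solvable_lie L -> isotropic_center -> lie_ideal I ->
  nondegenerate_on I -> (0 < \dim I)%N -> (3 < \dim I)%N.
Proof.
move=> sol iso idI ndI I0.
have idI' x y : x \in I -> br x y \in I by move=> xI; rewrite (brC QL) memvN idI.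
(* L is the orthogonal sum of I and its complement, and brackets with I stay in I, so only the
   components in I contribute to [tri c]. *)
have cent c : c \in I -> (forall x y, x \in I -> y \in I -> tri c x y = 0) -> central c.
  move=> cI H; apply: tri_central => x y.
  have dec w : exists2 u, u \in I & exists2 v, v \in orth fullv I & w = u + v.
    have /memv_addP[u uI [v vO E]] : w \in (I + orth fullv I)%VS.
      by rewrite orth_sum ?memvf.
    by exists u => //; exists v.
  have T u v : v \in orth fullv I -> tri c u v = 0.
    by case/orthP=> _; apply; apply: idI'.
  have [x1 x1I [x2 x2O ->]] := dec x; have [y1 y1I [y2 y2O ->]] := dec y.
  by rewrite !(triE QL) H // !(T _ _ y2O) (triCr QL) T // oppr0 !addr0.
have [] := @solvable_center I 0%VS 0%VS => //.
- by move=> x y _ xI; rewrite addv0 idI.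
- by move=> x y; rewrite memv0 => /eqP -> _; rewrite (br0l QL) mem0v.
- by move=> x; rewrite memv0 => /eqP -> y; rewrite (br0l QL).
- by move=> x y _; rewrite memv0 => /eqP ->; rewrite (frmE QL).
move=> z zI [z0 Hz]; have cz := cent z zI Hz; have zz := iso z cz.
have [b [bI zb bb]] := isotropic_partner QL ndI zI z0 zz.
have [_ dI] := nondeg_hyp QL ndI zI bI zz bb zb.
rewrite ltnNge; apply/negP => le3.
suff cb : central b.
  by have := isotropic_center_frm iso cz cb; rewrite zb => /eqP; rewrite oner_eq0.
apply: cent => // x y xI yI.
pose Q := perp (perp I z) b.
have dQ : (\dim Q <= 1)%N by rewrite dI in le3.
have dec w : w \in I -> exists2 u, u \in Q & exists k m, w = u + (k *: z + m *: b).
  move=> wI; exists (w - (frm b w *: z + frm z w *: b)).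
    rewrite (mem_hyp QL) memvB ?memvD ?memvZ //= !(frmE QL) zz zb bb (frmC QL b z) zb.
    by rewrite !(mulr0, mulr1, addr0, add0r) !subrr eqxx.
  by exists (frm b w), (frm z w); rewrite subrK.
have [x1 x1Q [k [m ->]]] := dec x xI; have [y1 y1Q [k' [m' ->]]] := dec y yI.
rewrite !(triE QL) !(tri_xx QL) !(tri_xt QL) ![tri b z _](triC QL).
rewrite ![tri b _ z](triR QL) ![tri _ z b](triR QL) !(central_tri _ _ cz).
rewrite !(mulr0, oppr0, addr0).
have [x10|x10] := eqVneq x1 0; first by rewrite x10 (triE QL).
suff /vlineP[j ->] : y1 \in <[x1]>%VS by rewrite (triE QL) (tri_tx QL) mulr0.
have /eqP -> // : (<[x1]> == Q)%VS.
by rewrite eqEdim -memvE x1Q dim_vline x10.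
Qed.

(** By invariance the complement of a nondegenerate ideal is an ideal as well; both have dimension
    at least 4, for a total of at least 8. *)
Lemma isotropic_center_indecomposable : solvable_lie L -> isotropic_center ->
  (\dim {: L} <= 7)%N -> indecomposable L.
Proof.
move=> sol iso L7 [I [idI I0 I1 ndI]].
pose J := orth fullv I.
have ndJ : nondegenerate_on J by apply: orth_nondeg.
have idJ : lie_ideal J.
  move=> x y /orthP[_ yJ]; apply/orthP; split=> [|w wI]; first exact: memvf.
  by rewrite (frmC QL) (br_skew QL) (frmC QL) yJ ?oppr0 // idI.
have disj : (I :&: J = 0)%VS.
  apply/eqP; rewrite -subv0; apply/subvP=> x; rewrite memv_cap memv0.
  case/andP=> xU /orthP[_ H]; apply/eqP; apply: ndI => // y yU.
  by rewrite (frmC QL) H.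
have dIJ : (\dim I + \dim J = \dim {: L})%N.
  by rewrite -dimv_disjoint_sum // orth_sum.
have dI : (0 < \dim I)%N by rewrite lt0n dimv_eq0.
have dJ : (0 < \dim J)%N.
  rewrite lt0n; apply: contra I1 => /eqP J0.
  by rewrite eqEdim subvf -dIJ J0 addn0 leqnn.
have gI := small_ideal sol iso idI ndI dI.
have gJ := small_ideal sol iso idJ ndJ dJ.
by have := leq_add gI gJ; rewrite dIJ => /leq_trans/(_ L7).
Qed.

Lemma solvable_chain (U : nat -> {vspace L}) k : U 0%N = fullv -> U k = 0%VS ->
  (forall i x y, x \in U i -> y \in U i -> br x y \in U i.+1) -> solvable_lie L.
Proof.
move=> U0 Uk H; exists k; apply/eqP; rewrite -subv0 -Uk.
elim: k {Uk} => [|k IH]; first by rewrite U0 subvf.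
by apply: lie_prod_sub => x y /(subvP IH) ? /(subvP IH) ?; apply: H.
Qed.

End Solvable.

(** * Reduction to a skew operator *)

Section Reduction.

Variables (F : rcfType) (L : quad_datum F).
Hypothesis QL : quadratic_lie L.
Implicit Types (x y t v w h : L) (U P : {vspace L}).

Local Notation central := (@central F L).

Lemma centralD x y : central x -> central y -> central (x + y).
Proof. by move=> cx cy t; rewrite (brE QL) cx cy addr0. Qed.

Lemma centralZ k x : central x -> central (k *: x).
Proof. by move=> cx t; rewrite (brE QL) cx scaler0. Qed.

Lemma tri_centralm x y t : central y -> tri x y t = 0.
Proof. by move=> cy; rewrite (triC QL) (central_tri QL) // oppr0. Qed.

Lemma tri_centralr x y t : central t -> tri x y t = 0.
Proof. by move=> ct; rewrite -(triR QL) (central_tri QL). Qed.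

(** An alternating 3-form on the span of four vectors and the center is determined by its four
    values on triples of those vectors. The decompositions are existential so that [shift_center]
    can feed them directly. *)
Lemma tri_vanish_span h v1 v2 v3 :
  tri h v1 v2 = 0 -> tri h v1 v3 = 0 -> tri h v2 v3 = 0 -> tri v1 v2 v3 = 0 ->
  forall x y t,
  (exists k k1 k2 k3 s, central s /\
     x = k *: h + k1 *: v1 + k2 *: v2 + k3 *: v3 + s) ->
  (exists k k1 k2 k3 s, central s /\
     y = k *: h + k1 *: v1 + k2 *: v2 + k3 *: v3 + s) ->
  (exists k k1 k2 k3 s, central s /\
     t = k *: h + k1 *: v1 + k2 *: v2 + k3 *: v3 + s) ->
  tri x y t = 0.
Proof.
move=> h12 h13 h23 h123 x y t.
have perm (u1 u2 u3 : L) : tri u1 u2 u3 = 0 ->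
    (((tri u1 u2 u3 = 0) * (tri u2 u3 u1 = 0) * (tri u3 u1 u2 = 0)) *
    ((tri u2 u1 u3 = 0) * (tri u1 u3 u2 = 0) * (tri u3 u2 u1 = 0)))%type.
  move=> e; have e2 : tri u2 u3 u1 = 0 by rewrite -(triR QL).
  have e3 : tri u3 u1 u2 = 0 by rewrite (triR QL).
  do !split=> //.
  - by rewrite (triC QL) e oppr0.
  - by rewrite (triC QL) e3 oppr0.
  - by rewrite (triC QL) e2 oppr0.
have {}h12 := perm _ _ _ h12; have {}h13 := perm _ _ _ h13.
have {}h23 := perm _ _ _ h23; have {}h123 := perm _ _ _ h123.
move=> [k [k1 [k2 [k3 [s [sc ->]]]]]] [l [l1 [l2 [l3 [r [rc ->]]]]]].
move=> [m [m1 [m2 [m3 [q [qc ->]]]]]].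
rewrite (triDl QL _ s) (central_tri QL _ _ sc) addr0.
rewrite (triDm QL _ r) (tri_centralm _ _ rc) addr0.
rewrite (triDr QL _ q) (tri_centralr _ _ qc) addr0.
rewrite !(triE QL). rewrite ?(tri_xx QL, tri_xt QL, tri_tx QL, h12, h13, h23, h123).
by rewrite  !(mulr0, addr0).
Qed.

Lemma mem_add_notin U v : v \notin U -> \dim (U + <[v]>)%VS = (\dim U).+1.
Proof.
move=> vU; rewrite dimv_disjoint_sum ?dim_vline; last first.
  apply/eqP; rewrite -subv0; apply/subvP=> x /memv_capP[kU /vlineP[k E]].
  rewrite memv0; rewrite {x}E in kU *; have [->|k0] := eqVneq k 0; first by rewrite scale0r.
  by case/negP: vU; rewrite -[v]scale1r -(mulVf k0) -scalerA memvZ.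
by case: eqP vU => [->|_ _]; rewrite ?mem0v ?addn1.
Qed.

(** Either p, x, y are dependent, or they span U and t is a combination of them. *)
Lemma tri_vanish3 U p : (\dim U <= 3)%N -> p \in U -> p <> 0 ->
  (forall x y, x \in U -> y \in U -> tri p x y = 0) ->
  forall x y t, x \in U -> y \in U -> t \in U -> tri x y t = 0.
Proof.
move=> d3 pU p0 H x y t xU yU tU.
have Hm u v : u \in U -> v \in U -> tri u p v = 0.
  by move=> uU vU; rewrite (triC QL) H // oppr0.
have Hr u v : u \in U -> v \in U -> tri u v p = 0.
  by move=> uU vU; rewrite -(triR QL) H.
have [/vlineP[k ->]|xp] := boolP (x \in <[p]>%VS).
  by rewrite (triE QL) H // mulr0.
have d2 := mem_add_notin xp; rewrite dim_vline (introN eqP p0) in d2.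
have [/memv_addP[_ /vlineP[k ->] [_ /vlineP[m ->] ->]]|ypx] :=
    boolP (y \in <[p]> + <[x]>)%VS.
  by rewrite !(triE QL) Hm // (tri_xx QL) !mulr0 addr0.
have d3' := mem_add_notin ypx; rewrite d2 in d3'.
have /eqP E : (<[p]> + <[x]> + <[y]> == U)%VS.
  by rewrite eqEdim d3' d3 !subv_add -!memvE pU xU yU.
move: (tU); rewrite -E => /memv_addP[_ /memv_addP[_ /vlineP[k ->] [_ /vlineP[m ->] ->]]].
move=> [_ /vlineP[l ->] ->].
by rewrite !(triE QL) Hr // (tri_xt QL) (tri_tx QL) !mulr0 !addr0.
Qed.

(** An alternating bilinear form in odd dimension is degenerate. Given v1 outside the radical, take
    v2 independent of v1 and paired to 0 with it, and w not paired to 0 with v1; a multiple of v1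
    corrects v2 against w. *)
Lemma tri_kernel3 U h : \dim U = 3 ->
  exists2 u, u \in U & u <> 0 /\ forall x, x \in U -> tri h u x = 0.
Proof.
move=> d3; have [|v1 v1U v10] := @dim_gt0 _ _ U; first by rewrite d3.
have [H|[w wU wv]] := perp_cases QL U (br h v1); first by exists v1.
pose K := perp U (br h v1).
have dK : \dim K = 2 by have := dim_perp_eq QL wU wv; rewrite d3 => -[].
have [/subvP sub|/subvPn[v2 v2K v2n]] := boolP (K <= <[v1]>)%VS.
  have : (\dim K <= 1)%N.
    by rewrite (leq_trans (dimvS (introT subvP sub))) // dim_vline leq_b1.
  by rewrite dK.
have v2U := perp_memW QL v2K; have v12 : tri h v1 v2 = 0 := perp_frm QL v2K.
pose m := tri h v2 w / tri h v1 w; exists (v2 - m *: v1); first by rewrite memvB ?memvZ.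
split.
  move/eqP; rewrite subr_eq0 => /eqP E.
  by case/negP: v2n; rewrite E; apply/vlineP; exists m.
have dv := mem_add_notin v2n; rewrite dim_vline (introN eqP v10) in dv.
have wn : w \notin (<[v1]> + <[v2]>)%VS.
  apply/negP=> /memv_addP[x1 /vlineP[k E1] [x2 /vlineP[l E2] wE]]; apply: wv.
  by rewrite wE E1 E2 -/(tri h v1 _) !(triE QL) (tri_tx QL) v12 !mulr0 addr0.
have dw := mem_add_notin wn; rewrite dv in dw.
have /eqP E : (<[v1]> + <[v2]> + <[w]> == U)%VS.
  by rewrite eqEdim dw d3 !subv_add -!memvE v1U wU v2U.
move=> x; rewrite -E.
move=> /memv_addP[_ /memv_addP[_ /vlineP[k ->] [_ /vlineP[l ->] ->]]].
move=> [_ /vlineP[j ->] ->].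
rewrite !(triE QL) !(tri_tx QL) (triCr QL h v2 v1) v12 /m.
have /eqP w0 : tri h v1 w <> 0 by [].
by field.
Qed.

(** * The complement V of a hyperbolic pair a, z with z central *)

Section Extension.

Variables a z : L.
Hypotheses (cz : central z) (zz : frm z z = 0) (aa : frm a a = 0)
  (za : frm z a = 1).
Let V := perp (perp fullv z) a.

Let az : frm a z = 1. Proof. by rewrite (frmC QL). Qed.

Lemma extP x : reflect (frm z x = 0 /\ frm a x = 0) (x \in V).
Proof.
rewrite (mem_hyp QL) memvf /=.
by apply: (iffP andP) => -[] => [/eqP ? /eqP ?|-> ->].
Qed.

Lemma ext_nondeg : nondegenerate_on V.
Proof.
have ndL : nondegenerate_on (fullv : {vspace L}) by case: QL.
by have [] := nondeg_hyp QL ndL (memvf _) (memvf _) zz aa za.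
Qed.

Lemma ext_dim : \dim {: L} = (\dim V).+2.
Proof.
have ndL : nondegenerate_on (fullv : {vspace L}) by case: QL.
by have [] := nondeg_hyp QL ndL (memvf _) (memvf _) zz aa za.
Qed.

Lemma ext_decomp x : exists2 v, v \in V & x = frm a x *: z + frm z x *: a + v.
Proof.
exists (x - (frm a x *: z + frm z x *: a)); last by rewrite addrC subrK.
by apply/extP; rewrite !(frmE QL) zz aa az za; split; ring.
Qed.

Lemma ext_br x : br a x \in V.
Proof.
apply/extP; split; first by rewrite (frmC QL) -/(tri a x z) tri_centralr.
by rewrite (frmC QL) -/(tri a x a) (tri_xt QL).
Qed.

Lemma ext_skew x y : frm (br a x) y = - frm x (br a y).
Proof. by rewrite (br_skew QL). Qed.

(** The Jacobi identity for a, x, y paired with t: the derivation ad a annihilates the 3-form. *)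
Lemma ext_deriv x y t : tri (br a x) y t + tri x (br a y) t + tri x y (br a t) = 0.
Proof.
have := congr1 (fun u => frm u t) (jacobi QL a x y).
rewrite (frmDl QL) [in LHS](br_skew QL) (frmC QL) /tri => E.
rewrite -E (frmC QL (br a t)); ring.
Qed.

Lemma ext_tri_perp :
  (forall x y t, x \in V -> y \in V -> t \in V -> tri x y t = 0) ->
  forall x y t, frm z x = 0 -> frm z y = 0 -> frm z t = 0 -> tri x y t = 0.
Proof.
move=> H x y t; have [x' x'V E] := ext_decomp x; have [y' y'V E'] := ext_decomp y.
have [t' t'V E''] := ext_decomp t => x0 y0 t0; rewrite E E' E'' x0 y0 t0 !scale0r !addr0.
by rewrite !(triE QL) ?(central_tri QL _ _ cz) ?(tri_centralm _ _ cz)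
  ?(tri_centralr _ _ cz) !(mulr0, addr0, add0r) H.
Qed.

(** The radical of the 3-form on V. It is stable under ad a ([kern_br]), and its vectors killed by
    ad a are central in L ([kern_central]). *)
Definition kern c := c \in V /\ forall x y, x \in V -> y \in V -> tri c x y = 0.

Lemma kernD c c' : kern c -> kern c' -> kern (c + c').
Proof.
move=> [cV H] [c'V H']; split=> [|x y xV yV]; first exact: memvD.
by rewrite (triE QL) H // H' // addr0.
Qed.

Lemma kernZ k c : kern c -> kern (k *: c).
Proof.
move=> [cV H]; split=> [|x y xV yV]; first exact: memvZ.
by rewrite (triE QL) H // mulr0.
Qed.

Lemma kern_br c : kern c -> kern (br a c).
Proof.
move=> [cV H]; split=> [|x y xV yV]; first exact: ext_br.
by have := ext_deriv c x y; rewrite !H ?ext_br // !addr0.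
Qed.

Lemma kern_central c : kern c -> br a c = 0 -> central c.
Proof.
move=> [cV H] ac; apply: (tri_central QL) => x y.
have [x' x'V ->] := ext_decomp x; have [y' y'V ->] := ext_decomp y.
have ca t : tri c a t = 0 by rewrite (triC QL) /tri ac (frmE QL) oppr0.
have ca' t : tri c t a = 0 by rewrite (triCr QL) ca oppr0.
rewrite !(triE QL) !(ca, ca') (H x' y') // !(tri_centralm _ _ cz).
by rewrite !(tri_centralr _ _ cz) !(mulr0, addr0).
Qed.

(** Induction on a nondegenerate U whose complement in V lies in the radical. Solvability of U
    modulo z gives a nonzero c in U that is again in the radical; if c is not isotropic it is split
    off from U. Reaching U = 0 would put all of V in the radical, against the nonvanishing of the
    3-form. *)
Lemma kern_isotropic : solvable_lie L ->
  (exists x y t, [/\ x \in V, y \in V, t \in V & tri x y t <> 0]) ->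
  exists c, [/\ kern c, c <> 0 & frm c c = 0].
Proof.
move=> sol [x0 [y0 [t0 [x0V y0V t0V ne]]]].
suff H n U : \dim U = n -> (U <= V)%VS -> nondegenerate_on U ->
    (forall v, v \in V -> (forall u, u \in U -> frm u v = 0) -> kern v) ->
    exists c, [/\ kern c, c <> 0 & frm c c = 0].
  apply: (H _ V erefl) => //; first exact: ext_nondeg.
  move=> v vV vn; have -> : v = 0.
    by apply: ext_nondeg => // u uV; rewrite (frmC QL) vn.
  by split=> [|x y]; rewrite ?mem0v ?(triE QL).
elim: n U => [|n IH] U dU /subvP UV ndU UC.
  case: ne; have [|_ H] := UC x0 x0V; last exact: H.
  by move=> u /(mem_dim0 dU) ->; rewrite (frmE QL).
have [||||||c cU [c0 cH]] := @solvable_center _ _ QL U <[z]>%VS <[z]>%VS sol ndU.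
- by rewrite dU.
(* The part v of [x, y] in V is orthogonal to the radical, which contains the complement of U in V;
   so v has no component w in that complement. *)
- move=> x y xU yU; pose v := br x y - frm a (br x y) *: z.
  have vV : v \in V.
    apply/extP; rewrite !(frmE QL) zz az (frmC QL z) -/(tri x y z) tri_centralr //.
    by split; ring.
  have /memv_addP[u uU [w wO E]] : v \in (U + orth fullv U)%VS.
    by rewrite orth_sum ?memvf.
  have /(orthP QL)[_ wU] := wO.
  have wV : w \in V by rewrite -[w](addKr u) -E addrC memvB // UV.
  have vn w' : kern w' -> frm v w' = 0.
    move=> kw'; have [w'V w'H] := kw'; have /extP[w'z _] := w'V.
    by rewrite !(frmE QL) w'z mulr0 oppr0 addr0 -/(tri x y w') -(triR QL) w'H // UV.
  have w0 : w = 0.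
    apply: ext_nondeg => // w' w'V.
    have /memv_addP[u' u'U [w2 w2O E']] : w' \in (U + orth fullv U)%VS.
      by rewrite orth_sum ?memvf.
    have /(orthP QL)[_ w2U] := w2O.
    have w2V : w2 \in V by rewrite -[w2](addKr u') -E' addrC memvB // UV.
    have kw2 := UC w2 w2V w2U; have := vn _ kw2.
    by rewrite E E' !(frmE QL) (w2U u) // (frmC QL w u') wU // !add0r.
  apply/memv_addP; exists v; first by rewrite E w0 addr0.
  exists (frm a (br x y) *: z); last by rewrite subrK.
  by rewrite memvZ // memv_line.
- by move=> x y /vlineP[k ->] _; rewrite (brE QL) cz scaler0 mem0v.
- by move=> _ /vlineP[k ->]; apply: centralZ.
- move=> x _ /UV/extP[xz _] /vlineP[k ->].
  by rewrite (frmE QL) (frmC QL) xz mulr0.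
- exact: subvv.
have kc : kern c.
  split=> [|x y xV yV]; first exact: UV.
  have dec v : v \in V -> exists2 u, u \in U & exists2 w, kern w & v = u + w.
    move=> vV; have /memv_addP[u uU [w /(orthP QL)[_ wU] E]] : v \in (U + orth fullv U)%VS.
      by rewrite orth_sum ?memvf.
    exists u => //; exists w => //; apply: UC => //.
    by rewrite -[w](addKr u) -E addrC memvB // UV.
  have [u uU [w [wV wH] ->]] := dec x xV; have [u' u'U [w' [w'V w'H] ->]] := dec y yV.
  have cV := UV _ cU.
  rewrite !(triE QL) cH // [tri c w _](triC QL) [tri c w w'](triC QL) !wH // ?UV //.
  by rewrite -(triR QL) w'H ?UV // oppr0 !addr0.
have [cc|cc] := classic (frm c c = 0); first by exists c.
apply: (IH (perp U c)).
- by have := dim_perp_eq QL cU cc; rewrite dU => -[].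
- by rewrite (subv_trans (perp_sub _ _)) //; apply/subvP.
- exact: nondeg_perp.
move=> v vV vH; rewrite -[v](subrK ((frm c v / frm c c) *: c)).
apply: kernD; last exact: kernZ.
apply: UC => [|u uU]; first by rewrite memvB ?memvZ // UV.
have [u' u'P ->] := frm_expand QL cU cc uU.
rewrite (frmDl QL) (frmZl QL) frm_proj // mulr0 add0r (frmDr QL) vH // add0r.
by rewrite (frmNr QL) (frmZr QL) (frmC QL u') (perp_frm QL u'P) mulr0 oppr0.
Qed.

(** Here c is central. The complement of c - m z is spanned by a + m c', u1, u2, p and central
    vectors, and the only triple on which [tri] may survive is (a + m c', u1, u2); m is the solution
    of tri a u1 u2 + m tri c' u1 u2 = 0. *)
Lemma shift_center c c' u1 u2 p : kern c -> c <> 0 -> br a c = 0 ->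
  c' \in V -> u1 \in V -> u2 \in V -> kern p -> frm c c' = 1 ->
  tri c' u1 u2 <> 0 -> tri a u1 p = 0 -> tri a u2 p = 0 ->
  (forall x, x \in V -> exists k1 k2 k3 k4,
     x = frm c x *: c' + k1 *: u1 + k2 *: u2 + k3 *: p + k4 *: c) ->
  exists z', [/\ z' <> 0, central z' & forall x y t,
    frm z' x = 0 -> frm z' y = 0 -> frm z' t = 0 -> tri x y t = 0].
Proof.
move=> kc c0 ac c'V u1V u2V kp cc' /eqP nb a1p a2p exp.
have cc := kern_central kc ac; have [cV _] := kc; have [pV pH] := kp.
pose m := - tri a u1 u2 / tri c' u1 u2; exists (c - m *: z); split.
- move=> E; have := cc'; rewrite (_ : c = m *: z); last by apply/eqP; rewrite -subr_eq0 E.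
  have /extP[c'z _] := c'V.
  by rewrite (frmE QL) c'z mulr0 => /esym/eqP; rewrite oner_eq0.
- by apply: centralD => //; rewrite -scaleNr; apply: centralZ.
have dec x : frm (c - m *: z) x = 0 -> exists k k1 k2 k3 s, central s /\
    x = k *: (a + m *: c') + k1 *: u1 + k2 *: u2 + k3 *: p + s.
  rewrite !(frmE QL) => /eqP; rewrite subr_eq0 => /eqP cx.
  have [v vV xE] := ext_decomp x; have [k1 [k2 [k3 [k4 vE]]]] := exp v vV.
  have cv : frm c v = m * frm z x.
    rewrite -cx [in RHS]xE !(frmE QL); have /extP[cz' ca'] := cV.
    by rewrite [frm c z](frmC QL) [frm c a](frmC QL) cz' ca' !mulr0 !add0r.
  exists (frm z x), k1, k2, k3, (frm a x *: z + k4 *: c); split.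
    by apply: centralD; apply: centralZ.
  rewrite [LHS]xE vE cv; apply: (frm_eq QL) => w.
  by rewrite !(frmE QL); ring.
move=> x y t /dec dx /dec dy /dec dt; apply: tri_vanish_span dx dy dt => //.
- by rewrite !(triE QL) /m; field.
- by rewrite !(triE QL) a1p -(triR QL) pH // mulr0 addr0.
- by rewrite !(triE QL) a2p -(triR QL) pH // mulr0 addr0.
- by rewrite -(triR QL) pH.
Qed.

End Extension.

End Reduction.

(** * Choosing the central vector *)

Section ReductionCases.

Variables (F : rcfType) (L : quad_datum F).
Hypothesis QL : quadratic_lie L.
Implicit Types (x y t v w h : L) (U P : {vspace L}).

(** States that z^perp / z is an abelian Lie algebra, without forming the quotient. *)
Definition abelian_type := exists z : L, [/\ z <> 0, central z &
  forall x y t, frm z x = 0 -> frm z y = 0 -> frm z t = 0 -> tri x y t = 0].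

Section KernelPlanes.

Variables a z : L.
Hypotheses (cz : central z) (zz : frm z z = 0) (aa : frm a a = 0)
  (za : frm z a = 1).
Local Notation V := (perp (perp fullv z) a).
Local Notation kern := (kern a z).
Let shift := shift_center QL cz zz aa za.

Lemma dual_neq0 x y : frm x y = 1 -> x <> 0.
Proof. by move=> + x0; rewrite x0 (frmE QL) => /esym/eqP; rewrite oner_eq0. Qed.

(** The 3-form has the single essential value tri c' v1 v2, so its radical is spanned by c and p. It
    then suffices that ad a kills c, for [shift_center] to apply. *)
Lemma plane_case c c' v1 v2 p :
  kern c -> c' \in V -> v1 \in V -> v2 \in V -> kern p ->
  frm c c' = 1 ->
  frm v1 c = 0 -> frm v1 c' = 0 -> frm v2 c = 0 -> frm v2 c' = 0 ->
  frm v1 v2 = 0 -> frm v1 v1 <> 0 -> frm v2 v2 <> 0 ->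
  tri c' v1 v2 <> 0 ->
  (forall x, x \in V -> exists k,
     x = frm c x *: c' + frm c' x *: c + (frm v1 x / frm v1 v1) *: v1 +
         (frm v2 x / frm v2 v2) *: v2 + k *: p) ->
  abelian_type.
Proof.
move=> kc c'V v1V v2V kp cc' v1c v1c' v2c v2c' v12 /eqP v11 /eqP v22 /eqP nb exp.
have [cV cH] := kc; have [pV pH] := kp.
have cH2 x y : x \in V -> y \in V -> tri x c y = 0.
  by move=> *; rewrite (triC QL) cH ?oppr0.
have pH2 x y : x \in V -> y \in V -> tri x p y = 0.
  by move=> *; rewrite (triC QL) pH ?oppr0.
have cH3 x y : x \in V -> y \in V -> tri x y c = 0 by move=> *; rewrite -(triR QL) cH.
have pH3 x y : x \in V -> y \in V -> tri x y p = 0 by move=> *; rewrite -(triR QL) pH.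
have kperp w : kern w -> [/\ frm c w = 0, frm v1 w = 0 & frm v2 w = 0].
  move=> [wV wH]; have [k E] := exp w wV.
  have cw : frm c w = 0.
    have := wH v1 v2 v1V v2V; rewrite E !(triE QL) cH // pH // (tri_xx QL).
    rewrite (tri_xt QL) !mulr0 !addr0 -E => /eqP.
    by rewrite mulf_eq0 (negPf nb) orbF => /eqP.
  have v1w : frm v1 w = 0.
    have := wH c' v2 c'V v2V; rewrite E !(triE QL) cH // pH // (tri_xx QL).
    rewrite (tri_xt QL) !mulr0 !addr0 add0r -E (triC QL) => /eqP.
    rewrite mulf_eq0 oppr_eq0 (negPf nb) orbF mulf_eq0 invr_eq0 (negPf v11).
    by rewrite orbF => /eqP.
  split=> //; have := wH c' v1 c'V v1V; rewrite E !(triE QL) cH // pH // (tri_xx QL).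
  rewrite (tri_xt QL) !mulr0 !addr0 !add0r -E (triR QL) => /eqP.
  rewrite mulf_eq0 (negPf nb) orbF mulf_eq0 invr_eq0 (negPf v22).
  by rewrite orbF => /eqP.
have skew := ext_skew QL a.
have selfD x : frm (br a x) x = 0 by rewrite -/(tri a x x) (tri_tx QL).
have brV x : br a x \in V := ext_br QL a cz x.
have kDc : kern (br a c) := kern_br QL cz kc.
have kDp : kern (br a p) := kern_br QL cz kp.
have [cDc v1Dc v2Dc] := kperp _ kDc; have [cDp v1Dp v2Dp] := kperp _ kDp.
have ac : br a c = 0.
  apply: (ext_nondeg QL zz aa za) => // x xV; have [k ->] := exp x xV.
  (* ad a preserves the volume tri c' v1 v2, so it has trace 0 on c', v1, v2; the entries at v1 and
     v2 vanish by skewness, hence so does the one at c'. *)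
  have c'Dc : frm (br a c) c' = 0.
    have := ext_deriv QL a c' v1 v2.
    have [k1 E1] := exp _ (brV c'); have [k2 E2] := exp _ (brV v1).
    have [k3 E3] := exp _ (brV v2).
    rewrite E1 E2 E3 !(triE QL) cH // cH2 // cH3 // pH // pH2 // pH3 //.
    rewrite !(tri_xx QL) !(tri_tx QL) !(tri_xt QL).
    rewrite (frmC QL v1 (br a v1)) (frmC QL v2 (br a v2)) !selfD !(mul0r, mulr0, addr0, add0r).
    move/eqP; rewrite mulf_eq0 (negPf nb) orbF => /eqP.
    by rewrite skew => ->; rewrite oppr0.
  have pDc : frm (br a c) p = 0 by rewrite skew cDp oppr0.
  by rewrite !(frmE QL) c'Dc selfD pDc (frmC QL _ v1) (frmC QL _ v2) v1Dc v2Dc !mulr0 !addr0.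
apply: (shift kc (dual_neq0 cc') ac c'V v1V v2V kp cc') => //.
- exact/eqP.
- by rewrite /tri skew v1Dp oppr0.
- by rewrite /tri skew v2Dp oppr0.
move=> x /exp[k E]; exists (frm v1 x / frm v1 v1), (frm v2 x / frm v2 v2), k, (frm c' x).
by rewrite [LHS]E; apply: (frm_eq QL) => w; rewrite !(frmE QL); ring.
Qed.

(** V carries the 3-form of the nilpotent algebra [r5]: its only essential value is tri d1 d2 y, and
    c1, c2 span its radical. *)
Definition r5_frame c1 c2 d1 d2 y :=
  [/\ kern c1, kern c2, d1 \in V, d2 \in V & y \in V] /\
  [/\ frm c1 d1 = 1, frm c2 d2 = 1, frm c1 d2 = 0 & frm c2 d1 = 0] /\
  tri d1 d2 y <> 0 /\
  forall x, x \in V -> x = frm c1 x *: d1 + frm c2 x *: d2 +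
    frm d1 x *: c1 + frm d2 x *: c2 + (frm y x / frm y y) *: y.

Lemma r5_frame_swap c1 c2 d1 d2 y : r5_frame c1 c2 d1 d2 y -> r5_frame c2 c1 d2 d1 y.
Proof.
move=> [[k1 k2 d1V d2V yV] [[e11 e22 e12 e21] [nb H]]].
split; first by split.
split; first by split.
split; first by rewrite (triC QL) => /eqP; rewrite oppr_eq0 => /eqP.
by move=> x /H {1}->; apply: (frm_eq QL) => w; rewrite !(frmE QL); ring.
Qed.

Section R5.
Variables c1 c2 d1 d2 y : L.
Hypotheses (fr : r5_frame c1 c2 d1 d2 y) (yy : frm y y <> 0).

Lemma r5_kern_perp w : kern w -> [/\ frm c1 w = 0, frm c2 w = 0 & frm y w = 0].
Proof.
have [[[c1V c1H] [c2V c2H] d1V d2V yV] [[e11 e22 e12 e21] [/eqP nb exp]]] := fr.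
have /eqP y0 := yy; move=> [wV wH]; have E := exp w wV.
have H1 : frm c1 w = 0.
  have := wH d2 y d2V yV; rewrite E !(triE QL) c1H // c2H // (tri_xx QL).
  rewrite (tri_xt QL) !mulr0 !addr0 -E => /eqP.
  by rewrite mulf_eq0 (negPf nb) orbF => /eqP.
have H2 : frm c2 w = 0.
  have := wH d1 y d1V yV; rewrite E !(triE QL) c1H // c2H // (tri_xx QL).
  rewrite (tri_xt QL) !mulr0 !addr0 add0r -E (triC QL) => /eqP.
  by rewrite mulf_eq0 oppr_eq0 (negPf nb) orbF => /eqP.
split=> //; have := wH d1 d2 d1V d2V; rewrite E !(triE QL) c1H // c2H // (tri_xx QL).
rewrite (tri_xt QL) !mulr0 !addr0 !add0r -E (triR QL) => /eqP.
rewrite mulf_eq0 (negPf nb) orbF mulf_eq0 invr_eq0 (negPf y0).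
by rewrite orbF => /eqP.
Qed.

(** [ext_deriv] on d1, d2, y: the entry at y is 0 by skewness, and the entries at d1, d2 are
    opposite to those at c1, c2. So ad a is traceless on the radical plane. *)
Lemma r5_trace : frm (br a c1) d1 + frm (br a c2) d2 = 0.
Proof.
have [[[c1V c1H] [c2V c2H] d1V d2V yV] [[e11 e22 e12 e21] [/eqP nb exp]]] := fr.
have H12 x u : x \in V -> u \in V -> tri x c1 u = 0.
  by move=> *; rewrite (triC QL) c1H ?oppr0.
have H22 x u : x \in V -> u \in V -> tri x c2 u = 0.
  by move=> *; rewrite (triC QL) c2H ?oppr0.
have H13 x u : x \in V -> u \in V -> tri x u c1 = 0 by move=> *; rewrite -(triR QL) c1H.
have H23 x u : x \in V -> u \in V -> tri x u c2 = 0 by move=> *; rewrite -(triR QL) c2H.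
have skew := ext_skew QL a.
have brV x : br a x \in V := ext_br QL a cz x.
have := ext_deriv QL a d1 d2 y.
have E1 := exp _ (brV d1); have E2 := exp _ (brV d2); have E3 := exp _ (brV y).
rewrite E1 E2 E3 !(triE QL) c1H // c2H // H12 // H22 // H13 // H23 //.
rewrite !(tri_xx QL) !(tri_tx QL) !(tri_xt QL).
rewrite (frmC QL y (br a y)) -[frm (br a y) y]/(tri a y y) (tri_tx QL).
rewrite !(mul0r, mulr0, addr0, add0r) -mulrDl => /eqP.
rewrite mulf_eq0 (negPf nb) orbF => /eqP E; rewrite !skew -opprD E; exact: oppr0.
Qed.

Lemma r5_br_kern c : kern c ->
  br a c = frm (br a c) d1 *: c1 + frm (br a c) d2 *: c2.
Proof.
move=> kc; have [_ [_ [_ exp]]] := fr.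
have [H1 H2 H3] := r5_kern_perp (kern_br QL cz kc).
rewrite {1}(exp _ (ext_br QL a cz c)) H1 H2 H3 mul0r !scale0r !addr0 !add0r.
by rewrite (frmC QL d1) (frmC QL d2).
Qed.

(** A vector of the radical plane killed by ad a is central, and [shift_center] applies with the
    other radical vector in the role of p. *)
Lemma r5_singular k : br a (c1 + k *: c2) = 0 -> abelian_type.
Proof.
have [[k1 k2 d1V d2V yV] [[e11 e22 e12 e21] [nb exp]]] := fr.
have kc : kern (c1 + k *: c2) by apply: (kernD QL) => //; apply: (kernZ QL).
have [[c1V c1H] [c2V c2H]] := (k1, k2).
have skew := ext_skew QL a.
move=> ac; have E : frm (br a c1) d1 + k * frm (br a c2) d1 = 0.
  by have := congr1 (fun u => frm u d1) ac; rewrite !(brE QL) !(frmE QL).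
have E' : frm (br a c1) d2 + k * frm (br a c2) d2 = 0.
  by have := congr1 (fun u => frm u d2) ac; rewrite !(brE QL) !(frmE QL).
have cd : frm (c1 + k *: c2) d1 = 1 by rewrite !(frmE QL) e11 e21 mulr0 addr0.
have dV : d2 - k *: d1 \in V by rewrite memvB ?memvZ.
apply: (shift kc (dual_neq0 cd) ac d1V dV yV k2 cd).
- by rewrite !(triE QL) (tri_xx QL) mulr0 subr0.
- rewrite /tri skew (r5_br_kern k2) !(frmE QL) [frm d2 c1](frmC QL) [frm d2 c2](frmC QL).
  rewrite [frm d1 c1](frmC QL) [frm d1 c2](frmC QL) e11 e22 e12 e21.
  have := r5_trace; move: E; move: (frm (br a c1) _) (frm (br a c2) _) => q r H1 H2.
  by apply/eqP; rewrite oppr_eq0; apply/eqP; lra.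
- have [_ _ H] := r5_kern_perp (kern_br QL cz k2).
  by rewrite /tri skew H oppr0.
move=> x xV; exists (frm c2 x), (frm y x / frm y y), (frm d2 x - k * frm d1 x), (frm d1 x).
rewrite {1}(exp x xV); apply: (frm_eq QL) => w; rewrite !(frmE QL); ring.
Qed.

End R5.

(** The hypothesis says that the traceless matrix of ad a on the radical plane has determinant 0.
    Its kernel contains c1 if q = 0, and c2 + (p / q) c1 otherwise. *)
Lemma r5_case c1 c2 d1 d2 y : r5_frame c1 c2 d1 d2 y -> frm y y <> 0 ->
  frm (br a c1) d1 ^+ 2 + frm (br a c1) d2 * frm (br a c2) d1 = 0 ->
  abelian_type.
Proof.
move=> fr y0; have fr' := r5_frame_swap fr.
have tr := r5_trace fr; have [[k1 k2 _ _ _] _] := fr.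
have E1 := r5_br_kern fr y0 k1; have E2 := r5_br_kern fr y0 k2.
set p := frm (br a c1) d1 in tr E1 *; set q := frm (br a c1) d2 in tr E1 *.
set r := frm (br a c2) d1 in tr E2 *; set s := frm (br a c2) d2 in tr E2 *.
move=> det; have es : s = - p by apply/eqP; rewrite -addr_eq0 addrC tr.
have [q0|q0] := eqVneq q 0.
  have p0 : p = 0 by apply/eqP; rewrite -sqrf_eq0 -det q0 mul0r addr0.
  apply: (r5_singular fr y0 (k := 0)).
  by rewrite scale0r addr0 E1 q0 p0 !scale0r addr0.
apply: (r5_singular fr' y0 (k := p / q)); rewrite !(brE QL) E1 E2 es.
have -> : r = - (p ^+ 2 / q).
  by apply: (mulfI q0); rewrite mulrN mulrCA mulfV // mulr1; apply/eqP; rewrite -addr_eq0 addrC det.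
by apply: (frm_eq QL) => w; rewrite !(frmE QL); field.
Qed.

End KernelPlanes.

Definition r5_type := exists a z c1 c2 d1 d2 y : L, exists b : bool,
  [/\ central z, frm z z = 0, frm a a = 0 & frm z a = 1] /\
  r5_frame a z c1 c2 d1 d2 y /\
  [/\ frm y y = (-1) ^+ b, frm c1 c1 = 0, frm c1 c2 = 0 & frm c2 c2 = 0] /\
  [/\ frm c1 y = 0, frm c2 y = 0, frm d1 y = 0 & frm d2 y = 0] /\
  [/\ frm d1 d1 = 0, frm d1 d2 = 0 & frm d2 d2 = 0] /\
  frm (br a c1) d1 ^+ 2 + frm (br a c1) d2 * frm (br a c2) d1 <> 0.

Lemma reduction : solvable_lie L -> isotropic_center L -> (2 <= \dim {: L} <= 7)%N ->
  abelian_type \/ (r5_type /\ \dim {: L} = 7).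
Proof.
move=> sol iso /andP[n2 n7].
have ndL : nondegenerate_on (fullv : {vspace L}) by case: QL.
have [|z z0 cz] := exists_central QL sol; first by apply: leq_trans n2.
have zz : frm z z = 0 by apply: iso.
have [a [_ za aa]] := isotropic_partner QL ndL (memvf z) z0 zz.
pose V := perp (perp fullv z) a.
have [[x0 [y0 [t0 [x0V y0V t0V ne]]]]|nn] :=
    classic (exists x y t, [/\ x \in V, y \in V, t \in V & tri x y t <> 0]); last first.
  left; exists z; split=> //; apply: (ext_tri_perp QL cz zz aa za) => x y t xV yV tV.
  by apply: NNPP => H; apply: nn; exists x, y, t.
have [|c [kc c0 cc]] := kern_isotropic QL cz zz aa za sol; first by exists x0, y0, t0.
have ndV := ext_nondeg QL zz aa za; rewrite -/V in ndV.
have [cV cH] := kc; rewrite -/V in cV cH.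
have [c' [c'V cc' c'c']] := isotropic_partner QL ndV cV c0 cc.
pose P := perp (perp V c) c'.
have [ndP dP] := nondeg_hyp QL ndV cV c'V cc c'c' cc'; rewrite -/P in ndP dP.
have dn := ext_dim QL zz aa za; rewrite -/V dP in dn.
have dP3 : (\dim P <= 3)%N by rewrite dn in n7.
have PP x : x \in P -> [/\ x \in V, frm c x = 0 & frm c' x = 0].
  by rewrite (mem_hyp QL) => /and3P[-> /eqP-> /eqP->].
have cH3 x y : x \in V -> y \in V -> tri x y c = 0 by move=> *; rewrite -(triR QL) cH.
have cH2 x y : x \in V -> y \in V -> tri x c y = 0.
  by move=> *; rewrite (triC QL) cH ?oppr0.
have decV x : x \in V -> exists2 w, w \in P & x = frm c x *: c' + frm c' x *: c + w.
  move=> xV; exists (x - (frm c x *: c' + frm c' x *: c)); last by rewrite addrC subrK.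
  rewrite (mem_hyp QL) memvB ?memvD ?memvZ //= !(frmE QL) cc c'c' cc' (frmC QL c' c) cc'.
  by apply/andP; split; apply/eqP; ring.
have [dP0|dP0] := eqVneq (\dim P) 0%N.
  exfalso; apply: ne; have [x xP ->] := decV _ x0V; have [y yP ->] := decV _ y0V.
  have [t tP ->] := decV _ t0V.
  rewrite (mem_dim0 dP0 xP) (mem_dim0 dP0 yP) (mem_dim0 dP0 tP) !(triE QL) !addr0.
  by rewrite !(tri_xx QL, tri_xt QL, tri_tx QL) !(mulr0, addr0).
(* P models c^perp / c inside the solvable algebra z^perp / z, so some nonzero p in P is in the
   radical of the 3-form on P; as dim P is at most 3, that 3-form is 0. *)
have triP x y t : x \in P -> y \in P -> t \in P -> tri x y t = 0.
  have [||||||p pP [p0 pH]] :=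
    @solvable_center _ _ QL P (<[c]> + <[z]>)%VS <[z]>%VS sol ndP.
  - by rewrite lt0n.
  - move=> u v uP vP; have [uV _ _] := PP _ uP; have [vV _ _] := PP _ vP.
    have [w wV E] := ext_decomp QL zz aa za (br u v); rewrite -/V in wV.
    have [w' w'P E'] := decV _ wV.
    have zuv : frm z (br u v) = 0 by rewrite (frmC QL) -/(tri u v z) (tri_centralr QL).
    have cuv : frm c w = 0.
      have := cH u v uV vV; rewrite (triR QL) /tri (frmC QL) E !(frmE QL).
      have /(extP QL)[cz' ca'] := cV.
      by rewrite [frm c z](frmC QL) [frm c a](frmC QL) cz' ca' !mulr0 !add0r.
    apply/memv_addP; exists w' => //.
    exists (frm c' w *: c + frm a (br u v) *: z).
      by rewrite memv_add ?memvZ ?memv_line.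
    rewrite [LHS]E zuv {1}E' cuv; apply: (frm_eq QL) => s; rewrite !(frmE QL); ring.
  - move=> _ y0' /memv_addP[_ /vlineP[k ->] [_ /vlineP[m ->] ->]].
    case/memv_addP=> u uP [_ /memv_addP[_ /vlineP[k' ->] [_ /vlineP[m' ->] ->]] ->].
    have [uV _ _] := PP _ uP.
    have cu : br c u \in <[z]>%VS.
      have [w wV E] := ext_decomp QL zz aa za (br c u); rewrite -/V in wV.
      have w0 : w = 0.
        apply: ndV => // s sV; have := cH u s uV sV; rewrite /tri E !(frmE QL).
        by have /(extP QL)[-> ->] := sV; rewrite !mulr0 !add0r.
      have zcu : frm z (br c u) = 0 by rewrite (frmC QL) -/(tri c u z) (tri_centralr QL).
      by rewrite E w0 zcu scale0r !addr0 memvZ ?memv_line.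
    rewrite !(brE QL) !cz (br_xx QL) [br c z](brC QL) cz !(scaler0, oppr0, addr0, add0r).
    by rewrite memvZ.
  - by move=> _ /vlineP[k ->]; apply: (centralZ QL).
  - move=> u v uP /memv_addP[_ /vlineP[k ->] [_ /vlineP[m ->] ->]].
    have [/(extP QL)[uz _] uc _] := PP _ uP.
    by rewrite !(frmE QL) [frm u c](frmC QL) [frm u z](frmC QL) uz uc !mulr0 addr0.
  - exact: addvSr.
  exact: (tri_vanish3 QL dP3 pP p0 pH).
have [x1 [x2 [x1P x2P nb]]] : exists x1 x2, [/\ x1 \in P, x2 \in P & tri c' x1 x2 <> 0].
  apply: NNPP => H; apply: ne.
  have b0 u v : u \in P -> v \in P -> tri c' u v = 0.
    by move=> uP vP; apply: NNPP => H'; apply: H; exists u, v.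
  have [x xP ->] := decV _ x0V; have [y yP ->] := decV _ y0V.
  have [t tP ->] := decV _ t0V.
  have [xV _ _] := PP _ xP; have [yV _ _] := PP _ yP; have [tV _ _] := PP _ tP.
  rewrite !(triE QL) (triP x y t) // !cH // !cH2 // !cH3 // !(tri_xx QL) !(tri_xt QL).
  rewrite !(tri_tx QL) b0 // [tri x c' t](triC QL) b0 // -[tri x y c'](triR QL) b0 //.
  by rewrite !(mulr0, addr0, oppr0).
(* Applied with p = 0 when P is a plane, and with an anisotropic p when dim P = 3. *)
have plane Q p : (Q <= P)%VS -> nondegenerate_on Q -> \dim Q = 2 -> kern a z p ->
    (forall v, v \in Q -> frm v p = 0) ->
    (forall x, x \in P -> exists2 w, w \in Q & exists k, x = w + k *: p) ->
    abelian_type.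
  move=> /subvP QP ndQ dQ kp Qp decP; have [pV pH] := kp; rewrite -/V in pV pH.
  have [v1 [v2 [b1 [b2 [v1Q v2Q v11 v22 v12]]]]] := ortho2 QL ndQ dQ.
  have n1 : frm v1 v1 <> 0 by rewrite v11; apply/eqP; rewrite signr_eq0.
  have n2' : frm v2 v2 <> 0 by rewrite v22; apply/eqP; rewrite signr_eq0.
  have [v1V v1c v1c'] := PP _ (QP _ v1Q); have [v2V v2c v2c'] := PP _ (QP _ v2Q).
  have exp2 := dim2_scal QL dQ v1Q v2Q n1 n2' v12.
  apply: (@plane_case a z cz zz aa za c c' v1 v2 p) => //; rewrite ?(frmC QL v1) ?(frmC QL v2) //.
  - move=> b0; apply: nb; have [w1 w1Q [k1 ->]] := decP _ x1P.
    have [w2 w2Q [k2 ->]] := decP _ x2P.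
    have [w1V _ _] := PP _ (QP _ w1Q); have [w2V _ _] := PP _ (QP _ w2Q).
    rewrite !(triE QL) [tri c' p _](triC QL) [tri c' p p](tri_tx QL) pH //.
    rewrite -[tri c' w1 p](triR QL) pH // (exp2 w1) // (exp2 w2) // !(triE QL).
    by rewrite !(tri_tx QL) (triCr QL c' v2 v1) b0 !(mulr0, oppr0, addr0).
  - move=> x xV; have [w wP E] := decV x xV; have [u uQ [k E']] := decP w wP.
    exists k; rewrite {1}E E' {1}(exp2 u uQ).
    have uE v : v \in Q -> frm v u = frm v x.
      move=> vQ; have [_ vc vc'] := PP _ (QP _ vQ).
      rewrite E E' !(frmE QL) [frm v c](frmC QL) [frm v c'](frmC QL) vc vc' Qp //.
      by rewrite !mulr0 !add0r addr0.
    by rewrite !uE // !addrA.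
have k0 : kern a z (0 : L) by split=> [|u v]; rewrite ?mem0v ?(triE QL).
have [dP2|dP2] := eqVneq (\dim P) 2%N.
  left; apply: (plane P 0) => //; first by move=> v; rewrite (frmE QL).
  by move=> x xP; exists x => //; exists 0; rewrite scale0r addr0.
have [dP1|dP1] := eqVneq (\dim P) 1%N.
  exfalso; have [|v vP v0] := exists_aniso QL ndP; first by rewrite dP1.
  apply: nb; rewrite (dim1_scal QL dP1 vP v0 x1P) (dim1_scal QL dP1 vP v0 x2P).
  by rewrite !(triE QL) (tri_tx QL) !mulr0.
have {dP3 dP0 dP1 dP2} dP3 : \dim P = 3.
  by move: (\dim P) dP3 dP0 dP1 dP2 => [|[|[|[|]]]].
(* Only the 2-form [tri c'] on P is left. In dimension 3 it has a radical vector p, which then lies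
   in [kern]. *)
have [p pP [p0 pb]] := tri_kernel3 QL c' dP3.
have [pV pc pc'] := PP _ pP.
have kp : kern a z p.
  split=> // x y xV yV; have [x' x'P ->] := decV _ xV; have [y' y'P ->] := decV _ yV.
  have [x'V _ _] := PP _ x'P; have [y'V _ _] := PP _ y'P.
  rewrite !(triE QL) (triP p x' y') // ?cH2 // ?cH3 // (tri_tx QL) [tri p c' _](triC QL) pb //.
  rewrite -[tri p x' c'](triR QL) pb // ?[tri p c' c](triC QL) ?[tri c' p c]cH3 //.
  by rewrite !(mulr0, oppr0, addr0).
(* An anisotropic p leaves a nondegenerate plane and [plane] applies. An isotropic p spans with c a
   totally isotropic radical plane, which gives an [r5_frame]. *)
have [pp|pp] := classic (frm p p = 0); last first.
  left; apply: (plane (perp P p) p) => //.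
  - exact: perp_sub.
  - exact: nondeg_perp.
  - by have := dim_perp_eq QL pP pp; rewrite dP3 => -[].
  - by move=> v /(perp_frm QL) <-; rewrite (frmC QL).
  - move=> x xP; have [x' x'P E] := frm_expand QL pP pp xP.
    by exists x' => //; exists (frm p x / frm p p); rewrite addrC.
have [p' [p'P pp' p'p']] := isotropic_partner QL ndP pP p0 pp.
have [ndY dY] := nondeg_hyp QL ndP pP p'P pp p'p' pp'.
have {}dY : \dim (perp (perp P p) p') = 1%N by rewrite dP3 in dY; case: dY.
have [|y [b [yY yb]]] := exists_unit QL ndY; first by rewrite dY.
have ny : frm y y <> 0 by rewrite yb; apply/eqP; rewrite signr_eq0.
move: (yY); rewrite (mem_hyp QL) => /and3P[yP /eqP py /eqP p'y].
have [p'V cp' c'p'] := PP _ p'P; have [yV cy c'y] := PP _ yP.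
have decP x : x \in P -> x = frm p x *: p' + frm p' x *: p + (frm y x / frm y y) *: y.
  move=> xP; have w : x - (frm p x *: p' + frm p' x *: p) \in perp (perp P p) p'.
    rewrite (mem_hyp QL) memvB ?memvD ?memvZ //= !(frmE QL) pp p'p' pp' (frmC QL p' p) pp'.
    by apply/andP; split; apply/eqP; ring.
  have := dim1_scal QL dY yY ny w.
  rewrite !(frmE QL) [frm y p](frmC QL) [frm y p'](frmC QL) py p'y !mulr0 addr0 subr0.
  by move=> E; rewrite -E addrC subrK.
have fr : r5_frame a z c p c' p' y.
  split; first by split.
  split; first by split; rewrite // (frmC QL).
  split.
    move=> b0; apply: nb; rewrite (decP _ x1P) (decP _ x2P) !(triE QL).
    have pb' x : x \in P -> tri c' x p = 0 by move=> *; rewrite (triCr QL) pb ?oppr0.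
    rewrite !pb // !pb' // !(tri_tx QL) [tri c' y p'](triCr QL) b0.
    by rewrite !(mulr0, oppr0, addr0).
  move=> x xV; have [w wP E] := decV x xV.
  have wE v : v \in P -> frm v w = frm v x.
    move=> vP; have [_ vc vc'] := PP _ vP.
    rewrite E !(frmE QL) [frm v c](frmC QL) [frm v c'](frmC QL) vc vc'.
    by rewrite !mulr0 !add0r.
  rewrite {1}E {1}(decP w wP) !wE //; apply: (frm_eq QL) => s; rewrite !(frmE QL); ring.
have [det|det] := classic (frm (br a c) c' ^+ 2 + frm (br a c) p' * frm (br a p) c' = 0).
  by left; apply: (r5_case cz zz aa za fr ny det).
right; split; last by rewrite dn dP3.
exists a, z, c, p, c', p', y, b; do !split=> //; by case: kp.
Qed.

End ReductionCases.

(** * Normal forms of skew operators *)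

Section SkewForms.

Variables (F : rcfType) (L : quad_datum F).
Hypothesis QL : quadratic_lie L.
Implicit Types (x y t v w h a : L) (U P Q W : {vspace L}) (b : bool).

Lemma sign_neq0 b : (-1) ^+ b <> 0 :> F.
Proof. by apply/eqP; rewrite signr_eq0. Qed.

Definition stable a W := forall x, x \in W -> br a x \in W.

(** The trace on W of the isotropic center: once the 3-form vanishes on V, vectors of V killed by ad
    a are central. *)
Definition iso_kernel a W := forall x, x \in W -> br a x = 0 -> frm x x = 0.

Definition hyp_plane a x y (m : F) :=
  [/\ frm x x = 0, frm y y = 0, frm x y = 1, br a x = m *: x & br a y = - (m *: y)].

Definition rot_plane a b x y (m : F) :=
  [/\ frm x x = (-1) ^+ b, frm y y = (-1) ^+ b, frm x y = 0, br a x = m *: y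
    & br a y = - (m *: x)].

Definition nil3 a b x1 x2 x3 :=
  [/\ frm x1 x1 = 0, frm x1 x2 = 0, frm x1 x3 = - (-1) ^+ b, frm x2 x2 = (-1) ^+ b
    & frm x2 x3 = 0] /\
  [/\ frm x3 x3 = 0, br a x1 = x2, br a x2 = x3 & br a x3 = 0].

Lemma skew a x y : frm (br a x) y = - frm x (br a y).
Proof. exact: ext_skew. Qed.

Lemma skew_self a x : frm x (br a x) = 0.
Proof. by rewrite (frmC QL) -/(tri a x x) (tri_tx QL). Qed.

(** In an orthogonal basis a skew operator on a plane has one entry d, nonzero because the kernel is
    isotropic. Equal signs give a rotation; opposite signs make v1 + v2 and v1 - v2 eigenvectors. *)
Lemma plane_form a W : nondegenerate_on W -> \dim W = 2 -> stable a W ->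
  iso_kernel a W -> exists x y m, [/\ x \in W, y \in W & 0 < m] /\
    (hyp_plane a x y m \/ exists b, rot_plane a b x y m).
Proof.
move=> ndW dW st ik; have [v1 [v2 [b1 [b2 [v1W v2W v11 v22 v12]]]]] := ortho2 QL ndW dW.
have n1 : frm v1 v1 <> 0 by rewrite v11; apply: sign_neq0.
have n2 : frm v2 v2 <> 0 by rewrite v22; apply: sign_neq0.
have exp := dim2_scal QL dW v1W v2W n1 n2 v12.
pose d := frm v2 (br a v1).
have D1 : br a v1 = ((-1) ^+ b2 * d) *: v2.
  rewrite (exp _ (st _ v1W)) skew_self mul0r scale0r add0r v22 -/d.
  by rewrite [_ * d]mulrC; congr (_ *: _); case: (b2); rewrite ?expr0 ?expr1; field.
have D2 : br a v2 = - (((-1) ^+ b1 * d) *: v1).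
  rewrite (exp _ (st _ v2W)) skew_self mul0r scale0r addr0 v11.
  have -> : frm v1 (br a v2) = - d by rewrite /d [RHS]/= (frmC QL v2) skew opprK.
  by rewrite -scaleNr; congr (_ *: _); case: (b1); rewrite ?expr0 ?expr1; field.
have d0 : d != 0.
  by apply/eqP=> d0; apply: n1; apply: ik => //; rewrite D1 d0 mulr0 scale0r.
have [E|E] := eqVneq b1 b2.
  subst b2; pose e := (-1) ^+ b1 * d.
  exists v1, (Num.sg e *: v2), `|e|; split.
    by split; rewrite ?memvZ // normr_gt0 mulf_neq0 ?signr_eq0.
  have e0 : e != 0 by rewrite mulf_neq0 ?signr_eq0.
  right; exists b1; split; rewrite ?(brE QL) ?(frmE QL) ?v12 ?mulr0 //.
  - by rewrite mulrA -expr2 sqr_sg e0 mul1r.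
  - by rewrite D1 -/e scalerA mulrC {1}[e]numEsg.
  - rewrite D2 -/e scalerN scalerA; congr (- (_ *: _)).
    by rewrite normrEsg.
(* Exchanging x and y changes the sign of the eigenvalue, so m may be taken positive. *)
have key (x y : L) (m : F) : x \in W -> y \in W -> m != 0 -> hyp_plane a x y m ->
    exists x y m, [/\ x \in W, y \in W & 0 < m] /\
    (hyp_plane a x y m \/ exists b, rot_plane a b x y m).
  move=> xW yW m0 H; have [mp|mn|/eqP] := ltrgt0P m; last by rewrite (negPf m0).
    by exists x, y, m; split=> //; left.
  exists y, x, (- m); split; first by split=> //; rewrite oppr_gt0.
  by left; case: H => ? ? ? ? ?; split=> //; rewrite ?scaleNr ?opprK // (frmC QL).
move: E v11 v22 D1 D2; case: (b1) (b2) => [] [] //= _; rewrite ?expr1 ?expr0 => v11 v22 D1 D2.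
- apply: (key (v1 + v2) (- 2^-1 *: (v1 - v2)) d); rewrite ?memvZ ?memvB ?memvD //.
  split; rewrite ?(brE QL) ?D1 ?D2; try (apply: (frm_eq QL) => t);
    rewrite !(frmE QL) ?v11 ?v22 ?v12 ?[frm v2 v1](frmC QL) ?v12; by field.
- apply: (key (v1 + v2) (2^-1 *: (v1 - v2)) (- d)); rewrite ?memvZ ?memvB ?memvD ?oppr_eq0 //.
  split; rewrite ?(brE QL) ?D1 ?D2; try (apply: (frm_eq QL) => t);
    rewrite !(frmE QL) ?v11 ?v22 ?v12 ?[frm v2 v1](frmC QL) ?v12; by field.
Qed.

(** Write D for ad a. Dv is orthogonal to v and has length -s phi(v, v), nonzero, so v and Dv span a
    stable nondegenerate plane; its complement is stable because D is skew. *)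
Lemma plane_split a W v s : nondegenerate_on W -> stable a W -> iso_kernel a W ->
  v \in W -> frm v v <> 0 -> br a (br a v) = s *: v -> s <> 0 ->
  exists Q W', [/\ (Q <= W)%VS, nondegenerate_on Q, \dim Q = 2, stable a Q &
    iso_kernel a Q] /\ [/\ (W' <= W)%VS, nondegenerate_on W', \dim W = (\dim W').+2,
    stable a W' & iso_kernel a W'] /\
    (forall x y, x \in Q -> y \in W' -> frm x y = 0).
Proof.
move=> ndW st ik vW vv vs s0; pose u := br a v.
have uW : u \in W := st _ vW.
have vu : frm v u = 0 := skew_self a v.
have uu : frm u u <> 0.
  rewrite /u skew vs (frmE QL) => /eqP; rewrite oppr_eq0 mulf_eq0.
  by rewrite (introF eqP s0) (introF eqP vv).
have Qin x : x \in (<[v]> + <[u]>)%VS -> exists k l, x = k *: v + l *: u.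
  by case/memv_addP=> _ /vlineP[k ->] [_ /vlineP[l ->] ->]; exists k, l.
have vQ : v \in (<[v]> + <[u]>)%VS by rewrite (subvP (addvSl _ _)) ?memv_line.
have uQ : u \in (<[v]> + <[u]>)%VS by rewrite (subvP (addvSr _ _)) ?memv_line.
have QW : (<[v]> + <[u]> <= W)%VS by rewrite subv_add -!memvE vW uW.
exists (<[v]> + <[u]>)%VS, (perp (perp W v) u).
split; first split=> //; last (split; first split).
- move=> x /Qin[k [l ->]] H.
  have := H v vQ; rewrite !(frmE QL) [frm u v](frmC QL) vu mulr0 addr0 => /eqP.
  rewrite mulf_eq0 (introF eqP vv) orbF => /eqP k0.
  have := H u uQ; rewrite !(frmE QL) vu mulr0 add0r => /eqP.
  by rewrite mulf_eq0 (introF eqP uu) orbF k0 => /eqP ->; rewrite !scale0r addr0.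
- rewrite mem_add_notin ?dim_vline.
    by have /eqP -> : v <> 0 by move=> v0; apply: vv; rewrite v0 (frmE QL).
  apply/negP=> /vlineP[k uE]; apply: uu; rewrite {2}uE (frmE QL) (frmC QL) vu.
  exact: mulr0.
- move=> x /Qin[k [l ->]]; rewrite !(brE QL) -/u vs.
  by rewrite memvD ?memvZ.
- by move=> x /(subvP QW); apply: ik.
- by rewrite (subv_trans (perp_sub _ _)) ?perp_sub.
- by apply: nondeg_perp => //; [apply: nondeg_perp | apply: perpI].
- rewrite (dim_perp_eq QL vW vv); congr _.+1.
  by apply: (@dim_perp_eq _ _ QL _ _ u) => //; apply: perpI.
- move=> x; rewrite !(mem_hyp QL) => /and3P[xW /eqP vx /eqP ux].
  rewrite st //= -[frm v _]opprK -skew ux oppr0 eqxx /=.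
  by rewrite -[frm u _]opprK -skew vs (frmE QL) vx mulr0 oppr0.
- by move=> x xW; apply: ik; have := perp_memW QL (perp_memW QL xW).
- move=> x y /Qin[k [l ->]]; rewrite (mem_hyp QL) => /and3P[_ /eqP vy /eqP uy].
  by rewrite !(frmE QL) vy uy !mulr0 addr0.
Qed.

Lemma br_mem0 a W x : nondegenerate_on W -> stable a W -> x \in W ->
  (forall y, y \in W -> tri a x y = 0) -> br a x = 0.
Proof. by move=> ndW st xW H; apply: ndW => //; apply: st. Qed.

(** Otherwise k + k' would be a kernel vector of length 2. *)
Lemma not_both_kernel a W k k' : iso_kernel a W -> k \in W -> k' \in W ->
  frm k k = 0 -> frm k' k' = 0 -> frm k k' = 1 -> br a k = 0 -> br a k' <> 0.
Proof.
move=> ik kW k'W kk k'k' kk' Dk Dk'.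
have := ik (k + k') (memvD kW k'W); rewrite (brE QL) Dk Dk' addr0 => /(_ erefl).
rewrite !(frmE QL) kk k'k' kk' (frmC QL k') kk' addr0 add0r => /eqP.
by rewrite -(natrD _ 1 1) pnatr_eq0.
Qed.

(** Odd dimension gives an isotropic kernel vector k. Its partner k' is sent to the line orthogonal
    to both, and that line to the line of k, so k' generates a Jordan chain of length 3; rescaling
    k' normalizes it. *)
Lemma nil3_form a W : nondegenerate_on W -> \dim W = 3 -> stable a W ->
  iso_kernel a W -> exists b x1 x2 x3, [/\ x1 \in W, x2 \in W & x3 \in W] /\
    nil3 a b x1 x2 x3.
Proof.
move=> ndW dW st ik; have [k kW [k0 kH]] := tri_kernel3 QL a dW.
have Dk := br_mem0 ndW st kW kH; have kk := ik k kW Dk.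
have [k' [k'W kk' k'k']] := isotropic_partner QL ndW kW k0 kk.
have [ndY dY] := nondeg_hyp QL ndW kW k'W kk k'k' kk'.
have {}dY : \dim (perp (perp W k) k') = 1%N by rewrite dW in dY; case: dY.
have [|w [b [wY wb]]] := exists_unit QL ndY; first by rewrite dY.
have w0 : frm w w <> 0 by rewrite wb; apply: sign_neq0.
move: (wY); rewrite (mem_hyp QL) => /and3P[wW /eqP kw /eqP k'w].
have kD x : frm k (br a x) = 0 by rewrite -[LHS]opprK -skew Dk (frmE QL) oppr0.
pose e := frm w (br a k') / frm w w.
have Dk' : br a k' = e *: w.
  apply: (dim1_scal QL dY wY w0).
  by rewrite (mem_hyp QL) st //= kD skew_self eqxx.
have e0 : e <> 0.
  move=> e0; apply: (not_both_kernel ik kW k'W kk k'k' kk' Dk).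
  by rewrite Dk' e0 scale0r.
have Dw : br a w = - (e * (-1) ^+ b) *: k.
  apply/eqP; rewrite -subr_eq0; apply/eqP; apply: ndW => [|y yW].
    by rewrite memvB ?st ?memvZ.
  have [u uY ->] : exists2 u, u \in perp (perp W k) k' &
      y = frm k y *: k' + frm k' y *: k + u.
    exists (y - (frm k y *: k' + frm k' y *: k)); last by rewrite addrC subrK.
    rewrite (mem_hyp QL) memvB ?memvD ?memvZ //= !(frmE QL) kk k'k' kk' (frmC QL k' k) kk'.
    by apply/andP; split; apply/eqP; ring.
  rewrite (dim1_scal QL dY wY w0 uY) !(frmE QL) kk kk' kw (frmC QL _ w) (frmC QL _ k).
  rewrite (frmC QL _ k') skew_self kD -[frm k' (br a w)]opprK -skew Dk' (frmE QL) wb.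
  by ring.
have /eqP e1 := e0.
exists b, (e^-1 *: k'), w, (- (e * (-1) ^+ b) *: k); split.
  by split; rewrite ?memvZ.
split; split; rewrite ?(brE QL) ?(frmE QL) ?k'k' ?kk ?k'w ?Dk ?Dk' ?scaler0 //;
  rewrite ?(frmC QL w k) ?kw ?mulr0 //.
- by rewrite (frmC QL k') kk' mulr1 mulrN mulrA mulVf // mul1r.
- by rewrite scalerA mulVf // scale1r.
Qed.

End SkewForms.

(** * Skew operators in dimension 4 *)

Section Skew4.

Variables (F : rcfType) (L : quad_datum F).
Hypothesis QL : quadratic_lie L.
Implicit Types (x y t v w h a : L) (U P Q W : {vspace L}) (b : bool).

(* The characteristic polynomial is even because -D is the adjoint of D. *)
Lemma skew4_charpoly a W : nondegenerate_on W -> \dim W = 4 -> stable a W ->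
  exists p r, forall x, x \in W ->
    br a (br a (br a (br a x))) = - (p *: br a (br a x)) - r *: x.
Proof.
move=> ndW dW st.
have [|v1 v1W n1] := exists_aniso QL ndW; first by rewrite dW.
have d1 : \dim (perp W v1) = 3 by have := dim_perp_eq QL v1W n1; rewrite dW => -[].
have nd1 := nondeg_perp QL ndW v1W n1.
have [|v2 v2P n2] := exists_aniso QL nd1; first by rewrite d1.
have d2 : \dim (perp (perp W v1) v2) = 2.
  by have := dim_perp_eq QL v2P n2; rewrite d1 => -[].
have nd2 := nondeg_perp QL nd1 v2P n2.
have [v3 [v4 [b3 [b4 [v3P v4P v33 v44 v34]]]]] := ortho2 QL nd2 d2.
have v2W := perp_memW QL v2P; have v12 := perp_frm QL v2P.
have [v3P' v4P'] := (perp_memW QL v3P, perp_memW QL v4P).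
have [v3W v4W] := (perp_memW QL v3P', perp_memW QL v4P').
have [v13 v14] := (perp_frm QL v3P', perp_frm QL v4P').
have [v23 v24] := (perp_frm QL v3P, perp_frm QL v4P).
have n3 : frm v3 v3 <> 0 by rewrite v33; apply: sign_neq0.
have n4 : frm v4 v4 <> 0 by rewrite v44; apply: sign_neq0.
move: n1 n2 n3 n4 => /eqP n1 /eqP n2 /eqP n3 /eqP n4.
(* Parseval in the orthogonal basis reduces the relation to identities between the coordinates of
   x. *)
have pars x y : x \in W -> y \in W -> frm x y = frm v1 x * frm v1 y / frm v1 v1 +
   frm v2 x * frm v2 y / frm v2 v2 + frm v3 x * frm v3 y / frm v3 v3 +
   frm v4 x * frm v4 y / frm v4 v4.
  move=> xW yW; have [x1 x1P E1] := frm_expand QL v1W (elimN eqP n1) xW.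
  have [x2 x2P E2] := frm_expand QL v2P (elimN eqP n2) x1P.
  have E3 := dim2_scal QL d2 v3P v4P (elimN eqP n3) (elimN eqP n4) v34 x2P.
  have e2 : frm v2 x = frm v2 x1 by rewrite E1 !(frmE QL) (frmC QL v2 v1) v12 mulr0 add0r.
  have e3 : frm v3 x = frm v3 x2.
    by rewrite E1 E2 !(frmE QL) (frmC QL v3 v1) (frmC QL v3 v2) v13 v23 !mulr0 !add0r.
  have e4 : frm v4 x = frm v4 x2.
    by rewrite E1 E2 !(frmE QL) (frmC QL v4 v1) (frmC QL v4 v2) v14 v24 !mulr0 !add0r.
  rewrite e3 e4 e2 {1}E1 {1}E2 {1}E3 !(frmE QL); by field; rewrite n1 n2 n3 n4.
pose d12 := frm (br a v1) v2; pose d13 := frm (br a v1) v3; pose d14 := frm (br a v1) v4.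
pose d23 := frm (br a v2) v3; pose d24 := frm (br a v2) v4; pose d34 := frm (br a v3) v4.
set q1 := frm v1 v1 in n1 pars; set q2 := frm v2 v2 in n2 pars.
set q3 := frm v3 v3 in n3 v33 pars; set q4 := frm v4 v4 in n4 v44 pars.
have sk x y : frm x (br a y) = - frm y (br a x) by rewrite (frmC QL) skew.
have co x : x \in W -> [/\
    frm v1 (br a x) = - (d12 * frm v2 x / q2 + d13 * frm v3 x / q3 + d14 * frm v4 x / q4),
    frm v2 (br a x) = d12 * frm v1 x / q1 - d23 * frm v3 x / q3 - d24 * frm v4 x / q4,
    frm v3 (br a x) = d13 * frm v1 x / q1 + d23 * frm v2 x / q2 - d34 * frm v4 x / q4 &
    frm v4 (br a x) = d14 * frm v1 x / q1 + d24 * frm v2 x / q2 + d34 * frm v3 x / q3].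
  have e12 : frm v2 (br a v1) = d12 by rewrite (frmC QL).
  have e13 : frm v3 (br a v1) = d13 by rewrite (frmC QL).
  have e14 : frm v4 (br a v1) = d14 by rewrite (frmC QL).
  have e23 : frm v3 (br a v2) = d23 by rewrite (frmC QL).
  have e24 : frm v4 (br a v2) = d24 by rewrite (frmC QL).
  have e34 : frm v4 (br a v3) = d34 by rewrite (frmC QL).
  move=> xW; split; rewrite sk pars ?st // !skew_self //.
  - by rewrite e12 e13 e14; ring.
  - by rewrite (sk v1) e12 e23 e24; ring.
  - by rewrite (sk v1) (sk v2) e13 e23 e34; ring.
  - by rewrite (sk v1) (sk v2) (sk v3) e14 e24 e34; ring.
(* The coefficients of X^4 + p X^2 + r for a skew matrix d relative to a diagonal form q: p is the
   sum of the principal 2 by 2 minors, r the squared Pfaffian over the discriminant. *)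
pose p := d12 ^+ 2 / (q1 * q2) + d13 ^+ 2 / (q1 * q3) + d14 ^+ 2 / (q1 * q4) +
  d23 ^+ 2 / (q2 * q3) + d24 ^+ 2 / (q2 * q4) + d34 ^+ 2 / (q3 * q4).
pose r := (d12 * d34 - d13 * d24 + d14 * d23) ^+ 2 / (q1 * q2 * q3 * q4).
exists p, r => x xW; have Dx := st _ xW; have D2x := st _ Dx; have D3x := st _ D2x.
have D4x := st _ D3x.
apply/eqP; rewrite -subr_eq0; apply/eqP; apply: ndW => [|y yW].
  by rewrite !(memvB, memvN, memvZ).
rewrite pars // ?memvB ?memvN ?memvZ //.
have [e1 e2 e3 e4] := co _ xW; have [f1 f2 f3 f4] := co _ Dx.
have [g1 g2 g3 g4] := co _ D2x; have [h1 h2 h3 h4] := co _ D3x.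
suff [-> -> -> ->] : [/\ frm v1 (br a (br a (br a (br a x))) - (- (p *: br a (br a x)) - r *: x)) = 0,
  frm v2 (br a (br a (br a (br a x))) - (- (p *: br a (br a x)) - r *: x)) = 0,
  frm v3 (br a (br a (br a (br a x))) - (- (p *: br a (br a x)) - r *: x)) = 0 &
  frm v4 (br a (br a (br a (br a x))) - (- (p *: br a (br a x)) - r *: x)) = 0].
  by rewrite !mul0r !addr0.
rewrite !(frmE QL) h1 h2 h3 h4 !(g1, g2, g3, g4) !(f1, f2, f3, f4) !(e1, e2, e3, e4) /p /r.
move: n1 n2 n3 n4 (frm v1 x) (frm v2 x) (frm v3 x) (frm v4 x).
move: (q1) (q2) (q3) (q4) (d12) (d13) (d14) (d23) (d24) (d34).
clear=> k1 k2 k3 k4 e12 e13 e14 e23 e24 e34 n1 n2 n3 n4 y1 y2 y3 y4.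
by split; field; rewrite ?n1 ?n2 ?n3 ?n4.
Qed.

(** With D = ad a, D^2 is symmetric while D is skew, so the relations D^2 = kD - c for x and y give
    2k phi(Dx, y) = 0. Applying this to Dx, which satisfies the same relation, leaves c phi(x, y) =
    0. *)
Lemma eigenspace_isotropic a k c x y : k <> 0 -> c <> 0 ->
  br a (br a x) = k *: br a x - c *: x -> br a (br a y) = k *: br a y - c *: y ->
  frm x y = 0.
Proof.
move=> /eqP k0 /eqP c0.
have key u v : br a (br a u) = k *: br a u - c *: u ->
    br a (br a v) = k *: br a v - c *: v -> frm (br a u) v = 0.
  move=> Eu Ev; have : frm (br a (br a u)) v = frm u (br a (br a v)).
    by rewrite !(skew QL) opprK.
  rewrite Eu Ev !(frmE QL) -(opprK (frm u (br a v))) -(skew QL) => /eqP.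
  rewrite -subr_eq0 => /eqP E; apply: (mulfI k0); rewrite mulr0.
  have e : (k * frm (br a u) v) *+ 2 = 0 by rewrite -[RHS]E; ring.
  by move/eqP: e; rewrite mulrn_eq0 => /eqP.
move=> Ex Ey; have := key (br a x) y; rewrite Ex !(brE QL) Ex => /(_ erefl Ey).
rewrite !(frmE QL) key // mulr0 add0r => /eqP.
by rewrite oppr_eq0 mulf_eq0 (negPf c0) => /eqP.
Qed.

Section Biquadratic.

Variables (a : L) (W : {vspace L}).
Hypotheses (ndW : nondegenerate_on W) (st : stable a W).

Definition form63 a x1 x2 y1 y2 :=
  [/\ frm x1 x1 = 0, frm x1 x2 = 0, frm x1 y1 = 0, frm x1 y2 = 1 & frm x2 x2 = 0] /\
  [/\ frm x2 y1 = 1, frm x2 y2 = 0, frm y1 y1 = 0, frm y1 y2 = 0 & frm y2 y2 = 0] /\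
  [/\ br a x1 = x1 + x2, br a x2 = x2, br a y1 = - y1 - y2 & br a y2 = - y2].

(** With D = ad a: (D^2 - 1)^2 = 0 but D^2 is not 1, so there are Jordan blocks of size 2 at 1 and
    -1, in duality under the form. *)
Lemma jordan_hyp w : (forall x, x \in W ->
    br a (br a (br a (br a x))) = 2 *: br a (br a x) - x) ->
  w \in W -> br a (br a w) <> w ->
  exists x1 x2 y1 y2, [/\ x1 \in W, x2 \in W, y1 \in W & y2 \in W] /\
    form63 a x1 x2 y1 y2.
Proof.
move=> D4 wW Nw.
(* The operator is (D - 1)(D + 1)^2. If it vanished on W so would its adjoint, and the sum of the
   two is 2(D^2 - 1). *)
have [u uW nz] : exists2 u, u \in W &
    br a (br a (br a u)) + br a (br a u) - br a u - u <> 0.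
  apply: NNPP => H; apply: Nw.
  have H1 u : u \in W -> br a (br a (br a u)) + br a (br a u) - br a u - u = 0.
    by move=> uW; apply: NNPP => H'; apply: H; exists u.
  have H2 u : u \in W -> - br a (br a (br a u)) + br a (br a u) + br a u - u = 0.
    move=> uW; apply: ndW => [|y yW]; first by rewrite !(memvB, memvD, memvN) ?st.
    rewrite -[RHS](frm0r QL u) -(H1 y yW) !(frmE QL) !(skew QL); ring.
  have := congr1 (fun v => 2^-1 *: v) (congr2 +%R (H1 w wW) (H2 w wW)).
  rewrite addr0 scaler0 => E; apply/eqP; rewrite -subr_eq0 -[X in _ == X]E; apply/eqP.
  by apply: (frm_eq QL) => t; rewrite !(frmE QL); field.
pose x2 := br a (br a (br a u)) + br a (br a u) - br a u - u.
pose x0 := br a (br a u) + 2 *: br a u + u.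
have D4u := D4 _ uW.
have Dx0 : br a x0 = x0 + x2.
  by rewrite /x0 /x2 !(brE QL); apply: (frm_eq QL) => t; rewrite !(frmE QL); ring.
have Dx2 : br a x2 = x2.
  by rewrite /x2 !(brE QL) D4u; apply: (frm_eq QL) => t; rewrite !(frmE QL); ring.
have x2W : x2 \in W by rewrite !(memvB, memvD) ?st.
have x0W : x0 \in W by rewrite !(memvB, memvD) ?memvZ ?st.
have {nz}[y0 y0W x2y0] := exists_dual QL ndW x2W nz.
clearbody x2 x0.
(* (X - 1)^2 (X + 2) / 4 is the spectral projection onto the generalized eigenspace of -1; the
   eigenvector x2 for 1 pairs with that component only, so phi(x2, y1) = 1. *)
pose y1 := 4^-1 *: (br a (br a (br a y0)) - 3 *: br a y0 + 2 *: y0).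
have y1W : y1 \in W by rewrite memvZ // !(memvB, memvD) ?memvZ ?st.
have D4y := D4 _ y0W.
have x2D x : frm x2 (br a x) = - frm x2 x by rewrite -[LHS]opprK -(skew QL) Dx2.
have x2y1 : frm x2 y1 = 1 by rewrite /y1 !(frmE QL) !x2D x2y0; field.
pose y2 := - (br a y1 + y1).
have Dy1 : br a y1 = - y1 - y2 by rewrite /y2 opprK addrCA addNr addr0.
have DDy1 : br a (br a y1) = - 2 *: br a y1 - 1 *: y1.
  rewrite /y1 !(brE QL) D4y !(brE QL); apply: (frm_eq QL) => t.
  by rewrite !(frmE QL); field.
clearbody y1.
have Dy2 : br a y2 = - y2.
  by rewrite /y2 !(brE QL) DDy1; apply: (frm_eq QL) => t; rewrite !(frmE QL); ring.
have Vp x : x = x0 \/ x = x2 -> br a (br a x) = 2 *: br a x - 1 *: x.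
  case=> ->; rewrite ?Dx0 ?(brE QL) ?Dx0 Dx2 ?Dx2;
    by apply: (frm_eq QL) => t; rewrite !(frmE QL); ring.
have Vm y : y = y1 \/ y = y2 -> br a (br a y) = - 2 *: br a y - 1 *: y.
  case=> ->; first exact: DDy1.
  by rewrite Dy2 (brNr QL) Dy2; apply: (frm_eq QL) => t; rewrite !(frmE QL); ring.
have two : (2 : F) <> 0 by apply/eqP; rewrite pnatr_eq0.
have two' : - (2 : F) <> 0 by apply/eqP; rewrite oppr_eq0 pnatr_eq0.
have one : (1 : F) <> 0 by apply/eqP; rewrite oner_eq0.
have Ip x y (Ex : x = x0 \/ x = x2) (Ey : y = x0 \/ y = x2) : frm x y = 0 :=
  eigenspace_isotropic two one (Vp _ Ex) (Vp _ Ey).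
have Im x y (Ex : x = y1 \/ x = y2) (Ey : y = y1 \/ y = y2) : frm x y = 0 :=
  eigenspace_isotropic two' one (Vm _ Ex) (Vm _ Ey).
have I00 := Ip x0 x0 (or_introl erefl) (or_introl erefl).
have I02 := Ip x0 x2 (or_introl erefl) (or_intror erefl).
have I22 := Ip x2 x2 (or_intror erefl) (or_intror erefl).
have J11 := Im y1 y1 (or_introl erefl) (or_introl erefl).
have J12 := Im y1 y2 (or_introl erefl) (or_intror erefl).
have J22 := Im y2 y2 (or_intror erefl) (or_intror erefl).
(* As phi(x2, y1) = 1, this makes the first vector orthogonal to y1 without disturbing the Jordan
   relation. *)
pose c := frm x0 y1; exists (x0 - c *: x2), x2, y1, y2.
have y2W : y2 \in W by rewrite memvN memvD ?st.
have x2y2 : frm x2 y2 = 0 by rewrite /y2 !(frmE QL) x2D; ring.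
have x0y2 : frm x0 y2 = 1.
  rewrite /y2 !(frmE QL) -/c -[frm x0 (br a y1)]opprK -(skew QL) Dx0 (frmE QL) x2y1 -/c.
  by ring.
clearbody y2; split; first by split; rewrite // memvB ?memvZ.
split; [split|split; split]; rewrite ?(frmE QL) ?(brE QL) ?[frm x2 x0](frmC QL) ?I00 ?I02 ?I22 //.
- by rewrite !mulr0 !oppr0 !addr0.
- by rewrite mulr0 oppr0 addr0.
- by rewrite -/c x2y1 mulr1 subrr.
- by rewrite x0y2 x2y2 mulr0 oppr0 addr0.
- by rewrite Dx0 Dx2; apply: (frm_eq QL) => t; rewrite !(frmE QL); ring.
Qed.

Definition form66 a b x1 x2 y1 y2 :=
  [/\ frm x1 x1 = 0, frm x1 x2 = 0, frm x1 y1 = 0, frm x1 y2 = (-1) ^+ b & frm x2 x2 = 0] /\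
  [/\ frm x2 y1 = (-1) ^+ b, frm x2 y2 = 0, frm y1 y1 = 0, frm y1 y2 = 0 & frm y2 y2 = 0] /\
  [/\ br a x1 = y1 + x2, br a x2 = - y2, br a y1 = - x1 - y2 & br a y2 = x2].

Lemma jordan_rot w : (forall x, x \in W ->
    br a (br a (br a (br a x))) = - (2 *: br a (br a x)) - x) ->
  w \in W -> br a (br a w) <> - w ->
  exists b x1 x2 y1 y2, [/\ x1 \in W, x2 \in W, y1 \in W & y2 \in W] /\
    form66 a b x1 x2 y1 y2.
Proof.
move=> D4 wW Nw.
have [N NE] : exists N : L -> L, forall x, N x = br a (br a x) + x.
  by exists (fun x => br a (br a x) + x).
have NW x : x \in W -> N x \in W by move=> xW; rewrite NE memvD ?st.
have Nsym x y : frm (N x) y = frm x (N y).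
  by rewrite !NE !(frmE QL) !(skew QL) opprK.
(* N = D^2 + 1 is symmetric, so by polarization it would be 0 on W if its quadratic form were. *)
have [v vW nz] : exists2 v, v \in W & frm (N v) v <> 0.
  apply: NNPP => H; apply: Nw; apply/eqP; rewrite -addr_eq0; apply/eqP.
  have H1 u : u \in W -> frm (N u) u = 0.
    by move=> uW; apply: NNPP => H'; apply: H; exists u.
  rewrite -NE; apply: ndW => [|y yW]; first exact: NW.
  have := H1 _ (memvD wW yW); have -> : N (w + y) = N w + N y.
    by rewrite !NE !(brE QL) addrACA.
  rewrite !(frmE QL) !H1 // addr0 add0r (Nsym y w) (frmC QL y) -mulr2n => /eqP.
  by rewrite mulrn_eq0 => /eqP.
(* In the normal form N x1 = -2 y2 and phi(x1, y2) = (-1)^b, hence phi(N x1, x1) = -2 (-1)^b: this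
   fixes the factor 2 and the inverted sign. *)
pose k := (Num.sqrt (`|frm (N v) v| / 2))^-1; pose b := 0 < frm (N v) v.
have k0 : 0 < `|frm (N v) v| by rewrite normr_gt0; apply/eqP.
have NZ c x : N (c *: x) = c *: N x by rewrite !NE !(brE QL) scalerDr.
pose x0 := k *: v; have x0W : x0 \in W by rewrite memvZ.
have Nx0 : frm (N x0) x0 = - (2 * (-1) ^+ b).
  rewrite NZ !(frmE QL) mulrA -expr2 exprVn sqr_sqrtr ?divr_ge0 ?normr_ge0 //.
  rewrite /b; case: (ltrgt0P (frm (N v) v)) nz => [p _|p _|->] //; rewrite ?gtr0_norm ?ltr0_norm //=.
    by field; rewrite gt_eqF.
  by field; rewrite lt_eqF.
have NN x : x \in W -> N (N x) = 0.
  move=> xW; rewrite !NE !(brE QL) D4 //; apply: (frm_eq QL) => t.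
  by rewrite !(frmE QL); ring.
clearbody x0.
have [y2 y2W [Nx0y2 Ny2]] : exists2 y2, y2 \in W & N x0 = - (2 *: y2) /\ N y2 = 0.
  exists (- (2^-1 *: N x0)); first by rewrite memvN memvZ ?NW.
  split; last by rewrite -scaleNr NZ NN // scaler0.
  by apply: (frm_eq QL) => t; rewrite !(frmE QL); field.
have [x2 x2E] : exists x2, br a y2 = x2 by exists (br a y2).
have x2W : x2 \in W by rewrite -x2E st.
have Dx2 : br a x2 = - y2 by apply/eqP; rewrite -addr_eq0 -x2E -NE Ny2.
have two (u : F) : - (2 * u) = 0 -> u = 0.
  by move/eqP; rewrite oppr_eq0 mulf_eq0 pnatr_eq0 => /eqP.
have y2y2 : frm y2 y2 = 0.
  by apply: two; have := Nsym x0 y2; rewrite Nx0y2 Ny2 !(frmE QL).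
have x0y2 : frm x0 y2 = (-1) ^+ b.
  have := Nx0; rewrite Nx0y2 !(frmE QL) (frmC QL) => /eqP.
  by rewrite eqr_opp => /eqP/mulfI; apply; rewrite pnatr_eq0.
have x0x2 : frm x0 x2 = 0.
  have DN x : br a (N x) = N (br a x) by rewrite !NE (brE QL).
  apply: two; rewrite -x2E -!(frmZr QL) -(frmNr QL) -(brZr QL) -(brNr QL) -Nx0y2.
  have : frm x0 (br a (N x0)) = - frm x0 (br a (N x0)).
    by rewrite {1}DN -Nsym -(skew QL) (frmC QL).
  by move/eqP; rewrite -addr_eq0 -mulr2n mulrn_eq0 => /eqP.
(* Removes the length of x0; N kills y2, so N x1 = N x0 is kept. *)
pose c := frm x0 x0; pose x1 := x0 - (c / 2 * (-1) ^+ b) *: y2.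
have x1x1 : frm x1 x1 = 0.
  rewrite !(frmE QL) y2y2 [frm y2 x0](frmC QL) x0y2 -/c.
  have s := sqr_sign F b; rewrite !mulr0 oppr0 addr0.
  transitivity (c - c * ((-1) ^+ b) ^+ 2); first by field.
  by rewrite s; ring.
have y2x2 : frm y2 x2 = 0 by rewrite -x2E (skew_self QL).
have x1x2 : frm x1 x2 = 0 by rewrite !(frmE QL) x0x2 y2x2 mulr0 oppr0 addr0.
have x1y2 : frm x1 y2 = (-1) ^+ b by rewrite !(frmE QL) x0y2 y2y2 mulr0 oppr0 addr0.
have Nx1 : N x1 = - (2 *: y2).
  have -> : N x1 = N x0 - (c / 2 * (-1) ^+ b) *: N y2.
    by rewrite /x1 !NE !(brE QL); apply: (frm_eq QL) => t; rewrite !(frmE QL); ring.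
  by rewrite Ny2 scaler0 subr0 Nx0y2.
have DDx1 : br a (br a x1) = - x1 - 2 *: y2.
  have : br a (br a x1) = N x1 - x1 by rewrite NE addrK.
  by rewrite Nx1 addrC.
have x1W : x1 \in W by rewrite memvB ?memvZ.
clearbody x1.
have x2x2 : frm x2 x2 = 0 by rewrite -{1}x2E (skew QL) Dx2 !(frmE QL) y2y2 !oppr0.
have Dx1y2 : frm (br a x1) y2 = 0 by rewrite (skew QL) x2E x1x2 oppr0.
have Dx1x2 : frm (br a x1) x2 = (-1) ^+ b by rewrite (skew QL) Dx2 !(frmE QL) x1y2 opprK.
have Dx1Dx1 : frm (br a x1) (br a x1) = 2 * (-1) ^+ b.
  by rewrite (skew QL) DDx1 !(frmE QL) x1x1 x1y2; ring.
exists b, x1, x2, (br a x1 - x2), y2; split; first by split; rewrite // memvB ?st.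
split; [split|split; split]; rewrite ?(frmE QL) ?(brE QL) //.
- by rewrite (skew_self QL) x1x2 subrr.
- by rewrite (frmC QL) Dx1x2 x2x2 subr0.
- by rewrite (frmC QL).
- rewrite Dx1Dx1 x2x2 Dx1x2 [frm x2 _](frmC QL) Dx1x2; ring.
- by rewrite Dx1y2 (frmC QL) y2x2 subrr.
- by rewrite subrK.
- by rewrite DDx1 Dx2; apply: (frm_eq QL) => t; rewrite !(frmE QL); ring.
Qed.

End Biquadratic.
End Skew4.

Section Skew45.

Variables (F : rcfType) (L : quad_datum F).
Hypothesis QL : quadratic_lie L.
Implicit Types (x y t v w h a : L) (U P Q W : {vspace L}) (b : bool).

Definition form67 a (l : F) x1 x2 y1 y2 :=
  [/\ frm x1 x1 = 0, frm x1 x2 = 0, frm x1 y1 = 0, frm x1 y2 = 1 & frm x2 x2 = 0] /\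
  [/\ frm x2 y1 = 1, frm x2 y2 = 0, frm y1 y1 = 0, frm y1 y2 = 0 & frm y2 y2 = 0] /\
  [/\ br a x1 = x1 - l *: y1, br a y1 = l *: x1 + y1, br a x2 = - x2 + l *: y2
    & br a y2 = - (l *: x2) - y2].

(** With D = ad a and c = 1 + l^2 the relation is (D^2 - 2D + c)(D^2 + 2D + c) = 0, with eigenvalues
    1 and -1 plus or minus il. Each factor produces a stable plane, written as real and imaginary
    parts; the two planes are isotropic and dual. *)
Lemma complex_quadruple a W l : nondegenerate_on W -> stable a W ->
  (0 < \dim W)%N -> 0 < l -> (forall x, x \in W ->
    br a (br a (br a (br a x))) =
      - ((2 * (l ^+ 2 - 1)) *: br a (br a x)) - ((1 + l ^+ 2) ^+ 2) *: x) ->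
  exists x1 x2 y1 y2, [/\ x1 \in W, x2 \in W, y1 \in W & y2 \in W] /\
    form67 a l x1 x2 y1 y2.
Proof.
move=> ndW st W0 l0 D4; have l1 : l != 0 by rewrite gt_eqF.
pose c := 1 + l ^+ 2; have c0 : c != 0 by rewrite gt_eqF // ltr_pwDl // exprn_even_ge0.
have two : (2 : F) <> 0 by apply/eqP; rewrite pnatr_eq0.
have two' : - (2 : F) <> 0 by apply/eqP; rewrite oppr_eq0 pnatr_eq0.
(* The adjoint of D^2 + 2D + c is D^2 - 2D + c. If both vanished on W, their difference would give D
   = 0, and then c w = 0. *)
have [w wW nz] : exists2 w, w \in W & br a (br a w) + 2 *: br a w + c *: w <> 0.
  apply: NNPP => H; have [w wW w0] := dim_gt0 W0; apply: w0.
  have H1 u : u \in W -> br a (br a u) + 2 *: br a u + c *: u = 0.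
    by move=> uW; apply: NNPP => H'; apply: H; exists u.
  have H2 u : u \in W -> br a (br a u) - 2 *: br a u + c *: u = 0.
    move=> uW; apply: ndW => [|y yW]; first by rewrite !(memvB, memvD, memvN, memvZ) ?st.
    rewrite -[RHS](frm0r QL u) -(H1 y yW) !(frmE QL) !(skew QL); ring.
  have Dw : br a w = 0.
    have := congr1 (fun v => 4^-1 *: v) (congr2 +%R (H1 w wW) (congr1 -%R (H2 w wW))).
    rewrite oppr0 addr0 scaler0 => E; rewrite -[RHS]E; apply: (frm_eq QL) => t.
    by rewrite !(frmE QL); field.
  have := H1 w wW; rewrite Dw (br0r QL) scaler0 !add0r => /eqP.
  by rewrite scaler_eq0 (negPf c0) => /eqP.
pose x1 := br a (br a w) + 2 *: br a w + c *: w.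
have D4w := D4 w wW.
have DDx1 : br a (br a x1) = 2 *: br a x1 - c *: x1.
  rewrite /x1 !(brE QL) D4w; apply: (frm_eq QL) => t; rewrite !(frmE QL) /c; ring.
have x1W : x1 \in W by rewrite !(memvD) ?memvZ ?st.
have x10 : x1 <> 0 := nz.
clearbody x1.
pose y1 := - (l^-1 *: (br a x1 - x1)).
have Dx1 : br a x1 = x1 - l *: y1.
  by apply: (frm_eq QL) => t; rewrite /y1 !(frmE QL); field.
have y1W : y1 \in W by rewrite memvN memvZ // memvB ?st.
have Dy1 : br a y1 = l *: x1 + y1.
  rewrite {1}/y1 !(brE QL) DDx1 Dx1; apply: (frm_eq QL) => t.
  by rewrite !(frmE QL) /c; field.
clearbody y1.
have Dx10 : br a x1 <> 0.
  move=> Dx10; have := DDx1; rewrite Dx10 (br0r QL) scaler0 sub0r => /esym/eqP.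
  by rewrite oppr_eq0 scaler_eq0 (negPf c0) => /eqP.
have [y0 y0W x1y0] := exists_dual QL ndW (st _ x1W) Dx10.
have [u uE] : exists u, u = br a (br a y0) - 2 *: br a y0 + c *: y0.
  by exists (br a (br a y0) - 2 *: br a y0 + c *: y0).
have uW : u \in W by rewrite uE !(memvB, memvD) ?memvZ ?st.
have D4y := D4 y0 y0W.
have DDu : br a (br a u) = - 2 *: br a u - c *: u.
  rewrite uE !(brE QL) D4y; apply: (frm_eq QL) => t; rewrite !(frmE QL) /c; ring.
have x1u : frm x1 u = 4.
  have -> : frm x1 u = frm (br a (br a x1) + 2 *: br a x1 + c *: x1) y0.
    by rewrite uE !(frmE QL) !(skew QL); ring.
  by rewrite DDx1 !(frmE QL) x1y0; ring.
have [v vE] : exists v, v = l^-1 *: (br a u + u) by exists (l^-1 *: (br a u + u)).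
have vW : v \in W by rewrite vE memvZ // memvD ?st.
have Du : br a u = - u + l *: v.
  by apply: (frm_eq QL) => t; rewrite vE !(frmE QL); field.
have Dv : br a v = - v - l *: u.
  rewrite {1}vE !(brE QL) DDu Du; apply: (frm_eq QL) => t; rewrite !(frmE QL) /c.
  by field.
pose d := frm x1 v; have e0 : d ^+ 2 + 16 != 0.
  by rewrite gt_eqF // ltr_wpDl // exprn_even_ge0.
(* Solves 4s + dr = 0 and ds - 4r = 1, that is phi(x1, x2) = 0 and phi(x1, y2) = 1. The passage from
   u, v to x2, y2 is a multiplication by a complex number, so it commutes with D. *)
pose s := d / (d ^+ 2 + 16); pose r := - 4 / (d ^+ 2 + 16).
have [x2 x2E] : exists x2, x2 = s *: u + r *: v by exists (s *: u + r *: v).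
have [y2 y2E] : exists y2, y2 = s *: v - r *: u by exists (s *: v - r *: u).
have Dx2 : br a x2 = - x2 + l *: y2.
  by rewrite x2E y2E !(brE QL) Du Dv; apply: (frm_eq QL) => t; rewrite !(frmE QL); ring.
have Dy2 : br a y2 = - (l *: x2) - y2.
  by rewrite x2E y2E !(brE QL) Du Dv; apply: (frm_eq QL) => t; rewrite !(frmE QL); ring.
have x1x2 : frm x1 x2 = 0.
  by rewrite x2E !(frmE QL) x1u -/d /s /r; field.
have x1y2 : frm x1 y2 = 1.
  by rewrite y2E !(frmE QL) x1u -/d /s /r; field.
have Vp x : x = x1 \/ x = y1 -> br a (br a x) = 2 *: br a x - c *: x.
  case=> -> //; rewrite Dy1 !(brE QL) Dy1 Dx1; apply: (frm_eq QL) => t.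
  by rewrite !(frmE QL) /c; ring.
have Vm y : y = x2 \/ y = y2 -> br a (br a y) = - 2 *: br a y - c *: y.
  by case=> ->; rewrite ?Dx2 ?Dy2 !(brE QL) Dx2 Dy2; apply: (frm_eq QL) => t;
    rewrite !(frmE QL) /c; ring.
have /eqP c0' := c0.
have Ip x y (Ex : x = x1 \/ x = y1) (Ey : y = x1 \/ y = y1) : frm x y = 0 :=
  eigenspace_isotropic QL two c0' (Vp _ Ex) (Vp _ Ey).
have Im x y (Ex : x = x2 \/ x = y2) (Ey : y = x2 \/ y = y2) : frm x y = 0 :=
  eigenspace_isotropic QL two' c0' (Vm _ Ex) (Vm _ Ey).
have x2Dx1 : frm x2 (br a x1) = - l.
  by rewrite -[LHS]opprK -(skew QL) Dx2 !(frmE QL) (frmC QL x2) (frmC QL y2) x1x2 x1y2; ring.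
have y2Dx1 : frm y2 (br a x1) = 1.
  by rewrite -[LHS]opprK -(skew QL) Dy2 !(frmE QL) (frmC QL x2) (frmC QL y2) x1x2 x1y2; ring.
have x2y1 : frm x2 y1 = 1.
  apply: (mulfI l1); move: x2Dx1; rewrite Dx1 !(frmE QL) (frmC QL x2) x1x2 => E; lra.
have y2y1 : frm y2 y1 = 0.
  apply: (mulfI l1); move: y2Dx1; rewrite Dx1 !(frmE QL) (frmC QL y2) x1y2 => E; lra.
exists x1, x2, y1, y2; split.
  by split; rewrite // ?x2E ?y2E ?memvB ?memvD ?memvZ.
split; [split|split; split]; rewrite // ?(frmC QL y1 y2) //;
  (by apply: Ip; tauto) || (by apply: Im; tauto).
Qed.

Lemma stableZ k a W : stable a W -> stable (k *: a) W.
Proof. by move=> st x xW; rewrite (brE QL) memvZ ?st. Qed.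

(** Discussion of the discriminant of X^2 + pX + r, whose roots are the eigenvalues of the square of
    ad a: negative gives a complex quadruple, positive two planes, zero two planes or a Jordan
    block. *)
Lemma skew4_cases a W : nondegenerate_on W -> \dim W = 4 -> stable a W ->
  (forall x, x \in W -> br a x = 0 -> x = 0) ->
  (exists Q W', [/\ (Q <= W)%VS, nondegenerate_on Q, \dim Q = 2, stable a Q &
    iso_kernel a Q] /\ [/\ (W' <= W)%VS, nondegenerate_on W', \dim W' = 2,
    stable a W' & iso_kernel a W'] /\
    (forall x y, x \in Q -> y \in W' -> frm x y = 0)) \/
  exists k, 0 < k /\ exists x1 x2 y1 y2,
   [/\ x1 \in W, x2 \in W, y1 \in W & y2 \in W] /\
   [\/ form63 (k *: a) x1 x2 y1 y2, exists b, form66 (k *: a) b x1 x2 y1 y2 |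
     exists l, 0 < l /\ form67 (k *: a) l x1 x2 y1 y2].
Proof.
move=> ndW dW st inj.
have ik : iso_kernel a W by move=> x xW /(inj _ xW) ->; rewrite (frmE QL).
have planes v s : v \in W -> frm v v <> 0 -> br a (br a v) = s *: v ->
   exists Q W', [/\ (Q <= W)%VS, nondegenerate_on Q, \dim Q = 2, stable a Q &
    iso_kernel a Q] /\ [/\ (W' <= W)%VS, nondegenerate_on W', \dim W' = 2,
    stable a W' & iso_kernel a W'] /\
    (forall x y, x \in Q -> y \in W' -> frm x y = 0).
  move=> vW vv Dv; have s0 : s <> 0.
    move=> s0; apply: vv; rewrite s0 scale0r in Dv.
    by rewrite (inj _ vW) ?(frmE QL) //; apply: (inj) => //; apply: st.
  have [Q [W' [HQ [[h1 h2 h3 h4 h5] HH]]]] := plane_split QL ndW st ik vW vv Dv s0.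
  by exists Q, W'; split=> //; split=> //; split=> //; rewrite dW in h3; case: h3.
have [p [r D4]] := skew4_charpoly QL ndW dW st.
have [dpos|dneg] := leP 0 (p ^+ 2 - 4 * r); last first.
  right; have r0 : 0 < r by have := sqr_ge0 p; lra.
  pose q := Num.sqrt r; have q0 : 0 < q by rewrite sqrtr_gt0.
  have qr : q ^+ 2 = r by rewrite sqr_sqrtr // ltW.
  have qp1 : 0 < 2 * q - p by nra.
  have qp2 : 0 < 2 * q + p by nra.
  (* The eigenvalues are m and -m plus or minus in: p = 2(n^2 - m^2) and r = (m^2 + n^2)^2. Dividing
     a by m makes the real parts 1 and -1. *)
  pose m := Num.sqrt ((2 * q - p) / 4); pose n := Num.sqrt ((2 * q + p) / 4).
  have m0 : 0 < m by rewrite sqrtr_gt0 divr_gt0.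
  have n0 : 0 < n by rewrite sqrtr_gt0 divr_gt0.
  have m2 : m ^+ 2 = (2 * q - p) / 4 by rewrite sqr_sqrtr // ltW // divr_gt0.
  have n2 : n ^+ 2 = (2 * q + p) / 4 by rewrite sqr_sqrtr // ltW // divr_gt0.
  have m1 : m != 0 by rewrite gt_eqF.
  have ep : p = 2 * (n ^+ 2 - m ^+ 2) by rewrite m2 n2; field.
  have er : r = (n ^+ 2 + m ^+ 2) ^+ 2 by rewrite m2 n2 -qr; field.
  exists m^-1; split; first by rewrite invr_gt0.
  have [|||x1 [x2 [y1 [y2 [HW HF]]]]] :=
    @complex_quadruple (m^-1 *: a) W (n / m) ndW (stableZ _ st).
  - by rewrite dW.
  - exact: divr_gt0.
  - move=> x xW; rewrite !(brE QL) D4 // ep er; apply: (frm_eq QL) => t.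
    by rewrite !(frmE QL); field.
  by exists x1, x2, y1, y2; split=> //; constructor 3; exists (n / m); rewrite divr_gt0.
pose e := Num.sqrt (p ^+ 2 - 4 * r); have e2 : e ^+ 2 = p ^+ 2 - 4 * r by rewrite sqr_sqrtr.
pose s1 := (- p + e) / 2; pose s2 := (- p - e) / 2.
have fac x : x \in W -> br a (br a (br a (br a x))) =
    (s1 + s2) *: br a (br a x) - (s1 * s2) *: x.
  move=> xW; rewrite D4 // (_ : s1 + s2 = - p); last by rewrite /s1 /s2; field.
  rewrite (_ : s1 * s2 = r); first by rewrite scaleNr.
  have -> : s1 * s2 = (p ^+ 2 - e ^+ 2) / 4 by rewrite /s1 /s2; field.
  by rewrite e2; field.
have [|v vW vv] := exists_aniso QL ndW; first by rewrite dW.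
have [S1|] := classic (forall x, x \in W -> br a (br a x) = s1 *: x).
  by left; apply: (planes v s1); rewrite ?S1.
move=> H; have {H} [w [wW nw]] : exists w, w \in W /\ br a (br a w) - s1 *: w <> 0.
  apply: NNPP => H'; apply: H => x xW; apply: NNPP => nx; apply: H'; exists x; split=> //.
  by move/eqP; rewrite subr_eq0 => /eqP.
have fac2 x : x \in W -> br a (br a (br a (br a x) - s1 *: x)) = s2 *: (br a (br a x) - s1 *: x).
  move=> xW; rewrite !(brE QL) fac //; apply: (frm_eq QL) => t; rewrite !(frmE QL); ring.
have mW x : x \in W -> br a (br a x) - s1 *: x \in W.
  by move=> xW; rewrite memvB ?memvZ ?st.
have [e0|e0] := eqVneq e 0; last first.
  (* u and w2 are eigenvectors of the square of ad a for s2, and phi(u, w2) = s2 - s1 is nonzero; so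
     one of u, w2, u + w2 is anisotropic. *)
  left; pose u := br a (br a w) - s1 *: w; have uW : u \in W := mW _ wW.
  have Du : br a (br a u) = s2 *: u := fac2 _ wW.
  have nu : u <> 0 := nw; clearbody u.
  have [uu|uu] := classic (frm u u = 0); last exact: (planes u s2).
  have [w' w'W uw'] := exists_dual QL ndW uW nu.
  have [w2 w2E] : exists w2, w2 = br a (br a w') - s1 *: w'.
    by exists (br a (br a w') - s1 *: w').
  have w2W : w2 \in W by rewrite w2E mW.
  have Dw2 : br a (br a w2) = s2 *: w2 by rewrite w2E fac2.
  have uw2 : frm u w2 = s2 - s1.
    rewrite w2E !(frmE QL) -[frm u (br a _)]opprK -(skew QL) -[- frm (br a u) _]opprK opprK.
    rewrite -[frm (br a u) (br a w')]opprK -(skew QL) Du !(frmE QL) uw'; ring.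
  have [ww|ww] := classic (frm w2 w2 = 0); last exact: (planes w2 s2).
  apply: (planes (u + w2) s2); first exact: memvD.
    rewrite !(frmE QL) uu ww (frmC QL w2) uw2 addr0 add0r /s1 /s2.
    have -> : (- p - e) / 2 - (- p + e) / 2 + ((- p - e) / 2 - (- p + e) / 2) = - 2 * e by field.
    by apply/eqP; rewrite mulf_neq0 // oppr_eq0 pnatr_eq0.
  by rewrite !(brE QL) Du Dw2 scalerDr.
right; have s12 : s2 = s1 by rewrite /s1 /s2 e0 subr0 addr0.
rewrite s12 in fac fac2.
have s0 : s1 != 0.
  apply/eqP=> s0; apply: nw; apply: (inj _ (mW _ wW)).
  by apply: (inj _ (st _ (mW _ wW))); rewrite fac2 // s0 scale0r.
pose m := Num.sqrt `|s1|; have m0 : 0 < m by rewrite sqrtr_gt0 normr_gt0.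
have m2 : m ^+ 2 = `|s1| by rewrite sqr_sqrtr.
have m1 : m != 0 by rewrite gt_eqF.
exists m^-1; split; first by rewrite invr_gt0.
have [sp|sn|/eqP] := ltrgt0P s1; last by rewrite (negPf s0).
- have E1 : s1 = m ^+ 2 by rewrite m2 gtr0_norm.
  have [||x1 [x2 [y1 [y2 [HW HF]]]]] :=
    @jordan_hyp _ _ QL (m^-1 *: a) W ndW (stableZ _ st) w _ wW.
  + move=> x xW; rewrite !(brE QL) fac // E1; apply: (frm_eq QL) => t.
    by rewrite !(frmE QL); field.
  + rewrite !(brE QL) => E; apply: nw; apply/eqP; rewrite subr_eq0; apply/eqP.
    rewrite E1 -[X in _ = _ *: X]E.
    by apply: (frm_eq QL) => t; rewrite !(frmE QL); field.
  by exists x1, x2, y1, y2; split=> //; constructor 1.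
- have E1 : s1 = - m ^+ 2 by rewrite m2 ltr0_norm ?opprK.
  have [||b [x1 [x2 [y1 [y2 [HW HF]]]]]] :=
    @jordan_rot _ _ QL (m^-1 *: a) W ndW (stableZ _ st) w _ wW.
  + move=> x xW; rewrite !(brE QL) fac // E1; apply: (frm_eq QL) => t.
    by rewrite !(frmE QL); field.
  + rewrite !(brE QL) => E; apply: nw; apply/eqP; rewrite subr_eq0; apply/eqP.
    rewrite E1 scaleNr -scalerN -E; apply: (frm_eq QL) => t.
    by rewrite !(frmE QL); field.
  by exists x1, x2, y1, y2; split=> //; constructor 2; exists b.
Qed.

End Skew45.

(** * Skew operators with a kernel, in dimensions 4 and 5 *)

Section SkewSingular.

Variables (F : rcfType) (L : quad_datum F).
Hypothesis QL : quadratic_lie L.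
Implicit Types (x y t v w h a : L) (U P Q W : {vspace L}) (b : bool).

(** The Gram matrix of [tri a] is skew-symmetric of odd size, so its determinant equals its
    opposite. *)
Lemma odd_kernel a W : odd (\dim W) ->
  exists2 u, u \in W & u <> 0 /\ forall x, x \in W -> tri a u x = 0.
Proof.
move=> oddW; pose B := vbasis W; pose M := \matrix_(i, j < \dim W) tri a B`_i B`_j.
have MT : M^T = - M by apply/matrixP=> i j; rewrite !mxE (triCr QL).
have /det0P[v v0 vM] : \det M == 0.
  have := det_tr M; rewrite MT -scaleN1r detZ -signr_odd oddW expr1 mulN1r => /eqP.
  by rewrite eq_sym -addr_eq0 -mulr2n mulrn_eq0.
pose u := \sum_i v 0 i *: B`_i.
have BW (i : 'I_(\dim W)) : B`_i \in W by rewrite vbasis_mem // mem_nth ?size_tuple.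
have uW : u \in W by rewrite memv_suml // => i _; rewrite memvZ.
exists u => //; split.
  move=> u00; move/eqP: v0; apply; apply/rowP=> i; rewrite mxE.
  by have /freeP/(_ (v 0) u00) := basis_free (vbasisP W); apply.
have triS t (f : 'I_(\dim W) -> F) : tri a (\sum_i f i *: B`_i) t = \sum_i f i * tri a B`_i t.
  by elim/big_ind2: _ => [|x1 r1 x2 r2 E1 E2|i _]; rewrite !(triE QL) ?E1 ?E2.
have triSr t (f : 'I_(\dim W) -> F) : tri a t (\sum_i f i *: B`_i) = \sum_i f i * tri a t B`_i.
  by elim/big_ind2: _ => [|x1 r1 x2 r2 E1 E2|i _]; rewrite !(triE QL) ?E1 ?E2.
move=> x xW; rewrite (coord_vbasis xW) triSr big1 // => j _.
rewrite triS; move/rowP/(_ j): vM; rewrite !mxE => E.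
suff -> : \sum_i v 0 i * tri a B`_i B`_j = 0 by rewrite mulr0.
by rewrite -[RHS]E; apply: eq_bigr => i _; rewrite mxE.
Qed.

Lemma hyp_expand W k k' x : k \in W -> k' \in W ->
  frm k k = 0 -> frm k' k' = 0 -> frm k k' = 1 -> x \in W ->
  exists2 w, w \in perp (perp W k) k' & x = frm k x *: k' + frm k' x *: k + w.
Proof.
move=> kW k'W kk k'k' kk' xW.
exists (x - (frm k x *: k' + frm k' x *: k)); last by rewrite addrC subrK.
rewrite (mem_hyp QL) memvB ?memvD ?memvZ //= !(frmE QL) kk k'k' kk' (frmC QL k' k) kk'.
by apply/andP; split; apply/eqP; ring.
Qed.

Lemma hyp_eq0 W k k' x : nondegenerate_on W -> k \in W -> k' \in W ->
  frm k k = 0 -> frm k' k' = 0 -> frm k k' = 1 -> x \in W ->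
  frm x k = 0 -> frm x k' = 0 ->
  (forall w, w \in perp (perp W k) k' -> frm x w = 0) -> x = 0.
Proof.
move=> ndW kW k'W kk k'k' kk' xW xk xk' H; apply: ndW => // y yW.
have [w wP ->] := hyp_expand kW k'W kk k'k' kk' yW.
by rewrite !(frmE QL) xk xk' H // !mulr0 !addr0.
Qed.

Definition form61 a x1 x2 y1 y2 :=
  [/\ frm x1 x1 = 0, frm x1 x2 = 0, frm x1 y1 = 0, frm x1 y2 = 1 & frm x2 x2 = 0] /\
  [/\ frm x2 y1 = 1, frm x2 y2 = 0, frm y1 y1 = 0, frm y1 y2 = 0 & frm y2 y2 = 0] /\
  [/\ br a x1 = x2, br a x2 = 0, br a y1 = - y2 & br a y2 = 0].

Section Hyp.

Variables (a : L) (W : {vspace L}) (k k' : L).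
Hypotheses (ndW : nondegenerate_on W) (st : stable a W) (ik : iso_kernel a W).
Hypotheses (kW : k \in W) (k'W : k' \in W).
Hypotheses (kk : frm k k = 0) (k'k' : frm k' k' = 0) (kk' : frm k k' = 1).
Hypothesis Dk : br a k = 0.
Local Notation P := (perp (perp W k) k').

Let PP x : x \in P -> [/\ x \in W, frm k x = 0 & frm k' x = 0].
Proof. by rewrite (mem_hyp QL) => /and3P[-> /eqP-> /eqP->]. Qed.

Let kD x : frm (br a x) k = 0.
Proof. by rewrite (skew QL) Dk (frmE QL) oppr0. Qed.

Lemma kernel_image : br a k' \in P.
Proof. by rewrite (mem_hyp QL) st //= (frmC QL) kD (skew_self QL) eqxx. Qed.

(** The hypothesis forces ad a to kill k' + v, which pairs to 1 with k: two kernel vectors that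
    [not_both_kernel] forbids. *)
Lemma kernel_shift v : v \in P ->
  (forall w, w \in P -> frm (br a k') w + frm (br a v) w = 0) -> False.
Proof.
move=> vP H; have [vW kv k'v] := PP vP; pose x := k' + v.
have xW : x \in W by apply: memvD.
have Dx : br a x = 0.
  have Dxw w : w \in P -> frm (br a x) w = 0 by move=> wP; rewrite /x (brE QL) (frmE QL) H.
  apply: (hyp_eq0 ndW kW k'W kk k'k' kk'); rewrite ?st ?kD //.
  have : frm (br a x) (k' + v) = 0 by rewrite (frmC QL) (skew_self QL).
  by rewrite (frmDr QL) (Dxw v) // addr0.
have xx := ik xW Dx; have kx : frm k x = 1 by rewrite /x (frmE QL) kk' kv addr0.
exact: (not_both_kernel QL ik kW xW kk xx kx Dk Dx).
Qed.

Lemma kernel_br x : x \in P -> (forall y, y \in P -> frm (br a x) y = 0) ->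
  br a x = - (frm (br a k') x *: k).
Proof.
move=> xP H; have [xW kx k'x] := PP xP.
apply/eqP; rewrite -addr_eq0; apply/eqP.
apply: (hyp_eq0 ndW kW k'W kk k'k' kk'); rewrite ?memvD ?memvZ ?st //.
- by rewrite !(frmE QL) kD kk mulr0 addr0.
- by rewrite !(frmE QL) kk' mulr1 (skew QL) (frmC QL (br a k')) addNr.
- by move=> w wP; have [_ kw _] := PP wP; rewrite (frmDl QL) (frmZl QL) H // kw mulr0 addr0.
Qed.

Lemma skew4_singular_form : \dim P = 2 -> exists x1 x2 y1 y2,
  [/\ x1 \in W, x2 \in W, y1 \in W & y2 \in W] /\ form61 a x1 x2 y1 y2.
Proof.
move=> dP; have [ndP _] := nondeg_hyp QL ndW kW k'W kk k'k' kk'.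
have [p1 [p2 [b1 [b2 [p1P p2P p11 p22 p12]]]]] := ortho2 QL ndP dP.
have n1 : frm p1 p1 <> 0 by rewrite p11; apply: sign_neq0.
have n2 : frm p2 p2 <> 0 by rewrite p22; apply: sign_neq0.
have exp := dim2_scal QL dP p1P p2P n1 n2 p12.
have self x : frm (br a x) x = 0 by rewrite (frmC QL) (skew_self QL).
pose d := frm (br a p1) p2; have d' : frm (br a p2) p1 = - d by rewrite (skew QL) (frmC QL).
pose m := br a k'; have mP : m \in P := kernel_image.
have [mW km k'm] := PP mP.
(* Otherwise the compression of ad a to P is invertible, and solving for v puts [kernel_shift] to
   use. *)
have d0 : d = 0.
  apply: NNPP => /eqP d0.
  apply: (@kernel_shift (- (frm m p2 / d) *: p1 + (frm m p1 / d) *: p2)).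
    by rewrite memvD ?memvZ.
  move=> w wP; rewrite -/m (exp w wP) !(brE QL) !(frmE QL) !self d' -/d.
  by move/eqP: n1 n2 => n1 /eqP n2; field; rewrite d0 n1 n2.
have DP x : x \in P -> br a x = - (frm m x *: k).
  move=> xP; apply: kernel_br => // y yP.
  by rewrite (exp x xP) (exp y yP) !(brE QL) !(frmE QL) !self d' -/d d0; ring.
have m0 : m <> 0 by move=> m0; apply: (not_both_kernel QL ik kW k'W kk k'k' kk' Dk).
(* ad a sends x in P to -phi(m, x) k, so the complement of m in P is in the kernel; an anisotropic m
   would leave an anisotropic kernel vector there. *)
have mm : frm m m = 0.
  apply: NNPP => mm; have dm : \dim (perp P m) = 1%N.
    by have := dim_perp_eq QL mP mm; rewrite dP => -[].
  have [|p pP pp] := exists_aniso QL (nondeg_perp QL ndP mP mm); first by rewrite dm.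
  have pP' := perp_memW QL pP; have [pW _ _] := PP pP'; apply: pp; apply: ik => //.
  by rewrite DP // (perp_frm QL pP) scale0r oppr0.
have [m' [m'P mm' m'm']] := isotropic_partner QL ndP mP m0 mm.
have [m'W km' k'm'] := PP m'P.
exists k', m, m', k; split=> //; split; [split|split; split] => //.
- by rewrite (frmC QL).
- by rewrite (frmC QL).
- by rewrite (frmC QL).
- by rewrite DP // mm scale0r oppr0.
- by rewrite DP // mm' scale1r.
Qed.

(** An isotropic h and its partner leave an anisotropic line in P3; an isotropic vector orthogonal
    to h has no component there. *)
Lemma isotropic_plane3 (P3 U : {vspace L}) : nondegenerate_on P3 -> \dim P3 = 3 ->
  (U <= P3)%VS -> (forall x, x \in U -> frm x x = 0) -> (\dim U <= 1)%N.
Proof.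
move=> nd3 d3 /subvP sub iso; rewrite leqNgt; apply/negP => dU.
have [|h hU h0] := @dim_gt0 _ _ U; first exact: leq_trans dU.
have hh := iso _ hU.
have [h' [h'P hh' h'h']] := isotropic_partner QL nd3 (sub _ hU) h0 hh.
have [ndY dY] := nondeg_hyp QL nd3 (sub _ hU) h'P hh h'h' hh'.
have {}dY : \dim (perp (perp P3 h) h') = 1%N by rewrite d3 in dY; case: dY.
have [|y yY yy] := exists_aniso QL ndY; first by rewrite dY.
suff /dimvS : (U <= <[h]>)%VS by rewrite dim_vline leqNgt (leq_trans _ dU) // ltnS leq_b1.
apply/subvP=> x xU; have [w wY E] := hyp_expand (sub _ hU) h'P hh h'h' hh' (sub _ xU).
have := iso _ xU; rewrite E (isotropic_sub QL iso hU xU) (dim1_scal QL dY yY yy wY).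
move: (yY); rewrite (mem_hyp QL) => /and3P[_ /eqP hy /eqP h'y].
rewrite scale0r add0r !(frmE QL) hh hy (frmC QL y h) hy !mulr0 !add0r mulrA => /eqP.
rewrite mulf_eq0 (introF eqP yy) orbF -expr2 sqrf_eq0 => /eqP ->.
by rewrite scale0r addr0; apply/vlineP; exists (frm h' x).
Qed.

Lemma skew5_cases : \dim P = 3 ->
  (exists Q W', [/\ (Q <= W)%VS, nondegenerate_on Q, \dim Q = 2, stable a Q &
    iso_kernel a Q] /\ [/\ (W' <= W)%VS, nondegenerate_on W', \dim W = (\dim W').+2,
    stable a W' & iso_kernel a W'] /\
    (forall x y, x \in Q -> y \in W' -> frm x y = 0)) \/
  exists2 x, x \in W & frm x (br a (br a (br a (br a x)))) <> 0 /\
    br a (br a (br a (br a (br a x)))) = 0.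
Proof.
move=> dP; have [ndP _] := nondeg_hyp QL ndW kW k'W kk k'k' kk'.
pose m := br a k'; have mP : m \in P := kernel_image; have [mW km k'm] := PP mP.
have self x : frm (br a x) x = 0 by rewrite (frmC QL) (skew_self QL).
have skewC x y : frm (br a x) y = - frm (br a y) x by rewrite (skew QL) (frmC QL).
(* If the compression of ad a to P were 0, the complement of m in P, of dimension at least 2, would
   be in the kernel, hence totally isotropic. *)
have Dne : ~ (forall x y, x \in P -> y \in P -> frm (br a x) y = 0).
  move=> H; have d2 : (1 < \dim (perp P m))%N.
    by have := dim_perp P m; rewrite dP.
  suff : (\dim (perp P m) <= 1)%N by rewrite leqNgt d2.
  apply: (isotropic_plane3 ndP dP (perp_sub _ _)) => x xP'.
  have xP := perp_memW QL xP'; have [xW _ _] := PP xP; apply: ik => //.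
  by rewrite kernel_br -/m ?(perp_frm QL xP') ?scale0r ?oppr0 // => y yP; apply: H.
have [u uP [u0 uH]] := tri_kernel3 QL a dP; have [uW ku k'u] := PP uP.
have Hu x : x \in P -> frm (br a u) x = 0 := uH x.
have Hu' x : x \in P -> frm (br a x) u = 0 by move=> xP; rewrite skewC Hu ?oppr0.
have Du : br a u = - (frm m u *: k) by apply: kernel_br.
(* u is the radical vector of the compression to P. If anisotropic, it leaves a plane on which the
   compression is invertible, and a plane splits off; if isotropic, k' generates a Jordan chain of
   length 5. *)
have [uu|uu] := classic (frm u u = 0); last first.
  left; have ndQ := nondeg_perp QL ndP uP uu.
  have dQ : \dim (perp P u) = 2 by have := dim_perp_eq QL uP uu; rewrite dP => -[].
  have [q1 [q2 [b1 [b2 [q1Q q2Q q11 q22 q12]]]]] := ortho2 QL ndQ dQ.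
  have n1 : frm q1 q1 <> 0 by rewrite q11; apply: sign_neq0.
  have n2 : frm q2 q2 <> 0 by rewrite q22; apply: sign_neq0.
  have exp := dim2_scal QL dQ q1Q q2Q n1 n2 q12.
  have [q1P q2P] := (perp_memW QL q1Q, perp_memW QL q2Q).
  have [[q1W kq1 k'q1] [q2W kq2 k'q2]] := (PP q1P, PP q2P).
  pose d := frm (br a q1) q2.
  have /eqP d0 : d <> 0.
    move=> d0; apply: Dne => x y xP yP.
    have [x' x'Q ->] := frm_expand QL uP uu xP; have [y' y'Q ->] := frm_expand QL uP uu yP.
    rewrite !(brE QL) !(frmE QL) !Hu ?Hu' ?(perp_memW QL x'Q) ?(perp_memW QL y'Q) //.
    rewrite (exp x' x'Q) (exp y' y'Q) !(brE QL) !(frmE QL) !self -/d (skewC q2 q1) -/d d0.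
    by ring.
  have Pexp x y : x \in P -> y \in W -> frm y k = 0 -> frm y q1 = 0 -> frm y u = 0 ->
      frm y q2 = d -> frm y k' = - frm m x -> y = (d / frm q2 q2) *: q2 - frm m x *: k.
    move=> xP yW yk yq1 yu yq2 yk'; apply/eqP; rewrite -subr_eq0; apply/eqP.
    apply: (hyp_eq0 ndW kW k'W kk k'k' kk'); rewrite ?memvB ?memvZ // ?(frmE QL).
    - by rewrite yk (frmC QL q2) kq2 kk; ring.
    - by rewrite yk' (frmC QL q2) k'q2 kk'; ring.
    move=> w wP; have [_ kw _] := PP wP; have [w' w'Q ->] := frm_expand QL uP uu wP.
    have [_ kw' _] := PP (perp_memW QL w'Q).
    rewrite (exp w' w'Q) !(frmE QL) yu yq1 yq2 ku kq1 kq2 [frm q2 q1](frmC QL) q12.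
    by rewrite [frm q2 u](frmC QL) (perp_frm QL q2Q) divfK; [ring | apply/eqP].
  have D1 : br a q1 = (d / frm q2 q2) *: q2 - frm m q1 *: k.
    by apply: Pexp; rewrite ?st ?self ?kD ?Hu' // (skew QL) (frmC QL).
  have D2 : br a (br a q2) = - (d / frm q1 q1) *: br a q1.
    have -> : br a q2 = - (d / frm q1 q1) *: q1 - frm m q2 *: k.
      apply/eqP; rewrite -subr_eq0; apply/eqP.
      apply: (hyp_eq0 ndW kW k'W kk k'k' kk'); rewrite ?memvB ?memvZ ?st // ?(frmE QL).
      - by rewrite kD (frmC QL q1) kq1 kk; ring.
      - by rewrite (skew QL) (frmC QL q2) -/m (frmC QL q1) k'q1 kk'; ring.
      move=> w wP; have [_ kw _] := PP wP; have [w' w'Q ->] := frm_expand QL uP uu wP.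
      rewrite (exp w' w'Q) !(frmE QL) Hu' // self (skewC q2 q1) -/d ku kq1 kq2 q12.
      by rewrite [frm q1 u](frmC QL) (perp_frm QL q1Q) !mulNr divfK; [ring | apply/eqP].
    by rewrite !(brE QL) Dk; apply: (frm_eq QL) => t; rewrite !(frmE QL); ring.
  (* q1 is an eigenvector of the square of ad a only modulo k; applying ad a once more removes the
     term in k. *)
  apply: (@plane_split _ _ QL a W (br a q1) (- (d ^+ 2 / (frm q1 q1 * frm q2 q2)))) => //.
  - exact: st.
  - rewrite D1 !(frmE QL) kk kq2 [frm q2 k](frmC QL) kq2 !(mulr0, oppr0, addr0).
    by apply/eqP; rewrite !mulf_neq0 ?invr_eq0 //; apply/eqP.
  - rewrite {1}D1 !(brE QL) Dk (br0r QL) D2; apply: (frm_eq QL) => t; rewrite !(frmE QL).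
    by move/eqP: n1 n2 => n1 /eqP n2; field; rewrite n1 n2.
  - by apply/eqP; rewrite oppr_eq0 mulf_neq0 ?expf_neq0 // invr_eq0 mulf_neq0 //; apply/eqP.
have [u' [u'P uu' u'u']] := isotropic_partner QL ndP uP u0 uu.
have [ndY dY] := nondeg_hyp QL ndP uP u'P uu u'u' uu'.
have {}dY : \dim (perp (perp P u) u') = 1%N by rewrite dP in dY; case: dY.
have [|w wY ww] := exists_aniso QL ndY; first by rewrite dY.
move: (wY); rewrite (mem_hyp QL) => /and3P[wP /eqP uw /eqP u'w].
have [u'W ku' k'u'] := PP u'P; have [wW kw k'w] := PP wP.
have exp x : x \in P -> x = frm u x *: u' + frm u' x *: u + (frm w x / frm w w) *: w.
  move=> xP; have [y yY E] := hyp_expand uP u'P uu u'u' uu' xP.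
  rewrite {1}E {1}(dim1_scal QL dY wY ww yY); congr (_ + (_ / _) *: _).
  by rewrite E !(frmE QL) [frm w u](frmC QL) [frm w u'](frmC QL) uw u'w; ring.
pose d := frm (br a u') w.
have /eqP d0 : d <> 0.
  move=> d0; apply: Dne => x y xP yP; rewrite (exp x xP) (exp y yP) !(brE QL) !(frmE QL).
  by rewrite !Hu // !Hu' // !self -/d (skewC w u') -/d d0; ring.
(* A vector m orthogonal to the radical u is in the image of the compression, which [kernel_shift]
   excludes. *)
have [e0|/eqP e0] := classic (frm m u = 0).
  exfalso; apply: (@kernel_shift (- (frm m w / d) *: u' + (frm m u' / d) *: w)).
    by rewrite memvD ?memvZ.
  move=> x xP; rewrite -/m (exp x xP) !(brE QL) !(frmE QL) (Hu' u') // (Hu' w) // !self.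
  rewrite -/d (skewC w u') -/d.
  by rewrite e0; move/eqP: ww => ww; field; rewrite d0 ww.
right; exists k' => //; rewrite -/m.
have Dw : exists f g, br a w = f *: u + g *: k.
  exists (frm (br a w) u'), (frm (br a w) k'); apply/eqP; rewrite -subr_eq0; apply/eqP.
  apply: (hyp_eq0 ndW kW k'W kk k'k' kk'); rewrite ?memvB ?memvD ?memvZ ?st // ?(frmE QL).
  - by rewrite kD [frm u k](frmC QL) ku kk; ring.
  - by rewrite [frm u k'](frmC QL) k'u kk'; ring.
  move=> x xP; have [_ kx _] := PP xP.
  by rewrite (exp x xP) !(frmE QL) self uu' uu uw ku ku' kw Hu' //; ring.
have Dm : exists f g, br a m = (frm m u * d / frm w w) *: w + f *: u + g *: k.
  exists (frm (br a m) u'), (frm (br a m) k'); apply/eqP; rewrite -subr_eq0; apply/eqP.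
  apply: (hyp_eq0 ndW kW k'W kk k'k' kk'); rewrite ?memvB ?memvD ?memvZ ?st // ?(frmE QL).
  - by rewrite kD [frm w k](frmC QL) [frm u k](frmC QL) ku kw kk; ring.
  - by rewrite [frm u k'](frmC QL) [frm w k'](frmC QL) k'u k'w kk'; ring.
  have Dmw : frm (br a m) w = frm m u * d.
    rewrite {1}(exp m mP) !(brE QL) !(frmE QL) Hu // self -/d (frmC QL u m).
    by ring.
  move=> x xP; have [_ kx _] := PP xP.
  rewrite (exp x xP) !(frmE QL) [frm w u'](frmC QL) [frm w u](frmC QL) uu' uu uw u'w ku ku' kw.
  by rewrite Hu' // Dmw divfK; [ring | apply/eqP].
have [f [g Dw']] := Dw; have [f' [g' Dm']] := Dm.
have D3 : exists i j, br a (br a m) = i *: u + j *: k.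
  rewrite Dm' !(brE QL) Dw' Du Dk.
  exists (frm m u * d / frm w w * f), (frm m u * d / frm w w * g - f' * frm m u).
  by apply: (frm_eq QL) => t; rewrite !(frmE QL); ring.
have [i [j D3']] := D3; split.
  have -> : frm k' (br a (br a (br a m))) = frm (br a m) (br a m).
    by rewrite -[LHS]opprK -(skew QL) -/m -(skew QL).
  rewrite Dm' !(frmE QL) [frm w k](frmC QL) [frm w u](frmC QL) [frm u k](frmC QL).
  rewrite [frm k w]kw uu ku uw kk !(mulr0, addr0); apply/eqP.
  by rewrite !mulf_neq0 ?invr_eq0 //; apply/eqP.
by rewrite D3' !(brE QL) Du !(brE QL) Dk !(scaler0, oppr0, addr0, br0r QL).
Qed.

End Hyp.

End SkewSingular.

(** * The listed algebras in coordinates *)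

Arguments br : simpl never.
Arguments frm : simpl never.

Section Tables.
Variables (F : rcfType) (n : nat).

Definition vec (s : seq F) : 'rV[F]_n := \row_i s`_i.

Lemma vecD a b : size a = n -> size b = n ->
  vec a + vec b = vec [seq x.1 + x.2 | x <- zip a b].
Proof.
move=> sa sb; apply/rowP=> i; rewrite !mxE (nth_map (0, 0)) ?size_zip ?sa ?sb ?minnn //.
by rewrite nth_zip ?sa ?sb.
Qed.

Lemma vecZ k a : size a = n -> k *: vec a = vec [seq k * x | x <- a].
Proof. by move=> sa; apply/rowP=> i; rewrite !mxE (nth_map 0) ?sa. Qed.

Lemma vec0 : 0 = vec (nseq n 0).
Proof. by apply/rowP=> i; rewrite !mxE nth_nseq ltn_ord. Qed.

Lemma vec_eq a b : vec a = vec b -> size a = n -> size b = n -> a = b.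
Proof.
move=> /rowP ab sa sb; apply: (@eq_from_nth _ 0) => [|i]; first by rewrite sa.
by rewrite sa => ltin; have := ab (Ordinal ltin); rewrite !mxE.
Qed.

(** Bilinearity and alternation of the bracket and symmetry of the form hold for every table; only
    these four conditions depend on the entries. *)
Lemma table_quadratic (t : seq ('I_n * 'I_n * 'rV[F]_n)) q :
  let T := table_datum t q in
  (forall u v w : 'rV[F]_n, (@br F T u (@br F T v w) : 'rV[F]_n) +
     @br F T v (@br F T w u) + @br F T w (@br F T u v) = 0) ->
  (forall k (u v w : 'rV[F]_n),
     @frm F T (k *: u + v) w = k * @frm F T u w + @frm F T v w) ->
  (forall u : 'rV[F]_n, (forall v : 'rV[F]_n, @frm F T u v = 0) -> u = 0) ->
  (forall u v w : 'rV[F]_n, @frm F T (@br F T u v) w = @frm F T u (@br F T v w)) ->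
  quadratic_lie T.
Proof.
move=> T jac lin nd inv.
have sym (u v : T) : frm u v = frm v u.
  by rewrite /frm /= /polar_form [v + u]addrC addrAC.
split=> //; last by move=> x _ H; apply: nd => v; apply: (H v); rewrite memvf.
- split=> //.
    split=> v k x y; rewrite /br /= /table_br scaler_sumr -big_split;
    by apply: eq_bigr => r _ /=; rewrite !mxE scalerA -scalerDl; congr (_ *: _); ring.
  by move=> u; rewrite /br /= /table_br big1 // => r _; rewrite mulrC subrr scale0r.
- split=> v k x y; first exact: lin.
  by rewrite sym [frm v x]sym [frm v y]sym; apply: lin.
Qed.

End Tables.

Lemma cons_eq (T : Type) (a b : T) s t : a = b -> s = t -> a :: s = b :: t.
Proof. by move=> -> ->. Qed.

(** Replaces a vector by an explicit list of coordinates, on which brackets and forms compute. *)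
Lemma vec_ind (F : rcfType) n (P : 'rV[F]_n.+1 -> Prop) :
  (forall s, size s = n.+1 -> P (vec n.+1 s)) -> forall u, P u.
Proof.
move=> H u; suff -> : u = vec n.+1 [seq u 0 (inord k) | k <- iota 0 n.+1].
  by apply: H; rewrite size_map size_iota.
apply/rowP=> i; rewrite mxE (nth_map 0%N) ?size_iota ?ltn_ord //.
by rewrite nth_iota // add0n inord_val.
Qed.

Ltac list_cases n s :=
  match n with
  | O => destruct s; [move=> _ | discriminate]
  | S ?m => destruct s as [|? s]; [discriminate | list_cases m s]
  end.

Ltac coords n u := let s := fresh "s" in elim/vec_ind: u => s; list_cases n s.

Ltac list_ring := repeat (apply: cons_eq; first by [ring | field]); reflexivity.

Ltac vec_br :=
  apply/rowP; case; do 7?[case; first by move=> ?; rewrite /br /= table_brE /= !mxE /=; ring]; done.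

Ltac vec_frm := rewrite /frm /= /polar_form /vec !mxE /=; field.

Lemma oppr0_inv (F : rcfType) (x : F) : - x = 0 -> x = 0.
Proof. by move/eqP; rewrite oppr_eq0 => /eqP. Qed.

Lemma mulr0_inv (F : rcfType) (l x : F) : l != 0 -> l * x = 0 -> x = 0.
Proof. by move=> l0 /eqP; rewrite mulf_eq0 (negPf l0) => /eqP. Qed.

Lemma signr_neq0 (F : rcfType) (b : bool) : (-1) ^+ b != 0 :> F.
Proof. by rewrite signr_eq0. Qed.

Ltac clean_zeros :=
  repeat match goal with
  | H : 0 = 0 |- _ => clear H
  | H : ?s = 0 |- _ => is_var s; subst s
  | H : - _ = 0 |- _ => apply oppr0_inv in H
  | l0 : is_true (?l != 0), H : ?l * _ = 0 |- _ => apply (mulr0_inv l0) in H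
  | H : (-1) ^+ _ * _ = 0 |- _ => apply (mulr0_inv (@signr_neq0 _ _)) in H
  | H : _ = 0 |- _ => progress (rewrite ?(mulr0, mul0r, mulr1, mul1r, subr0, sub0r, addr0,
      add0r, oppr0, opprK) in H)
  end.

(** Each basis vector, from the last to the first, yields one coordinate equation, which
    [clean_zeros] solves. *)
Ltac basis_facts n m frmL H :=
  match m with
  | O => idtac
  | S ?m' =>
    have := H (vec n [seq (k == m')%:R | k <- iota 0 n]);
    rewrite /= frmL; move=> ?; clean_zeros; basis_facts n m' frmL H
  end.

Ltac vec_quad n brL frmL :=
  apply: table_quadratic;
  [ let u := fresh "u" in let v := fresh "v" in let w := fresh "w" in
    move=> u v w; coords n u; coords n v; coords n w;
    rewrite !brL !vecD //= vec0; apply: congr1; list_ring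
  | let k := fresh "k" in
    let u := fresh "u" in let v := fresh "v" in let w := fresh "w" in
    move=> k u v w; coords n u; coords n v; coords n w;
    rewrite vecZ // vecD //= !frmL; ring
  | let u := fresh "u" in let H := fresh "H" in
    move=> u; coords n u; move=> H; basis_facts n n frmL H; clear H;
    by rewrite vec0
  | let u := fresh "u" in let v := fresh "v" in let w := fresh "w" in
    move=> u v w; coords n u; coords n v; coords n w;
    rewrite !brL !frmL; ring].

Section Listed.
Variable F : rcfType.
Implicit Type l : F.

Lemma r1_brE (s : bool) a0 b0 : @br F (r1 F s)
    (vec 1 [:: a0]) (vec 1 [:: b0]) =
  vec 1 [:: 0].
Proof. by vec_br. Qed.

Lemma r1_frmE (s : bool) a0 b0 : @frm F (r1 F s)
    (vec 1 [:: a0]) (vec 1 [:: b0]) =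
  (-1) ^+ s * ((a0 * b0)).
Proof. by vec_frm. Qed.

Lemma r1_quadratic (s : bool) : quadratic_lie (r1 F s).
Proof. by vec_quad 1%N r1_brE r1_frmE. Qed.

Lemma r41_brE a0 a1 a2 a3 b0 b1 b2 b3 : @br F (r41 F)
    (vec 4 [:: a0; a1; a2; a3]) (vec 4 [:: b0; b1; b2; b3]) =
  vec 4 [:: 0;
    (a0 * b1 - a1 * b0);
    - (a0 * b2 - a2 * b0);
    (a1 * b2 - a2 * b1)].
Proof. by vec_br. Qed.

Lemma r41_frmE a0 a1 a2 a3 b0 b1 b2 b3 : @frm F (r41 F)
    (vec 4 [:: a0; a1; a2; a3]) (vec 4 [:: b0; b1; b2; b3]) =
  (a0 * b3 + a3 * b0) + (a1 * b2 + a2 * b1).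
Proof. by vec_frm. Qed.

Lemma r41_quadratic : quadratic_lie (r41 F).
Proof. by vec_quad 4%N r41_brE r41_frmE. Qed.

Lemma r42_brE (s : bool) a0 a1 a2 a3 b0 b1 b2 b3 : @br F (r42 F s)
    (vec 4 [:: a0; a1; a2; a3]) (vec 4 [:: b0; b1; b2; b3]) =
  vec 4 [:: 0;
    (a0 * b2 - a2 * b0);
    - (a0 * b1 - a1 * b0);
    - (a1 * b2 - a2 * b1)].
Proof. by vec_br. Qed.

Lemma r42_frmE (s : bool) a0 a1 a2 a3 b0 b1 b2 b3 : @frm F (r42 F s)
    (vec 4 [:: a0; a1; a2; a3]) (vec 4 [:: b0; b1; b2; b3]) =
  (-1) ^+ s * ((a0 * b3 + a3 * b0) + (a1 * b1) + (a2 * b2)).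
Proof. by vec_frm. Qed.

Lemma r42_quadratic (s : bool) : quadratic_lie (r42 F s).
Proof. by vec_quad 4%N r42_brE r42_frmE. Qed.

Lemma r5_brE (s : bool) a0 a1 a2 a3 a4 b0 b1 b2 b3 b4 : @br F (r5 F s)
    (vec 5 [:: a0; a1; a2; a3; a4]) (vec 5 [:: b0; b1; b2; b3; b4]) =
  vec 5 [:: 0;
    0;
    (a0 * b1 - a1 * b0);
    (a0 * b2 - a2 * b0);
    (a1 * b2 - a2 * b1)].
Proof. by vec_br. Qed.

Lemma r5_frmE (s : bool) a0 a1 a2 a3 a4 b0 b1 b2 b3 b4 : @frm F (r5 F s)
    (vec 5 [:: a0; a1; a2; a3; a4]) (vec 5 [:: b0; b1; b2; b3; b4]) =
  (-1) ^+ s * ((a0 * b4 + a4 * b0) - (a1 * b3 + a3 * b1) + (a2 * b2)).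
Proof. by vec_frm. Qed.

Lemma r5_quadratic (s : bool) : quadratic_lie (r5 F s).
Proof. by vec_quad 5%N r5_brE r5_frmE. Qed.

Lemma r61_brE a0 a1 a2 a3 a4 a5 b0 b1 b2 b3 b4 b5 : @br F (r61 F)
    (vec 6 [:: a0; a1; a2; a3; a4; a5]) (vec 6 [:: b0; b1; b2; b3; b4; b5]) =
  vec 6 [:: 0;
    0;
    (a0 * b1 - a1 * b0);
    0;
    - (a0 * b3 - a3 * b0);
    (a1 * b3 - a3 * b1)].
Proof. by vec_br. Qed.

Lemma r61_frmE a0 a1 a2 a3 a4 a5 b0 b1 b2 b3 b4 b5 : @frm F (r61 F)
    (vec 6 [:: a0; a1; a2; a3; a4; a5]) (vec 6 [:: b0; b1; b2; b3; b4; b5]) =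
  (a0 * b5 + a5 * b0) + (a1 * b4 + a4 * b1) + (a2 * b3 + a3 * b2).
Proof. by vec_frm. Qed.

Lemma r61_quadratic : quadratic_lie (r61 F).
Proof. by vec_quad 6%N r61_brE r61_frmE. Qed.

Lemma r62_brE (l : F) a0 a1 a2 a3 a4 a5 b0 b1 b2 b3 b4 b5 : @br F (r62 l)
    (vec 6 [:: a0; a1; a2; a3; a4; a5]) (vec 6 [:: b0; b1; b2; b3; b4; b5]) =
  vec 6 [:: 0;
    (a0 * b1 - a1 * b0);
    - (a0 * b2 - a2 * b0);
    l * (a0 * b3 - a3 * b0);
    - (l * (a0 * b4 - a4 * b0));
    (a1 * b2 - a2 * b1) + l * (a3 * b4 - a4 * b3)].
Proof. by vec_br. Qed.

Lemma r62_frmE (l : F) a0 a1 a2 a3 a4 a5 b0 b1 b2 b3 b4 b5 : @frm F (r62 l)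
    (vec 6 [:: a0; a1; a2; a3; a4; a5]) (vec 6 [:: b0; b1; b2; b3; b4; b5]) =
  (a0 * b5 + a5 * b0) + (a1 * b2 + a2 * b1) + (a3 * b4 + a4 * b3).
Proof. by vec_frm. Qed.

Lemma r62_quadratic (l : F) : quadratic_lie (r62 l).
Proof. by vec_quad 6%N r62_brE r62_frmE. Qed.

Lemma r63_brE a0 a1 a2 a3 a4 a5 b0 b1 b2 b3 b4 b5 : @br F (r63 F)
    (vec 6 [:: a0; a1; a2; a3; a4; a5]) (vec 6 [:: b0; b1; b2; b3; b4; b5]) =
  vec 6 [:: 0;
    (a0 * b1 - a1 * b0);
    (a0 * b1 - a1 * b0) + (a0 * b2 - a2 * b0);
    - (a0 * b3 - a3 * b0);
    - (a0 * b3 - a3 * b0) - (a0 * b4 - a4 * b0);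
    (a1 * b3 - a3 * b1) + (a1 * b4 - a4 * b1) + (a2 * b3 - a3 * b2)].
Proof. by vec_br. Qed.

Lemma r63_frmE a0 a1 a2 a3 a4 a5 b0 b1 b2 b3 b4 b5 : @frm F (r63 F)
    (vec 6 [:: a0; a1; a2; a3; a4; a5]) (vec 6 [:: b0; b1; b2; b3; b4; b5]) =
  (a0 * b5 + a5 * b0) + (a1 * b4 + a4 * b1) + (a2 * b3 + a3 * b2).
Proof. by vec_frm. Qed.

Lemma r63_quadratic : quadratic_lie (r63 F).
Proof. by vec_quad 6%N r63_brE r63_frmE. Qed.

Lemma r64_brE (l : F) (s : bool) a0 a1 a2 a3 a4 a5 b0 b1 b2 b3 b4 b5 : @br F (r64 l s)
    (vec 6 [:: a0; a1; a2; a3; a4; a5]) (vec 6 [:: b0; b1; b2; b3; b4; b5]) =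
  vec 6 [:: 0;
    (a0 * b1 - a1 * b0);
    - (a0 * b2 - a2 * b0);
    - (l * (a0 * b4 - a4 * b0));
    l * (a0 * b3 - a3 * b0);
    (a1 * b2 - a2 * b1) + l * (a3 * b4 - a4 * b3)].
Proof. by vec_br. Qed.

Lemma r64_frmE (l : F) (s : bool) a0 a1 a2 a3 a4 a5 b0 b1 b2 b3 b4 b5 : @frm F (r64 l s)
    (vec 6 [:: a0; a1; a2; a3; a4; a5]) (vec 6 [:: b0; b1; b2; b3; b4; b5]) =
  (-1) ^+ s * ((a0 * b5 + a5 * b0) + (a1 * b2 + a2 * b1) + (a3 * b3) + (a4 * b4)).
Proof. by vec_frm. Qed.

Lemma r64_quadratic (l : F) (s : bool) : quadratic_lie (r64 l s).
Proof. by vec_quad 6%N r64_brE r64_frmE. Qed.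

Lemma r65_brE (l : F) (e : bool) (s : bool) a0 a1 a2 a3 a4 a5 b0 b1 b2 b3 b4 b5 : @br F (r65 l e s)
    (vec 6 [:: a0; a1; a2; a3; a4; a5]) (vec 6 [:: b0; b1; b2; b3; b4; b5]) =
  vec 6 [:: 0;
    - (a0 * b2 - a2 * b0);
    (a0 * b1 - a1 * b0);
    - (l * (a0 * b4 - a4 * b0));
    l * (a0 * b3 - a3 * b0);
    (a1 * b2 - a2 * b1) + (-1) ^+ e * l * (a3 * b4 - a4 * b3)].
Proof. by vec_br. Qed.

Lemma r65_frmE (l : F) (e : bool) (s : bool) a0 a1 a2 a3 a4 a5 b0 b1 b2 b3 b4 b5 : @frm F (r65 l e s)
    (vec 6 [:: a0; a1; a2; a3; a4; a5]) (vec 6 [:: b0; b1; b2; b3; b4; b5]) =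
  (-1) ^+ s * ((a0 * b5 + a5 * b0) + (a1 * b1) + (a2 * b2)
    + (-1) ^+ e * (a3 * b3) + (-1) ^+ e * (a4 * b4)).
Proof. by vec_frm. Qed.

Lemma r65_quadratic (l : F) (e : bool) (s : bool) : quadratic_lie (r65 l e s).
Proof. by vec_quad 6%N r65_brE r65_frmE. Qed.

Lemma r66_brE (s : bool) a0 a1 a2 a3 a4 a5 b0 b1 b2 b3 b4 b5 : @br F (r66 F s)
    (vec 6 [:: a0; a1; a2; a3; a4; a5]) (vec 6 [:: b0; b1; b2; b3; b4; b5]) =
  vec 6 [:: 0;
    - (a0 * b3 - a3 * b0);
    (a0 * b1 - a1 * b0) + (a0 * b4 - a4 * b0);
    (a0 * b1 - a1 * b0);
    - (a0 * b3 - a3 * b0) - (a0 * b2 - a2 * b0);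
    (a1 * b2 - a2 * b1) + (a1 * b3 - a3 * b1) - (a3 * b4 - a4 * b3)].
Proof. by vec_br. Qed.

Lemma r66_frmE (s : bool) a0 a1 a2 a3 a4 a5 b0 b1 b2 b3 b4 b5 : @frm F (r66 F s)
    (vec 6 [:: a0; a1; a2; a3; a4; a5]) (vec 6 [:: b0; b1; b2; b3; b4; b5]) =
  (-1) ^+ s * ((a0 * b5 + a5 * b0) + (a1 * b4 + a4 * b1) + (a2 * b3 + a3 * b2)).
Proof. by vec_frm. Qed.

Lemma r66_quadratic (s : bool) : quadratic_lie (r66 F s).
Proof. by vec_quad 6%N r66_brE r66_frmE. Qed.

Lemma r67_brE (l : F) a0 a1 a2 a3 a4 a5 b0 b1 b2 b3 b4 b5 : @br F (r67 l)
    (vec 6 [:: a0; a1; a2; a3; a4; a5]) (vec 6 [:: b0; b1; b2; b3; b4; b5]) =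
  vec 6 [:: 0;
    (a0 * b1 - a1 * b0) + l * (a0 * b3 - a3 * b0);
    - (a0 * b2 - a2 * b0) - l * (a0 * b4 - a4 * b0);
    - (l * (a0 * b1 - a1 * b0)) + (a0 * b3 - a3 * b0);
    l * (a0 * b2 - a2 * b0) - (a0 * b4 - a4 * b0);
    - (l * (a1 * b2 - a2 * b1)) + (a1 * b4 - a4 * b1) + (a3 * b2 - a2 * b3) + l * (a3 * b4 - a4 * b3)].
Proof. by vec_br. Qed.

Lemma r67_frmE (l : F) a0 a1 a2 a3 a4 a5 b0 b1 b2 b3 b4 b5 : @frm F (r67 l)
    (vec 6 [:: a0; a1; a2; a3; a4; a5]) (vec 6 [:: b0; b1; b2; b3; b4; b5]) =
  (a0 * b5 + a5 * b0) + (a1 * b4 + a4 * b1) + (a2 * b3 + a3 * b2).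
Proof. by vec_frm. Qed.

Lemma r67_quadratic (l : F) : quadratic_lie (r67 l).
Proof. by vec_quad 6%N r67_brE r67_frmE. Qed.

Lemma r71_brE (s : bool) a0 a1 a2 a3 a4 a5 a6 b0 b1 b2 b3 b4 b5 b6 : @br F (r71 F s)
    (vec 7 [:: a0; a1; a2; a3; a4; a5; a6]) (vec 7 [:: b0; b1; b2; b3; b4; b5; b6]) =
  vec 7 [:: 0;
    0;
    (a0 * b1 - a1 * b0);
    (a0 * b2 - a2 * b0);
    (a0 * b3 - a3 * b0);
    (a0 * b4 - a4 * b0);
    (a1 * b4 - a4 * b1) - (a2 * b3 - a3 * b2)].
Proof. by vec_br. Qed.

Lemma r71_frmE (s : bool) a0 a1 a2 a3 a4 a5 a6 b0 b1 b2 b3 b4 b5 b6 : @frm F (r71 F s)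
    (vec 7 [:: a0; a1; a2; a3; a4; a5; a6]) (vec 7 [:: b0; b1; b2; b3; b4; b5; b6]) =
  (-1) ^+ s * ((a0 * b6 + a6 * b0) - (a1 * b5 + a5 * b1) + (a2 * b4 + a4 * b2) - (a3 * b3)).
Proof. by vec_frm. Qed.

Lemma r71_quadratic (s : bool) : quadratic_lie (r71 F s).
Proof. by vec_quad 7%N r71_brE r71_frmE. Qed.

Lemma r72_brE (s : bool) a0 a1 a2 a3 a4 a5 a6 b0 b1 b2 b3 b4 b5 b6 : @br F (r72 F s)
    (vec 7 [:: a0; a1; a2; a3; a4; a5; a6]) (vec 7 [:: b0; b1; b2; b3; b4; b5; b6]) =
  vec 7 [:: 0;
    (a0 * b1 - a1 * b0);
    - (a0 * b2 - a2 * b0);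
    0;
    (a0 * b3 - a3 * b0);
    (a0 * b4 - a4 * b0);
    (a1 * b2 - a2 * b1) + (a3 * b4 - a4 * b3)].
Proof. by vec_br. Qed.

Lemma r72_frmE (s : bool) a0 a1 a2 a3 a4 a5 a6 b0 b1 b2 b3 b4 b5 b6 : @frm F (r72 F s)
    (vec 7 [:: a0; a1; a2; a3; a4; a5; a6]) (vec 7 [:: b0; b1; b2; b3; b4; b5; b6]) =
  (-1) ^+ s * ((a0 * b6 + a6 * b0) + (a1 * b2 + a2 * b1) - (a3 * b5 + a5 * b3) + (a4 * b4)).
Proof. by vec_frm. Qed.

Lemma r72_quadratic (s : bool) : quadratic_lie (r72 F s).
Proof. by vec_quad 7%N r72_brE r72_frmE. Qed.

Lemma r73_brE (e : bool) (s : bool) a0 a1 a2 a3 a4 a5 a6 b0 b1 b2 b3 b4 b5 b6 : @br F (r73 F e s)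
    (vec 7 [:: a0; a1; a2; a3; a4; a5; a6]) (vec 7 [:: b0; b1; b2; b3; b4; b5; b6]) =
  vec 7 [:: 0;
    0;
    (a0 * b1 - a1 * b0);
    (a0 * b2 - a2 * b0);
    - (a0 * b5 - a5 * b0);
    (a0 * b4 - a4 * b0);
    (a1 * b2 - a2 * b1) + (-1) ^+ e * (a4 * b5 - a5 * b4)].
Proof. by vec_br. Qed.

Lemma r73_frmE (e : bool) (s : bool) a0 a1 a2 a3 a4 a5 a6 b0 b1 b2 b3 b4 b5 b6 : @frm F (r73 F e s)
    (vec 7 [:: a0; a1; a2; a3; a4; a5; a6]) (vec 7 [:: b0; b1; b2; b3; b4; b5; b6]) =
  (-1) ^+ s * ((a0 * b6 + a6 * b0) - (a1 * b3 + a3 * b1) + (a2 * b2)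
    + (-1) ^+ e * (a4 * b4) + (-1) ^+ e * (a5 * b5)).
Proof. by vec_frm. Qed.

Lemma r73_quadratic (e : bool) (s : bool) : quadratic_lie (r73 F e s).
Proof. by vec_quad 7%N r73_brE r73_frmE. Qed.

Lemma r75_brE (s : bool) a0 a1 a2 a3 a4 a5 a6 b0 b1 b2 b3 b4 b5 b6 : @br F (r75 F s)
    (vec 7 [:: a0; a1; a2; a3; a4; a5; a6]) (vec 7 [:: b0; b1; b2; b3; b4; b5; b6]) =
  vec 7 [:: 0;
    (a0 * b1 - a1 * b0);
    - (a0 * b2 - a2 * b0);
    (a1 * b2 - a2 * b1);
    (a0 * b4 - a4 * b0) + (a1 * b3 - a3 * b1);
    - (a0 * b5 - a5 * b0) + (a2 * b3 - a3 * b2);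
    - (a1 * b5 - a5 * b1) - (a2 * b4 - a4 * b2)].
Proof. by vec_br. Qed.

Lemma r75_frmE (s : bool) a0 a1 a2 a3 a4 a5 a6 b0 b1 b2 b3 b4 b5 b6 : @frm F (r75 F s)
    (vec 7 [:: a0; a1; a2; a3; a4; a5; a6]) (vec 7 [:: b0; b1; b2; b3; b4; b5; b6]) =
  (-1) ^+ s * (- (a0 * b6 + a6 * b0) + (a1 * b5 + a5 * b1) - (a2 * b4 + a4 * b2) + (a3 * b3)).
Proof. by vec_frm. Qed.

Lemma r75_quadratic (s : bool) : quadratic_lie (r75 F s).
Proof. by vec_quad 7%N r75_brE r75_frmE. Qed.

Lemma r76_brE (s : bool) a0 a1 a2 a3 a4 a5 a6 b0 b1 b2 b3 b4 b5 b6 : @br F (r76 F s)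
    (vec 7 [:: a0; a1; a2; a3; a4; a5; a6]) (vec 7 [:: b0; b1; b2; b3; b4; b5; b6]) =
  vec 7 [:: 0;
    - (a0 * b2 - a2 * b0);
    (a0 * b1 - a1 * b0);
    (a1 * b2 - a2 * b1);
    - (a0 * b5 - a5 * b0) + (a1 * b3 - a3 * b1);
    (a0 * b4 - a4 * b0) + (a2 * b3 - a3 * b2);
    (a1 * b4 - a4 * b1) + (a2 * b5 - a5 * b2)].
Proof. by vec_br. Qed.

Lemma r76_frmE (s : bool) a0 a1 a2 a3 a4 a5 a6 b0 b1 b2 b3 b4 b5 b6 : @frm F (r76 F s)
    (vec 7 [:: a0; a1; a2; a3; a4; a5; a6]) (vec 7 [:: b0; b1; b2; b3; b4; b5; b6]) =
  (-1) ^+ s * (- (a0 * b6 + a6 * b0) + (a1 * b5 + a5 * b1) - (a2 * b4 + a4 * b2) + (a3 * b3)).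
Proof. by vec_frm. Qed.

Lemma r76_quadratic (s : bool) : quadratic_lie (r76 F s).
Proof. by vec_quad 7%N r76_brE r76_frmE. Qed.

End Listed.

(** * Exhaustiveness *)

Section ListFrame.

Fixpoint all_prop (T : Type) (R : T -> Prop) (s : seq T) : Prop :=
  if s is x :: s' then R x /\ all_prop R s' else True.

Fixpoint pairs_le (T : Type) (R : T -> T -> Prop) (s : seq T) : Prop :=
  if s is x :: s' then all_prop (R x) s /\ pairs_le R s' else True.

Fixpoint pairs_lt (T : Type) (R : T -> T -> Prop) (s : seq T) : Prop :=
  if s is x :: s' then all_prop (R x) s' /\ pairs_lt R s' else True.

Fixpoint triples_lt (T : Type) (R : T -> T -> T -> Prop) (s : seq T) : Prop :=
  if s is x :: s' then pairs_lt (R x) s' /\ triples_lt R s' else True.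

Lemma all_propP T R (x0 : T) s : all_prop R s ->
  forall i, (i < size s)%N -> R (nth x0 s i).
Proof. by elim: s => //= x s IH [Rx /IH H] [|i] //; apply: H. Qed.

Lemma pairs_leP T R (x0 : T) s : pairs_le R s ->
  forall i j, (i <= j < size s)%N -> R (nth x0 s i) (nth x0 s j).
Proof.
elim: s => [_ i j|x s IH [H /IH {}IH]]; first by rewrite ltn0 andbF.
case=> [j ltj|i [//|j] ltij]; last exact: IH.
by have := all_propP x0 H ltj.
Qed.

Lemma pairs_ltP T R (x0 : T) s : pairs_lt R s ->
  forall i j, (i < j < size s)%N -> R (nth x0 s i) (nth x0 s j).
Proof.
elim: s => [_ i j|x s IH [H /IH {}IH]]; first by rewrite ltn0 andbF.
case=> [[//|j] ltj|i [//|j] ltij]; last exact: IH.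
by have := all_propP x0 H (i := j) ltj.
Qed.

Lemma triples_ltP T R (x0 : T) s : triples_lt R s ->
  forall i j k, (i < j < k)%N -> (k < size s)%N ->
  R (nth x0 s i) (nth x0 s j) (nth x0 s k).
Proof.
elim: s => [_ i j k|x s IH [H /IH {}IH]]; first by rewrite ltn0.
case=> [[//|j] [//|k] ltj ltk|i [//|j] [|k] ltij ltk]; last exact: IH.
  by have := pairs_ltP x0 H (i := j) (j := k); apply; rewrite -ltnS (andP ltj).2.
by rewrite andbF in ltij.
Qed.

Definition unit_vecs (F : rcfType) n : seq 'rV[F]_n :=
  [seq vec n [seq (k == i)%:R | k <- iota 0 n] | i <- iota 0 n].

(** [table_isometric] with the frame as a list: the conditions on pairs and triples unfold to finite
    conjunctions. *)
Lemma list_isometric (F : rcfType) (L : quad_datum F) n t q (s : seq L) :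
  quadratic_lie L -> quadratic_lie (@table_datum F n t q) ->
  \dim {: L} = n -> size s = n ->
  pairs_le (fun x y => frm x.1 y.1 = @frm F (table_datum t q) x.2 y.2)
    (zip s (unit_vecs F n)) ->
  triples_lt (fun x y z => tri x.1 y.1 z.1 = @tri F (table_datum t q) x.2 y.2 z.2)
    (zip s (unit_vecs F n)) ->
  isometric L (table_datum t q).
Proof.
move=> QL QT dL ss P2 P3.
have su : size (unit_vecs F n) = n by rewrite size_map size_iota.
have sz : size (zip s (unit_vecs F n)) = n by rewrite size_zip ss su minnn.
have nE (i : 'I_n) : nth (0, 0) (zip s (unit_vecs F n)) i = (s`_i, 'e_i).
  rewrite nth_zip ?su //; congr (_, _).
  rewrite (nth_map 0%N) ?size_iota // nth_iota // add0n.
  apply/rowP=> j; rewrite !mxE (nth_map 0%N) ?size_iota // nth_iota // eqxx.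
apply: (@table_isometric _ _ _ _ _ QL QT (fun i : 'I_n => s`_i)) => // [i j ij|i j k ijk].
  by have := pairs_leP (0, 0) P2 (i := i) (j := j); rewrite !nE sz ij ltn_ord => /(_ isT).
by have := triples_ltP (0, 0) P3 ijk; rewrite !nE sz ltn_ord => /(_ isT).
Qed.

End ListFrame.

Ltac sym_facts QL :=
  repeat match goal with
  | H : frm ?x ?y = _ |- _ =>
    lazymatch goal with
    | _ : frm y x = _ |- _ => fail
    | _ => let H' := fresh "S" in have H' := H; rewrite (frmC QL) in H'
    end
  end.

Ltac use_facts :=
  repeat match goal with H : frm ?x ?y = _ |- context [frm ?x ?y] => rewrite H end.

Ltac case_bools := repeat match goal with b : bool |- _ => destruct b end.

Ltac frame_end := use_facts;
  first [ring | case_bools; rewrite /= ?expr0 ?expr1; first [ring | by field; do ?(apply/andP; split)]].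

Ltac frame_gram QL frmL := rewrite frmL ?(frmE QL) /=; frame_end.

(** A triple containing z vanishes by centrality, a triple in V by [tV], and one starting with a is
    read off the action of ad a. *)
Ltac frame_tri QL brL frmL tz tV :=
  rewrite [in RHS]/tri brL frmL ?(triE QL) ?tz;
  repeat match goal with |- context [tri ?a ?x ?y] =>
    first [ rewrite (tV a x y); [ | assumption | assumption | assumption ]
          | match goal with H : br a x = _ |- _ => rewrite [tri a x y]/tri H ?(frmE QL) /= end ]
  end;
  frame_end.

Ltac frame QL quad brL frmL tz tV es :=
  sym_facts QL;
  apply: (@list_isometric _ _ _ _ _ es); [exact: QL | exact: quad | by [] | by [] |
    rewrite /=; do !split; frame_gram QL frmL |
    rewrite /=; do !split; frame_tri QL brL frmL tz tV].

Section Frames.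
Variables (F : rcfType) (L : quad_datum F).
Hypothesis QL : quadratic_lie L.
Implicit Types (a x y z : L) (b : bool).

Definition ext_data a z :=
  [/\ central z, frm z z = 0, frm a a = 0, frm a z = 1 &
   forall x y t, frm z x = 0 -> frm z y = 0 -> frm z t = 0 -> tri x y t = 0].

Definition perp2 a z x := frm a x = 0 /\ frm z x = 0.

Section Fixed.
Variables a z : L.
Hypothesis ed : ext_data a z.

Let tz u v : tri u v z = 0.
Proof. by case: ed => cz _ _ _ _; apply: (tri_centralr QL). Qed.

Lemma r41_frame x y : \dim {: L} = 4 -> perp2 a z x -> perp2 a z y ->
  hyp_plane a x y 1 -> isometric L (r41 F).
Proof.
move=> dL [ax zx] [ay zy] [xx yy xy Dx Dy]; have [cz zz aa az tV] := ed.
by frame QL r41_quadratic r41_brE r41_frmE tz tV [:: a; x; y; z].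
Qed.

Lemma r42_frame b x y : \dim {: L} = 4 -> perp2 a z x -> perp2 a z y ->
  rot_plane a b x y 1 -> isometric L (r42 F b).
Proof.
move=> dL [ax zx] [ay zy] [xx yy xy Dx Dy]; have [cz zz aa az tV] := ed.
(* The table has [a, x] = -y, hence the exchange of x and y. The sign on z compensates the sign in
   front of the whole form, as phi(a, z) = 1; the same factor recurs in the other frames. *)
by frame QL r42_quadratic r42_brE r42_frmE tz tV [:: a; y; x; (-1) ^+ b *: z].
Qed.

Lemma r5_frame_isometric b x1 x2 x3 : \dim {: L} = 5 ->
  perp2 a z x1 -> perp2 a z x2 -> perp2 a z x3 ->
  nil3 a b x1 x2 x3 -> isometric L (r5 F b).
Proof.
move=> dL [ax1 zx1] [ax2 zx2] [ax3 zx3] [[x11 x12 x13 x22 x23] [x33 D1 D2 D3]].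
have [cz zz aa az tV] := ed.
by frame QL r5_quadratic r5_brE r5_frmE tz tV [:: a; x1; x2; x3; (-1) ^+ b *: z].
Qed.

Lemma r61_frame x1 x2 y1 y2 : \dim {: L} = 6 ->
  perp2 a z x1 -> perp2 a z x2 -> perp2 a z y1 -> perp2 a z y2 ->
  form61 a x1 x2 y1 y2 -> isometric L (r61 F).
Proof.
move=> dL [ax1 zx1] [ax2 zx2] [ay1 zy1] [ay2 zy2].
move=> [[g1 g2 g3 g4 g5] [[g6 g7 g8 g9 g0] [D1 D2 D3 D4]]].
have [cz zz aa az tV] := ed.
by frame QL r61_quadratic r61_brE r61_frmE tz tV [:: a; x1; x2; y1; y2; z].
Qed.

Lemma r63_frame x1 x2 y1 y2 : \dim {: L} = 6 ->
  perp2 a z x1 -> perp2 a z x2 -> perp2 a z y1 -> perp2 a z y2 ->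
  form63 a x1 x2 y1 y2 -> isometric L (r63 F).
Proof.
move=> dL [ax1 zx1] [ax2 zx2] [ay1 zy1] [ay2 zy2].
move=> [[g1 g2 g3 g4 g5] [[g6 g7 g8 g9 g0] [D1 D2 D3 D4]]].
have [cz zz aa az tV] := ed.
by frame QL r63_quadratic r63_brE r63_frmE tz tV [:: a; x1; x2; y1; y2; z].
Qed.

Lemma r66_frame b x1 x2 y1 y2 : \dim {: L} = 6 ->
  perp2 a z x1 -> perp2 a z x2 -> perp2 a z y1 -> perp2 a z y2 ->
  form66 a b x1 x2 y1 y2 -> isometric L (r66 F b).
Proof.
move=> dL [ax1 zx1] [ax2 zx2] [ay1 zy1] [ay2 zy2].
move=> [[g1 g2 g3 g4 g5] [[g6 g7 g8 g9 g0] [D1 D2 D3 D4]]].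
have [cz zz aa az tV] := ed.
by frame QL r66_quadratic r66_brE r66_frmE tz tV [:: a; x1; x2; y1; y2; (-1) ^+ b *: z].
Qed.

Lemma r67_frame l x1 x2 y1 y2 : \dim {: L} = 6 ->
  perp2 a z x1 -> perp2 a z x2 -> perp2 a z y1 -> perp2 a z y2 ->
  form67 a l x1 x2 y1 y2 -> isometric L (r67 l).
Proof.
move=> dL [ax1 zx1] [ax2 zx2] [ay1 zy1] [ay2 zy2].
move=> [[g1 g2 g3 g4 g5] [[g6 g7 g8 g9 g0] [D1 D2 D3 D4]]].
have [cz zz aa az tV] := ed.
by frame QL r67_quadratic r67_brE r67_frmE tz tV [:: a; x1; x2; y1; y2; z].
Qed.

Lemma r62_frame l x y u v : \dim {: L} = 6 ->
  perp2 a z x -> perp2 a z y -> perp2 a z u -> perp2 a z v ->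
  [/\ frm x u = 0, frm x v = 0, frm y u = 0 & frm y v = 0] ->
  hyp_plane a x y 1 -> hyp_plane a u v l -> isometric L (r62 l).
Proof.
move=> dL [ax zx] [ay zy] [au zu] [av zv] [xu xv yu yv].
move=> [xx yy xy Dx Dy] [uu vv uv Du Dv]; have [cz zz aa az tV] := ed.
by frame QL r62_quadratic r62_brE r62_frmE tz tV [:: a; x; y; u; v; z].
Qed.

Lemma r64_frame l b x y u v : \dim {: L} = 6 ->
  perp2 a z x -> perp2 a z y -> perp2 a z u -> perp2 a z v ->
  [/\ frm x u = 0, frm x v = 0, frm y u = 0 & frm y v = 0] ->
  hyp_plane a x y 1 -> rot_plane a b u v l -> isometric L (r64 l b).
Proof.
move=> dL [ax zx] [ay zy] [au zu] [av zv] [xu xv yu yv].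
move=> [xx yy xy Dx Dy] [uu vv uv Du Dv]; have [cz zz aa az tV] := ed.
by frame QL r64_quadratic r64_brE r64_frmE tz tV
  [:: a; x; (-1) ^+ b *: y; u; v; (-1) ^+ b *: z].
Qed.

Lemma r65_frame l b b' x y u v : \dim {: L} = 6 ->
  perp2 a z x -> perp2 a z y -> perp2 a z u -> perp2 a z v ->
  [/\ frm x u = 0, frm x v = 0, frm y u = 0 & frm y v = 0] ->
  rot_plane a b x y 1 -> rot_plane a b' u v l -> isometric L (r65 l (b (+) b') b).
Proof.
move=> dL [ax zx] [ay zy] [au zu] [av zv] [xu xv yu yv].
move=> [xx yy xy Dx Dy] [uu vv uv Du Dv]; have [cz zz aa az tV] := ed.
by frame QL r65_quadratic r65_brE r65_frmE tz tV [:: a; x; y; u; v; (-1) ^+ b *: z].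
Qed.

Lemma r72_frame b x y u1 u2 u3 : \dim {: L} = 7 ->
  perp2 a z x -> perp2 a z y -> perp2 a z u1 -> perp2 a z u2 -> perp2 a z u3 ->
  [/\ frm x u1 = 0, frm x u2 = 0 & frm x u3 = 0] ->
  [/\ frm y u1 = 0, frm y u2 = 0 & frm y u3 = 0] ->
  hyp_plane a x y 1 -> nil3 a b u1 u2 u3 -> isometric L (r72 F b).
Proof.
move=> dL [ax zx] [ay zy] [au1 zu1] [au2 zu2] [au3 zu3] [xu1 xu2 xu3] [yu1 yu2 yu3].
move=> [xx yy xy Dx Dy] [[u11 u12 u13 u22 u23] [u33 D1 D2 D3]].
have [cz zz aa az tV] := ed.
by frame QL r72_quadratic r72_brE r72_frmE tz tV
  [:: a; x; (-1) ^+ b *: y; u1; u2; u3; (-1) ^+ b *: z].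
Qed.

Lemma r73_frame b b' x y u1 u2 u3 : \dim {: L} = 7 ->
  perp2 a z x -> perp2 a z y -> perp2 a z u1 -> perp2 a z u2 -> perp2 a z u3 ->
  [/\ frm x u1 = 0, frm x u2 = 0 & frm x u3 = 0] ->
  [/\ frm y u1 = 0, frm y u2 = 0 & frm y u3 = 0] ->
  rot_plane a b' x y 1 -> nil3 a b u1 u2 u3 -> isometric L (r73 F (b (+) b') b).
Proof.
move=> dL [ax zx] [ay zy] [au1 zu1] [au2 zu2] [au3 zu3] [xu1 xu2 xu3] [yu1 yu2 yu3].
move=> [xx yy xy Dx Dy] [[u11 u12 u13 u22 u23] [u33 D1 D2 D3]].
have [cz zz aa az tV] := ed.
by frame QL r73_quadratic r73_brE r73_frmE tz tV
  [:: a; u1; u2; u3; x; y; (-1) ^+ b *: z].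
Qed.

Definition nil5 b x1 x2 x3 x4 x5 :=
  [/\ frm x1 x1 = 0, frm x1 x2 = 0, frm x1 x3 = 0, frm x1 x4 = 0 & frm x1 x5 = - (-1) ^+ b] /\
  [/\ frm x2 x2 = 0, frm x2 x3 = 0, frm x2 x4 = (-1) ^+ b & frm x2 x5 = 0] /\
  [/\ frm x3 x3 = - (-1) ^+ b, frm x3 x4 = 0 & frm x3 x5 = 0] /\
  [/\ frm x4 x4 = 0, frm x4 x5 = 0 & frm x5 x5 = 0] /\
  [/\ br a x1 = x2, br a x2 = x3, br a x3 = x4, br a x4 = x5 & br a x5 = 0].

Lemma r71_frame b x1 x2 x3 x4 x5 : \dim {: L} = 7 ->
  perp2 a z x1 -> perp2 a z x2 -> perp2 a z x3 -> perp2 a z x4 -> perp2 a z x5 ->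
  nil5 b x1 x2 x3 x4 x5 -> isometric L (r71 F b).
Proof.
move=> dL [ax1 zx1] [ax2 zx2] [ax3 zx3] [ax4 zx4] [ax5 zx5].
move=> [[g1 g2 g3 g4 g5] [[g6 g7 g8 g9] [[g10 g11 g12] [[g13 g14 g15] [D1 D2 D3 D4 D5]]]]].
have [cz zz aa az tV] := ed.
by frame QL r71_quadratic r71_brE r71_frmE tz tV
  [:: a; x1; x2; x3; x4; x5; (-1) ^+ b *: z].
Qed.

End Fixed.
End Frames.

(** * From normal forms to labels *)

Section Classification.
Variables (F : rcfType) (L : quad_datum F).
Hypothesis QL : quadratic_lie L.
Implicit Types (a x y z v w : L) (b : bool) (W Q : {vspace L}).

Lemma hyp_planeZ k a x y m : hyp_plane a x y m -> hyp_plane (k *: a) x y (k * m).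
Proof.
by case=> ? ? ? Dx Dy; split; rewrite ?(brZl QL) ?Dx ?Dy ?scalerN ?scalerA.
Qed.

Lemma rot_planeZ k a b x y m : rot_plane a b x y m -> rot_plane (k *: a) b x y (k * m).
Proof.
by case=> ? ? ? Dx Dy; split; rewrite ?(brZl QL) ?Dx ?Dy ?scalerN ?scalerA.
Qed.

(** The two outer vectors are scaled inversely, so the Gram matrix is kept: a nilpotent block adapts
    to any scale of a, which leaves that scale free to normalize the other block. *)
Lemma nil3Z k a b x1 x2 x3 : k != 0 -> nil3 a b x1 x2 x3 ->
  nil3 (k *: a) b (k^-1 *: x1) x2 (k *: x3).
Proof.
move=> k0 [[x11 x12 x13 x22 x23] [x33 D1 D2 D3]].
split; split; rewrite ?(brE QL) ?(frmE QL) ?x11 ?x12 ?x13 ?x22 ?x23 ?x33 ?D1 ?D2 ?D3;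
  rewrite ?mulr0 ?scaler0 //.
  by rewrite mulrA mulVf ?mul1r.
by rewrite scalerA mulfV ?scale1r.
Qed.

(** With D = ad a, phi(x, Dx) and phi(x, D^3 x) vanish by skewness, so only even powers enter. For y
    = c1 x + c2 D^2 x + c3 D^4 x, the constant c1 normalizes phi(y, D^4 y) to a sign, c2 cancels
    phi(y, D^2 y), and c3 cancels phi(y, y). *)
Lemma nil5_form a x : frm x (br a (br a (br a (br a x)))) <> 0 ->
  br a (br a (br a (br a (br a x)))) = 0 ->
  exists b c1 c2 c3, let y := c1 *: x + c2 *: br a (br a x) +
      c3 *: br a (br a (br a (br a x))) in
    nil5 a b y (br a y) (br a (br a y)) (br a (br a (br a y)))
      (br a (br a (br a (br a y)))).
Proof.
move=> /eqP g0 D5; set g := frm x _ in g0; pose h := frm x (br a (br a x)).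
pose l := frm x x; pose c := Num.sqrt `|g|; pose b := 0 < g.
pose c1 := c^-1; pose c2 := - h / (2 * g) * c1.
pose c3 := (- l / (2 * g) + 3 * h ^+ 2 / (8 * g ^+ 2)) * c1.
have cg : c1 ^+ 2 * g = - (-1) ^+ b.
  rewrite exprVn sqr_sqrtr ?normr_ge0 // /b.
  have [gp|gn|/eqP] := ltrgt0P g; last by rewrite (negPf g0).
    by rewrite /= expr1 opprK mulVf.
  by rewrite /= expr0 invrN mulNr mulVf.
exists b, c1, c2, c3; set y := _ + _ => /=.
have Dy1 : br a y = c1 *: br a x + c2 *: br a (br a (br a x)).
  by rewrite /y !(brE QL) D5 scaler0 addr0.
have Dy2 : br a (br a y) = c1 *: br a (br a x) + c2 *: br a (br a (br a (br a x))).
  by rewrite Dy1 !(brE QL).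
have Dy3 : br a (br a (br a y)) = c1 *: br a (br a (br a x)).
  by rewrite Dy2 !(brE QL) D5 scaler0 addr0.
have Dy4 : br a (br a (br a (br a y))) = c1 *: br a (br a (br a (br a x))).
  by rewrite Dy3 !(brE QL).
have Dy5 : br a (br a (br a (br a (br a y)))) = 0 by rewrite Dy4 !(brE QL) D5 scaler0.
have s0 u : frm u (br a u) = 0 by apply: skew_self.
have s1 u w : frm (br a u) w = - frm u (br a w) by apply: skew.
have s3 u : frm u (br a (br a (br a u))) = 0 by rewrite -[LHS]opprK -s1 s0 oppr0.
have y4 : frm y (br a (br a (br a (br a y)))) = - (-1) ^+ b.
  rewrite Dy4 /y !(frmE QL) -/g !s1 D5 !(brE QL) !(frm0r QL) -cg; ring.
have y2 : frm y (br a (br a y)) = 0.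
  rewrite Dy2 /y !(frmE QL) -/g -/h !s1 D5 !(brE QL) !(frm0r QL) -/g /c2.
  by field.
have y0 : frm y y = 0.
  rewrite {2}/y /y !(frmE QL) -/g -/h -/l !s1 D5 !(brE QL) !(frm0r QL) -/g -/h /c2 /c3.
  by field.
clearbody y; do !split; rewrite ?s1 ?s0 ?s3 ?y0 ?y2 ?y4 ?Dy5 ?(br0r QL) ?(frm0r QL) ?oppr0 ?opprK //.
Qed.

Lemma ext_dataZ k a z : k != 0 -> ext_data a z -> ext_data (k *: a) (k^-1 *: z).
Proof.
move=> k0 [cz zz aa az tV]; have kV : k^-1 != 0 by rewrite invr_eq0.
split; rewrite ?(frmE QL) ?zz ?aa ?az ?mulr0 //.
- exact: centralZ.
- by rewrite mulr1 mulfV.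
move=> x y t; rewrite !(frmE QL) => /eqP + /eqP + /eqP.
rewrite !mulf_eq0 (negPf kV) /= => /eqP ? /eqP ? /eqP ?; exact: tV.
Qed.

Lemma perp2Z k m n a z x : perp2 a z x -> perp2 (k *: a) (m *: z) (n *: x).
Proof. by case=> ax zx; split; rewrite !(frmE QL) ?ax ?zx !mulr0. Qed.

Lemma perp2Z1 k m a z x : perp2 a z x -> perp2 (k *: a) (m *: z) x.
Proof. by case=> ax zx; split; rewrite !(frmE QL) ?ax ?zx !mulr0. Qed.

Definition listed := exists2 i : label F, admissible i & isometric L (algebra i).

Section Abelian.

Variables a z : L.
Hypothesis ed : ext_data a z.
Hypothesis iso : isotropic_center L.
Local Notation V := (perp (perp fullv z) a).

Let cz : central z. Proof. by case: ed. Qed.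
Let zz : frm z z = 0. Proof. by case: ed. Qed.
Let aa : frm a a = 0. Proof. by case: ed. Qed.
Let az : frm a z = 1. Proof. by case: ed. Qed.
Let za : frm z a = 1. Proof. by rewrite (frmC QL). Qed.

Lemma abelian_iso_kernel : iso_kernel a V.
Proof.
move=> x xV Dx; apply: iso; apply: (kern_central QL cz zz aa za _ Dx).
split=> // u v uV vV; have [_ _ _ _ tV] := ed.
by apply: tV; [case/(extP QL): xV | case/(extP QL): uV | case/(extP QL): vV].
Qed.

Lemma V_perp2 x : x \in V -> perp2 a z x.
Proof. by case/(extP QL). Qed.

Lemma abelian_stable : stable a V.
Proof. by move=> x _; apply: (ext_br QL). Qed.

Let scale (m : F) (m0 : 0 < m) : m^-1 != 0. Proof. by rewrite invr_eq0 gt_eqF. Qed.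

Lemma listed4 : \dim {: L} = 4 -> listed.
Proof.
move=> dL; have dV : \dim V = 2 by have := ext_dim QL zz aa za; rewrite dL => -[].
have [x [y [m [[xV yV m0] H]]]] := plane_form QL (ext_nondeg QL zz aa za) dV
  abelian_stable abelian_iso_kernel.
have [px py] := (V_perp2 xV, V_perp2 yV); have ed' := ext_dataZ (scale m0) ed.
have mm : m^-1 * m = 1 by rewrite mulVf // gt_eqF.
case: H => [H|[b H]].
  exists R41 => //; have := hyp_planeZ m^-1 H; rewrite mm.
  by apply: (r41_frame QL ed' dL); apply: perp2Z1.
exists (R42 b) => //; have := rot_planeZ m^-1 H; rewrite mm.
by apply: (r42_frame QL ed' dL); apply: perp2Z1.
Qed.

Lemma listed5 : \dim {: L} = 5 -> listed.
Proof.
move=> dL; have dV : \dim V = 3 by have := ext_dim QL zz aa za; rewrite dL => -[].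
have [b [x1 [x2 [x3 [[x1V x2V x3V] H]]]]] := nil3_form QL (ext_nondeg QL zz aa za) dV
  abelian_stable abelian_iso_kernel.
exists (R5 b) => //.
by apply: (r5_frame_isometric QL ed dL (V_perp2 x1V) (V_perp2 x2V) (V_perp2 x3V)).
Qed.

(** a is scaled so that the smaller parameter becomes 1 when the planes have the same type, and the
    hyperbolic one when the types differ: hence the bounds l >= 1 and l > 0. *)
Lemma two_planes (Q W' : {vspace L}) x y m u v n :
  \dim {: L} = 6 -> (forall x y, x \in Q -> y \in W' -> frm x y = 0) ->
  [/\ perp2 a z x, perp2 a z y, perp2 a z u & perp2 a z v] ->
  [/\ frm x u = 0, frm x v = 0, frm y u = 0 & frm y v = 0] ->
  0 < m -> 0 < n ->
  hyp_plane a x y m \/ (exists b, rot_plane a b x y m) ->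
  hyp_plane a u v n \/ (exists b, rot_plane a b u v n) -> listed.
Proof.
move=> dL _ [px py pu pv] [xu xv yu yv] m0 n0.
have p1 k w : perp2 a z w -> perp2 (k *: a) (k^-1 *: z) w by apply: perp2Z1.
have mm : m^-1 * m = 1 by rewrite mulVf // gt_eqF.
have nn : n^-1 * n = 1 by rewrite mulVf // gt_eqF.
have ge1 (r s : F) : 0 < r -> r <= s -> 1 <= r^-1 * s.
  by move=> r0 rs; rewrite [r^-1 * s]mulrC ler_pdivlMr // mul1r.
have gt0 (r s : F) : 0 < r -> 0 < s -> 0 < r^-1 * s.
  by move=> r0 s0; rewrite mulr_gt0 ?invr_gt0.
have edm := ext_dataZ (scale m0) ed; have edn := ext_dataZ (scale n0) ed.
have orth : [/\ frm x u = 0, frm x v = 0, frm y u = 0 & frm y v = 0] by split.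
have orth' : [/\ frm u x = 0, frm u y = 0, frm v x = 0 & frm v y = 0].
  by split; rewrite (frmC QL).
case=> [H|[b H]]; case=> [H'|[b' H']].
- have [le|/ltW le] := leP m n.
    exists (R62 (m^-1 * n)); first exact: ge1.
    have := hyp_planeZ m^-1 H; have := hyp_planeZ m^-1 H'; rewrite mm => H1 H2.
    by apply: (r62_frame QL edm dL _ _ _ _ orth H2 H1); apply: p1.
  exists (R62 (n^-1 * m)); first exact: ge1.
  have := hyp_planeZ n^-1 H; have := hyp_planeZ n^-1 H'; rewrite nn => H1 H2.
  by apply: (r62_frame QL edn dL _ _ _ _ orth' H1 H2); apply: p1.
- exists (R64 (m^-1 * n) b'); first exact: gt0.
  have := hyp_planeZ m^-1 H; have := rot_planeZ m^-1 H'; rewrite mm => H1 H2.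
  by apply: (r64_frame QL edm dL _ _ _ _ orth H2 H1); apply: p1.
- exists (R64 (n^-1 * m) b); first exact: gt0.
  have := rot_planeZ n^-1 H; have := hyp_planeZ n^-1 H'; rewrite nn => H1 H2.
  by apply: (r64_frame QL edn dL _ _ _ _ orth' H1 H2); apply: p1.
have [le|/ltW le] := leP m n.
  exists (R65 (m^-1 * n) (b (+) b') b); first exact: ge1.
  have := rot_planeZ m^-1 H; have := rot_planeZ m^-1 H'; rewrite mm => H1 H2.
  by apply: (r65_frame QL edm dL _ _ _ _ orth H2 H1); apply: p1.
exists (R65 (n^-1 * m) (b' (+) b) b'); first exact: ge1.
have := rot_planeZ n^-1 H; have := rot_planeZ n^-1 H'; rewrite nn => H1 H2.
by apply: (r65_frame QL edn dL _ _ _ _ orth' H1 H2); apply: p1.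
Qed.

Lemma listed6 : \dim {: L} = 6 -> listed.
Proof.
move=> dL; have dV : \dim V = 4 by have := ext_dim QL zz aa za; rewrite dL => -[].
have ndV := ext_nondeg QL zz aa za; have st := abelian_stable.
have ik := abelian_iso_kernel.
have [[k [kV k0 Dk]]|inj] := classic (exists k, [/\ k \in V, k <> 0 & br a k = 0]).
  have kk := ik k kV Dk.
  have [k' [k'V kk' k'k']] := isotropic_partner QL ndV kV k0 kk.
  have [_ dP] := nondeg_hyp QL ndV kV k'V kk k'k' kk'.
  have {}dP : \dim (perp (perp V k) k') = 2 by rewrite dV in dP; case: dP.
  have [x1 [x2 [y1 [y2 [[? ? ? ?] H]]]]] :=
    skew4_singular_form QL ndV st ik kV k'V kk k'k' kk' Dk dP.
  by exists R61 => //; apply: (r61_frame QL ed dL _ _ _ _ H); apply: V_perp2.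
have {}inj x : x \in V -> br a x = 0 -> x = 0.
  by move=> xV Dx; apply: NNPP => x0; apply: inj; exists x.
have [[Q [W' [[/subvP QV ndQ dQ stQ ikQ] [[/subvP WV ndW dW stW ikW] QW]]]]|] :=
    skew4_cases QL ndV dV st inj.
  have [x [y [m [[xQ yQ m0] H]]]] := plane_form QL ndQ dQ stQ ikQ.
  have [u [v [n [[uW vW n0] H']]]] := plane_form QL ndW dW stW ikW.
  apply: (two_planes dL QW _ _ m0 n0 H H'); split; try exact: QW.
  - by apply/V_perp2/QV.
  - by apply/V_perp2/QV.
  - by apply/V_perp2/WV.
  - by apply/V_perp2/WV.
move=> [k [k0 [x1 [x2 [y1 [y2 [[x1V x2V y1V y2V] H]]]]]]].
have k1 : k != 0 by rewrite gt_eqF.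
have ed' := ext_dataZ k1 ed.
have p1 w : w \in V -> perp2 (k *: a) (k^-1 *: z) w by move/V_perp2/perp2Z1.
case: H => [H|[b H]|[l [l0 H]]].
- by exists R63 => //; apply: (r63_frame QL ed' dL _ _ _ _ H); apply: p1.
- by exists (R66 b) => //; apply: (r66_frame QL ed' dL _ _ _ _ H); apply: p1.
- by exists (R67 l) => //; apply: (r67_frame QL ed' dL _ _ _ _ H); apply: p1.
Qed.

Lemma listed7 : \dim {: L} = 7 -> listed.
Proof.
move=> dL; have dV : \dim V = 5 by have := ext_dim QL zz aa za; rewrite dL => -[].
have ndV := ext_nondeg QL zz aa za; have st := abelian_stable.
have ik := abelian_iso_kernel.
have [|k kV [k0 kH]] := @odd_kernel _ _ QL a V; first by rewrite dV.
have Dk := br_mem0 ndV st kV kH; have kk := ik k kV Dk.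
have [k' [k'V kk' k'k']] := isotropic_partner QL ndV kV k0 kk.
have [_ dP] := nondeg_hyp QL ndV kV k'V kk k'k' kk'.
have {}dP : \dim (perp (perp V k) k') = 3 by rewrite dV in dP; case: dP.
have [[Q [W' [[/subvP QV ndQ dQ stQ ikQ] [[/subvP WV ndW dW stW ikW] QW]]]]|] :=
    skew5_cases QL ndV st ik kV k'V kk k'k' kk' Dk dP; last first.
  move=> [x xV [g0 D5]]; have [b [c1 [c2 [c3 H]]]] := nil5_form g0 D5.
  exists (R71 b) => //; apply: (r71_frame QL ed dL _ _ _ _ _ H); apply: V_perp2;
    by rewrite ?memvD ?memvZ ?st // ?memvD ?memvZ ?st.
have [x [y [m [[xQ yQ m0] H]]]] := plane_form QL ndQ dQ stQ ikQ.
rewrite dV in dW; case: dW => /esym dW.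
have [b [u1 [u2 [u3 [[u1W u2W u3W] N]]]]] := nil3_form QL ndW dW stW ikW.
have mV := scale m0; have ed' := ext_dataZ mV ed; have N' := nil3Z mV N.
have mm : m^-1 * m = 1 by rewrite mulVf // gt_eqF.
have [px py] : perp2 (m^-1 *: a) (m^-1^-1 *: z) x /\ perp2 (m^-1 *: a) (m^-1^-1 *: z) y.
  by split; apply: perp2Z1; apply/V_perp2/QV.
have pu1 : perp2 (m^-1 *: a) (m^-1^-1 *: z) (m^-1^-1 *: u1).
  by apply: perp2Z; apply/V_perp2/WV.
have pu2 : perp2 (m^-1 *: a) (m^-1^-1 *: z) u2 by apply: perp2Z1; apply/V_perp2/WV.
have pu3 : perp2 (m^-1 *: a) (m^-1^-1 *: z) (m^-1 *: u3).
  by apply: perp2Z; apply/V_perp2/WV.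
have orth w : w \in Q ->
    [/\ frm w (m^-1^-1 *: u1) = 0, frm w u2 = 0 & frm w (m^-1 *: u3) = 0].
  by move=> wQ; split; rewrite ?(frmE QL) QW ?mulr0.
case: H => [H|[b' H]].
  exists (R72 b) => //; have := hyp_planeZ m^-1 H; rewrite mm => H1.
  exact: (r72_frame QL ed' dL px py pu1 pu2 pu3 (orth x xQ) (orth y yQ) H1 N').
exists (R73 (b (+) b') b) => //; have := rot_planeZ m^-1 H; rewrite mm => H1.
exact: (r73_frame QL ed' dL px py pu1 pu2 pu3 (orth x xQ) (orth y yQ) H1 N').
Qed.

(** Dimensions 2 and 3 do not occur: if V = 0 then a is central with phi(a, z) = 1, and on a line a
    skew operator is 0, which puts an anisotropic vector in the kernel. *)
Lemma listed_abelian : (2 <= \dim {: L} <= 7)%N -> listed.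
Proof.
have dn := ext_dim QL zz aa za; have ndV := ext_nondeg QL zz aa za.
have ik := abelian_iso_kernel; have st := abelian_stable.
have [d0|d0] := eqVneq (\dim V) 0%N.
  exfalso; have ca : central a.
    move=> x; have [v vV ->] := ext_decomp QL zz aa za x; rewrite (mem_dim0 d0 vV).
    by rewrite !(brE QL) (br_xx QL) [br a z](brC QL) cz !(scaler0, oppr0, addr0).
  by have := isotropic_center_frm QL iso ca cz; rewrite az => /eqP; rewrite oner_eq0.
have [d1|d1] := eqVneq (\dim V) 1%N.
  exfalso; have [|v vV vv] := exists_aniso QL ndV; first by rewrite d1.
  apply: (vv); apply: ik => //; rewrite (dim1_scal QL d1 vV vv (st _ vV)).
  by rewrite (skew_self QL) mul0r scale0r.
rewrite dn; have := listed4; have := listed5; have := listed6; have := listed7.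
rewrite dn; move: (\dim V) d0 d1 => [|[|[|[|[|[|d]]]]]] //= _ _ H7 H6 H5 H4 _;
  [exact: H4 | exact: H5 | exact: H6 | exact: H7].
Qed.

End Abelian.

Lemma listed1 : \dim {: L} = 1%N -> listed.
Proof.
move=> dL; have ndL : nondegenerate_on (fullv : {vspace L}) by case: QL.
have [|v [b [_ vb]]] := exists_unit QL ndL; first by rewrite dL.
exists (R1 b) => //; apply: (@list_isometric _ _ _ _ _ [:: v]) => //.
  exact: r1_quadratic.
by rewrite /=; do !split; rewrite r1_frmE vb; ring.
Qed.

End Classification.

Section TriPerms.
Variables (F : rcfType) (L : quad_datum F).
Hypothesis QL : quadratic_lie L.
Implicit Types (x y t : L).

Lemma tri_perms x y t k : tri x y t = k ->
  [/\ tri y t x = k, tri t x y = k, tri y x t = - k, tri x t y = - k & tri t y x = - k].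
Proof.
move=> <-; split.
- by rewrite -(triR QL x).
- by rewrite (triR QL t).
- by rewrite (triC QL y).
- by rewrite (triCr QL x).
- by rewrite (triC QL t) -(triR QL x).
Qed.

End TriPerms.

Ltac sym_tri QL :=
  repeat match goal with
  | H : tri ?x ?y ?t = _ |- _ =>
    lazymatch goal with
    | _ : tri y t x = _ |- _ => fail
    | _ => have [? ? ? ? ?] := tri_perms QL H
    end
  end.

Ltac use_tri QL := rewrite ?(tri_xx QL) ?(tri_xt QL) ?(tri_tx QL);
  repeat match goal with H : tri ?x ?y ?z = _ |- context [tri ?x ?y ?z] => rewrite H end.

(** * The exceptional case, where z^perp / z is of type [r5] *)

Section R5Type.
Variables (F : rcfType) (L : quad_datum F).
Hypothesis QL : quadratic_lie L.
Implicit Types (x y z v w : L) (b : bool).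

Section Fixed.
Variables a z : L.
Hypotheses (cz : central z) (zz : frm z z = 0) (aa : frm a a = 0) (za : frm z a = 1).
Local Notation V := (perp (perp fullv z) a).
Let tz u v : tri u v z = 0. Proof. exact: (tri_centralr QL). Qed.
Let tz1 u v : tri z u v = 0. Proof. exact: (central_tri QL). Qed.
Let tz2 u v : tri u z v = 0. Proof. exact: (tri_centralm QL). Qed.

Definition r5_basis c1 c2 d1 d2 y b :=
  r5_frame a z c1 c2 d1 d2 y /\
  [/\ frm y y = (-1) ^+ b, frm c1 c1 = 0, frm c1 c2 = 0 & frm c2 c2 = 0] /\
  [/\ frm c1 y = 0, frm c2 y = 0, frm d1 y = 0 & frm d2 y = 0] /\
  [/\ frm d1 d1 = 0, frm d1 d2 = 0 & frm d2 d2 = 0].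

(** c1, c2 change by a matrix and the dual vectors d1, d2 by its inverse transpose, so tri d1 d2 y
    is divided by the determinant. *)
Lemma r5_basis_change c1 c2 d1 d2 y b k11 k12 k21 k22 :
  let det := k11 * k22 - k12 * k21 in
  let e1 := (k22 / det) *: d1 - (k21 / det) *: d2 in
  let e2 := (k11 / det) *: d2 - (k12 / det) *: d1 in
  det != 0 -> r5_basis c1 c2 d1 d2 y b ->
  r5_basis (k11 *: c1 + k12 *: c2) (k21 *: c1 + k22 *: c2) e1 e2 y b /\
  tri e1 e2 y = tri d1 d2 y / det.
Proof.
move=> det e1 e2 det0 [fr [[yy g1 g2 g3] [[g4 g5 g6 g7] [g8 g9 g10]]]].
have [[kc1 kc2 d1V d2V yV] [[h1 h2 h3 h4] [nb exp]]] := fr.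
have te : tri e1 e2 y = tri d1 d2 y / det.
  rewrite /e1 /e2 !(triE QL) !(tri_xx QL) (triC QL d2 d1) /det.
  by field.
sym_facts QL; split=> //; split; [split; [split|split; [split|split]] | split; [split|split; split]].
- by apply: (kernD QL); apply: (kernZ QL).
- by apply: (kernD QL); apply: (kernZ QL).
- by rewrite memvB ?memvZ.
- by rewrite memvB ?memvZ.
- exact: yV.
- by rewrite !(frmE QL) h1 h2 h3 h4; rewrite /det; field.
- by rewrite !(frmE QL) h1 h2 h3 h4; rewrite /det; field.
- by rewrite !(frmE QL) h1 h2 h3 h4; rewrite /det; field.
- by rewrite !(frmE QL) h1 h2 h3 h4; rewrite /det; field.
- by rewrite te; move/eqP: nb => nb; apply/eqP; rewrite mulf_neq0 ?invr_eq0.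
- move=> x xV; rewrite [LHS](exp x xV); apply: (frm_eq QL) => t.
  by rewrite /e1 /e2 !(frmE QL) /det; field; rewrite -/det det0 yy signr_eq0.
- exact: yy.
- by rewrite !(frmE QL); use_facts; ring.
- by rewrite !(frmE QL); use_facts; ring.
- by rewrite !(frmE QL); use_facts; ring.
- by rewrite !(frmE QL); use_facts; ring.
- by rewrite !(frmE QL); use_facts; ring.
- by rewrite !(frmE QL); use_facts; ring.
- by rewrite !(frmE QL); use_facts; ring.
- by rewrite !(frmE QL); use_facts; ring.
- by rewrite !(frmE QL); use_facts; ring.
- by rewrite !(frmE QL); use_facts; ring.
Qed.

(* Shifting a by v in V kills tri a on <d1, d2, y>. *)
Lemma r5_shift c1 c2 d1 d2 y b m11 m12 m21 m22 :
  r5_basis c1 c2 d1 d2 y b ->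
  br a c1 = m11 *: c1 + m12 *: c2 -> br a c2 = m21 *: c1 + m22 *: c2 ->
  exists a' c1' c2' y',
    [/\ frm z a' = 1, frm a' a' = 0, frm a' c1' = 0, frm a' c2' = 0 & frm a' y' = 0] /\
    [/\ frm a' d1 = 0, frm a' d2 = 0, frm z c1' = 0, frm z c2' = 0 & frm z y' = 0] /\
    [/\ frm z d1 = 0, frm z d2 = 0, frm c1' d1 = 1, frm c1' d2 = 0 & frm c2' d1 = 0] /\
    [/\ frm c2' d2 = 1, frm y' y' = (-1) ^+ b, frm c1' c1' = 0, frm c1' c2' = 0
       & frm c2' c2' = 0] /\
    [/\ frm c1' y' = 0, frm c2' y' = 0, frm d1 y' = 0, frm d2 y' = 0 & frm d1 d1 = 0] /\
    [/\ frm d1 d2 = 0, frm d2 d2 = 0, tri a' c1' d1 = m11, tri a' c1' d2 = m12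
       & tri a' c2' d1 = m21] /\
    [/\ tri a' c2' d2 = m22, tri a' c1' c2' = 0, tri a' c1' y' = 0, tri a' c2' y' = 0
       & tri a' d1 d2 = 0] /\
    [/\ tri a' d1 y' = 0, tri a' d2 y' = 0, tri c1' c2' d1 = 0, tri c1' c2' d2 = 0
       & tri c1' c2' y' = 0] /\
    [/\ tri c1' d1 d2 = 0, tri c1' d1 y' = 0, tri c1' d2 y' = 0, tri c2' d1 d2 = 0
       & tri c2' d1 y' = 0] /\
    tri c2' d2 y' = 0 /\ tri d1 d2 y' = tri d1 d2 y.
Proof.
move=> [fr [[yy g1 g2 g3] [[g4 g5 g6 g7] [g8 g9 g10]]]] D1 D2.
have [[[c1V c1H] [c2V c2H] d1V d2V yV] [[h1 h2 h3 h4] [/eqP nb _]]] := fr.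
have /(extP QL)[zc1 ac1] := c1V; have /(extP QL)[zc2 ac2] := c2V.
have /(extP QL)[zd1 ad1] := d1V; have /(extP QL)[zd2 ad2] := d2V.
have /(extP QL)[zy ay] := yV.
pose tau : F := (-1) ^+ b; have tau2 : tau * tau = 1 by rewrite -expr2 sqr_sign.
have k01 : tri c1 c2 d1 = 0 by apply: c1H.
have k02 : tri c1 c2 d2 = 0 by apply: c1H.
have k03 : tri c1 c2 y = 0 by apply: c1H.
have k04 : tri c1 d1 d2 = 0 by apply: c1H.
have k05 : tri c1 d1 y = 0 by apply: c1H.
have k06 : tri c1 d2 y = 0 by apply: c1H.
have k07 : tri c2 d1 d2 = 0 by apply: c2H.
have k08 : tri c2 d1 y = 0 by apply: c2H.
have k09 : tri c2 d2 y = 0 by apply: c2H.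
sym_facts QL.
have k11 : tri a c1 c2 = 0 by rewrite /tri D1 !(frmE QL); use_facts; ring.
have k12 : tri a c1 d1 = m11 by rewrite /tri D1 !(frmE QL); use_facts; ring.
have k13 : tri a c1 d2 = m12 by rewrite /tri D1 !(frmE QL); use_facts; ring.
have k14 : tri a c1 y = 0 by rewrite /tri D1 !(frmE QL); use_facts; ring.
have k15 : tri a c2 d1 = m21 by rewrite /tri D2 !(frmE QL); use_facts; ring.
have k16 : tri a c2 d2 = m22 by rewrite /tri D2 !(frmE QL); use_facts; ring.
have k17 : tri a c2 y = 0 by rewrite /tri D2 !(frmE QL); use_facts; ring.
have [h e0] : exists h, tri a d1 d2 = h by exists (tri a d1 d2).
have [h' e1] : exists h', tri a d1 y = h' by exists (tri a d1 y).
have [h'' e2] : exists h'', tri a d2 y = h'' by exists (tri a d2 y).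
have [beta e3] : exists beta, tri d1 d2 y = beta by exists (tri d1 d2 y).
rewrite e3 in nb *; sym_tri QL; clear fr c1H c2H c1V c2V d1V d2V yV D1 D2.
(* These coefficients cancel tri a d1 d2, tri a d2 y and tri a d1 y. The multiples of z below
   restore isotropy of the new a and its orthogonality to c1, c2 and y. *)
pose al := - h / beta; pose r1 := - h'' / beta; pose r2 := h' / beta.
exists (a + al *: y + r1 *: d1 + r2 *: d2 - (al ^+ 2 * tau / 2) *: z).
exists (c1 - r1 *: z), (c2 - r2 *: z), (y - (al * tau) *: z).
by do !split; (rewrite ?(triE QL) ?tz ?tz1 ?tz2; use_tri QL; rewrite ?(frmE QL);
  use_facts; rewrite -?/tau /al /r1 /r2; first [ring | by field]).
Qed.

Lemma r75_isometric c1 c2 d1 d2 y b m : \dim {: L} = 7 -> m != 0 ->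
  r5_basis c1 c2 d1 d2 y b -> br a c1 = m *: c1 -> br a c2 = - m *: c2 ->
  isometric L (r75 F b).
Proof.
move=> dL m0 B E1 E2.
have [||a' [c1' [c2' [y' H]]]] := @r5_shift c1 c2 d1 d2 y b m 0 0 (- m) B.
- by rewrite scale0r addr0.
- by rewrite scale0r add0r.
have [[_ [_ [/eqP nb _]]] _] := B.
move: H => [[? ? ? ? ?] [[? ? ? ? ?] [[? ? ? ? ?] [[? ? ? ? ?] [[? ? ? ? ?]
  [[? ? ? ? ?] [[? ? ? ? ?] [[? ? ? ? ?] [[? ? ? ? ?] [? e]]]]]]]]]].
have [beta e'] : exists beta, tri d1 d2 y = beta by exists (tri d1 d2 y).
rewrite e' in e nb; clear e' E1 E2 B; sym_tri QL; sym_facts QL.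
apply: (@list_isometric _ _ _ _ _ [:: m^-1 *: a'; (-1) ^+ b *: d2; - beta^-1 *: d1; y';
  ((-1) ^+ b * beta) *: c1'; c2'; (- (-1) ^+ b * m) *: z]);
  [exact: QL | exact: r75_quadratic | by [] | by [] | |].
  by rewrite /=; do !split; rewrite r75_frmE ?(frmE QL); frame_end.
by rewrite /=; do !split; rewrite [in RHS]/tri r75_brE r75_frmE ?(triE QL) ?tz;
  use_tri QL; frame_end.
Qed.

(** A rotation forces c1 and c2 to be scaled by the same factor, so tri d1 d2 y is normalized by a
    square root and its sign matters. In the hyperbolic case the two scales are independent and any
    nonzero value is absorbed. *)
Lemma r76_isometric_pos c1 c2 d1 d2 y b m : \dim {: L} = 7 -> m != 0 ->
  r5_basis c1 c2 d1 d2 y b -> br a c1 = m *: c2 -> br a c2 = - m *: c1 ->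
  0 < (-1) ^+ b * tri d1 d2 y ->
  isometric L (r76 F b).
Proof.
move=> dL m0 B E1 E2 bp.
have [||a' [c1' [c2' [y' H]]]] := @r5_shift c1 c2 d1 d2 y b 0 m (- m) 0 B.
- by rewrite scale0r add0r.
- by rewrite scale0r addr0.
move: H => [[? ? ? ? ?] [[? ? ? ? ?] [[? ? ? ? ?] [[? ? ? ? ?] [[? ? ? ? ?]
  [[? ? ? ? ?] [[? ? ? ? ?] [[? ? ? ? ?] [[? ? ? ? ?] [? e]]]]]]]]]].
pose r := Num.sqrt ((-1) ^+ b * tri d1 d2 y).
have r0 : r != 0 by rewrite gt_eqF // sqrtr_gt0.
have e' : tri d1 d2 y' = (-1) ^+ b * r ^+ 2.
  by rewrite e sqr_sqrtr ?ltW // mulrA -expr2 sqr_sign mul1r.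
clearbody r; clear e E1 E2 B bp; sym_tri QL; sym_facts QL.
apply: (@list_isometric _ _ _ _ _ [:: m^-1 *: a'; ((-1) ^+ b / r) *: d2;
  (- (-1) ^+ b / r) *: d1; y'; r *: c1'; r *: c2'; (- (-1) ^+ b * m) *: z]);
  [exact: QL | exact: r76_quadratic | by [] | by [] | |].
  by rewrite /=; do !split; rewrite r76_frmE ?(frmE QL); frame_end.
by rewrite /=; do !split; rewrite [in RHS]/tri r76_brE r76_frmE ?(triE QL) ?tz;
  use_tri QL; frame_end.
Qed.

(** Replacing c2 and d2 by their opposites reverses the sign of tri d1 d2 y, at the cost of that of
    m, which is free. *)
Lemma r76_isometric c1 c2 d1 d2 y b m : \dim {: L} = 7 -> m != 0 ->
  r5_basis c1 c2 d1 d2 y b -> br a c1 = m *: c2 -> br a c2 = - m *: c1 ->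
  isometric L (r76 F b).
Proof.
move=> dL m0 B E1 E2; have [[_ [_ [/eqP nb _]]] _] := B.
have [bp|bn|/eqP] := ltrgt0P ((-1) ^+ b * tri d1 d2 y).
- exact: (r76_isometric_pos dL m0 B E1 E2 bp).
- have [|B' t'] := @r5_basis_change c1 c2 d1 d2 y b 1 0 0 (-1) _ B.
    by rewrite mul1r mulr0 subr0 oppr_eq0 oner_eq0.
  apply: (r76_isometric_pos dL (m := - m) _ B'); rewrite ?oppr_eq0 //.
  + by rewrite !(brE QL) E1; apply: (frm_eq QL) => t; rewrite !(frmE QL); ring.
  + by rewrite !(brE QL) E2; apply: (frm_eq QL) => t; rewrite !(frmE QL); ring.
  by rewrite t' mulr0 subr0 mul1r invrN invr1 mulrN1 mulrN oppr_gt0.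
by rewrite mulf_eq0 signr_eq0 (negPf nb).
Qed.

Lemma r5_basis_listed c1 c2 d1 d2 y b : \dim {: L} = 7 ->
  r5_basis c1 c2 d1 d2 y b ->
  frm (br a c1) d1 ^+ 2 + frm (br a c1) d2 * frm (br a c2) d1 <> 0 -> listed L.
Proof.
move=> dL B /eqP s0; have [fr [[yy _ _ _] _]] := B.
have ny : frm y y <> 0 by rewrite yy; apply: sign_neq0.
have [[kc1 kc2 _ _ _] _] := fr.
have E1 := r5_br_kern QL cz fr ny kc1; have E2 := r5_br_kern QL cz fr ny kc2.
have tr := r5_trace QL cz fr.
set p := frm (br a c1) d1 in tr E1 s0; set q := frm (br a c1) d2 in tr E1 s0.
set r := frm (br a c2) d1 in tr E2 s0; set s := frm (br a c2) d2 in tr E2.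
have es : s = - p by apply/eqP; rewrite -addr_eq0 addrC tr.
rewrite {}es in E2 tr; clearbody p q r => {s tr}.
(* The determinant of w1 = k1 c1 + k2 c2 and its image under ad a. It is a nonzero quadratic form in
   k1, k2, hence nonzero at (1, 0), (0, 1) or (1, 1). *)
have [k1 [k2 k0]] : exists k1 k2, k1 * (k1 * q - k2 * p) - k2 * (k1 * p + k2 * r) != 0.
  have [q0|q0] := eqVneq q 0; last first.
    by exists 1, 0; rewrite !mul0r subr0 !mul1r subr0.
  have [r0|r0] := eqVneq r 0; last first.
    by exists 0, 1; rewrite !mul0r !mul1r sub0r add0r oppr_eq0.
  exists 1, 1; rewrite q0 r0 !mul1r addr0 sub0r -opprD oppr_eq0 -mulr2n mulrn_eq0 /=.
  by apply: contra s0 => /eqP ->; rewrite q0 mul0r addr0 expr0n.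
have [B1 t1] := r5_basis_change k0 B.
set w1 := k1 *: c1 + k2 *: c2 in B1; set w2 := _ *: c1 + _ *: c2 in B1.
set sc := p ^+ 2 + q * r in s0.
have D1 : br a w1 = w2.
  by rewrite /w1 /w2 !(brE QL) E1 E2; apply: (frm_eq QL) => t; rewrite !(frmE QL); ring.
have D2 : br a w2 = sc *: w1.
  by rewrite /w1 /w2 !(brE QL) E1 E2; apply: (frm_eq QL) => t; rewrite !(frmE QL) /sc; ring.
clearbody w1 w2.
pose m := Num.sqrt `|sc|; have m0 : m != 0 by rewrite gt_eqF // sqrtr_gt0 normr_gt0.
have m2 : m ^+ 2 = `|sc| by rewrite sqr_sqrtr.
(* A traceless operator on a plane has scalar square sc. If sc = m^2, the eigenvectors are m w1 + w2
   and m w1 - w2; if sc = -m^2, the vectors m w1 and w2 are rotated. *)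
have [sp|sn|/eqP] := ltrgt0P sc; last by rewrite (negPf s0).
- have sm : sc = m ^+ 2 by rewrite m2 gtr0_norm.
  have dt : m * (-1) - 1 * m != 0.
    by rewrite mulrN1 mul1r -opprD oppr_eq0 -mulr2n mulrn_eq0.
  have [B2 t2] := r5_basis_change dt B1.
  exists (R75 b) => //; apply: (r75_isometric dL m0 B2);
    by rewrite !(brE QL) D1 D2 sm; apply: (frm_eq QL) => t; rewrite !(frmE QL); ring.
have sm : sc = - m ^+ 2 by rewrite m2 ltr0_norm ?opprK.
have dt : m * 1 - 0 * 0 != 0 by rewrite mulr1 mul0r subr0.
have [B2 t2] := r5_basis_change dt B1.
exists (R76 b) => //; apply: (r76_isometric dL m0 B2);
  by rewrite !(brE QL) D1 D2 sm; apply: (frm_eq QL) => t; rewrite !(frmE QL); ring.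
Qed.

End Fixed.

Theorem classification : solvable_lie L -> indecomposable L ->
  (1 <= \dim {: L} <= 7)%N -> listed L.
Proof.
move=> sol ind /andP[d1 d7].
have [d2|] := leqP 2 (\dim {: L}); last first.
  by move=> d2; apply: (listed1 QL); apply/eqP; rewrite eqn_leq d1 -ltnS d2.
have iso := indecomposable_center QL ind d2.
have d27 : (2 <= \dim {: L} <= 7)%N by rewrite d2 d7.
have [[z [z0 cz tV]]|[[a [z [c1 [c2 [d [d' [y [b H]]]]]]]] dL]] := reduction QL sol iso d27.
  have ndL : nondegenerate_on (fullv : {vspace L}) by case: QL.
  have [a [_ za aa]] := isotropic_partner QL ndL (memvf z) z0 (iso z cz).
  apply: (@listed_abelian _ _ QL a z) => //; split=> //; first exact: iso.
  by rewrite (frmC QL).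
have [[cz zz aa za] [fr [[yy ? ? ?] [[? ? ? ?] [[? ? ?] det]]]]] := H.
by apply: (@r5_basis_listed a z cz zz aa za c1 c2 d d' y b).
Qed.

End R5Type.

(** * Solvability and indecomposability of the listed algebras *)

Section TableSolvable.
Variables (F : rcfType) (n : nat) (t : seq ('I_n * 'I_n * 'rV[F]_n)) (q : ('I_n -> F) -> F).
Local Notation T := (table_datum t q).
Hypothesis QT : quadratic_lie T.

(** The bases of the tables are ordered so that brackets move into tails; three such steps reach 0
    in every listed algebra. *)
Definition tail_space c : {vspace 'rV[F]_n} := (\sum_(i < n | (c <= i)%N) <['e_i]>)%VS.

Lemma mem_tail c s : size s = n -> take c s = nseq c 0 -> vec n s \in tail_space c.
Proof.
move=> ss ts; rewrite [vec n s]row_sum_delta memv_suml // => i _.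
have [ci|ic] := leqP c i.
  by rewrite memvZ // memvE; apply: (sumv_sup i).
have -> : vec n s 0 i = 0.
  by rewrite mxE -(nth_take _ ic) ts nth_nseq ic.
by rewrite scale0r mem0v.
Qed.

Lemma tailP c (u : 'rV[F]_n) : u \in tail_space c -> forall i : 'I_n, (i < c)%N -> u 0 i = 0.
Proof.
case/memv_sumP=> v Hv -> i ic; rewrite summxE big1 // => j cj.
have /vlineP[k ->] := Hv j cj; rewrite !mxE eqxx /=.
by case: eqP => [E|_]; rewrite ?mulr0 //; rewrite -E leqNgt ic in cj.
Qed.

Lemma tail_vec c s : size s = n -> (c <= n)%N -> vec n s \in tail_space c -> take c s = nseq c 0.
Proof.
move=> ss cn H; apply: (@eq_from_nth _ 0); rewrite size_takel ?ss // ?size_nseq //.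
move=> i ic; rewrite nth_take // nth_nseq ic.
by have := tailP H (i := Ordinal (leq_trans ic cn)) ic; rewrite mxE.
Qed.

Definition tail_step c c' := forall u v : 'rV[F]_n,
  u \in tail_space c -> v \in tail_space c -> @br F T u v \in tail_space c'.

Lemma tail0 : tail_space 0 = fullv.
Proof.
apply/eqP; rewrite eqEsubv subvf; apply/subvP=> u _.
by rewrite [u]row_sum_delta memv_suml // => i _; rewrite memvZ // memvE; apply: (sumv_sup i).
Qed.

Lemma tail_full : tail_space n = 0%VS.
Proof. by rewrite /tail_space big1 // => i; rewrite leqNgt ltn_ord. Qed.

Lemma tail_solvable c1 c2 : tail_step 0 c1 -> tail_step c1 c2 -> tail_step c2 n ->
  solvable_lie T.
Proof.
move=> s0 s1 s2.
pose U k : {vspace T} := if k is k'.+1 then if k' is k''.+1 then if k'' is _.+1 then tail_space n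
  else tail_space c2 else tail_space c1 else tail_space 0.
apply: (@solvable_chain F T U 3); [exact: tail0 | exact: tail_full |].
case=> [|[|[|k]]] x y; [exact: s0 | exact: s1 | exact: s2 |].
by rewrite /U tail_full !memv0 => /eqP -> _; rewrite (br0l QT).
Qed.

End TableSolvable.

Lemma vec_tail_step (F : rcfType) n t q c c' : (c <= n.+1)%N ->
  (forall s1 : seq F, size s1 = n.+1 -> forall s2, size s2 = n.+1 -> take c s1 = nseq c 0 ->
    take c s2 = nseq c 0 -> exists s, [/\ size s = n.+1, take c' s = nseq c' 0 &
    @br F (@table_datum F n.+1 t q) (vec n.+1 s1) (vec n.+1 s2) = vec n.+1 s]) ->
  tail_step t q c c'.
Proof.
move=> cn H u v; elim/vec_ind: u => s1 ss1; elim/vec_ind: v => s2 ss2.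
move=> /(tail_vec ss1 cn) t1 /(tail_vec ss2 cn) t2.
by have [s [ss ts ->]] := H s1 ss1 s2 ss2 t1 t2; apply: mem_tail.
Qed.

Ltac one_step n brL :=
  apply: vec_tail_step => //;
  let s := fresh "s" in move=> s; list_cases n s;
  let s := fresh "s" in move=> s; list_cases n s;
  rewrite /=;
  (let H1 := fresh "H" in let H2 := fresh "H" in move=> H1 H2;
   try (injection H1; clear H1; intros; subst);
   try (injection H2; clear H2; intros; subst));
  eexists; split; [ | | exact: brL]; [by [] | rewrite /=; list_ring].

Ltac table_solv n quad brL c1 c2 :=
  apply: (@tail_solvable _ _ _ _ quad c1 c2); one_step n brL.

Ltac center_facts n m brL c :=
  match m with
  | O => idtac
  | S ?m' =>
    have /= := c (vec n [seq (k == m')%:R | k <- iota 0 n]);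
    rewrite /= brL vec0;
    let E := fresh "E" in
    move=> /vec_eq E; have {}E := E erefl erefl; injection E; clear E; intros;
    clean_zeros; center_facts n m' brL c
  end.

Ltac center n brL frmL :=
  let x := fresh "x" in let c := fresh "c" in
  move=> x; coords n x; move=> c; center_facts n n brL c; clear c; rewrite frmL.

Section ListedClass.
Variable F : rcfType.
Implicit Types (l : F) (e s : bool) (i : label F).

Lemma r1_solvable s : solvable_lie (r1 F s).
Proof. by table_solv 1%N (@r1_quadratic F s) r1_brE 1%N 1%N. Qed.

Lemma r41_solvable : solvable_lie (r41 F).
Proof. by table_solv 4%N (@r41_quadratic F) r41_brE 1%N 3%N. Qed.

Lemma r41_center : isotropic_center (r41 F).
Proof. by center 4%N r41_brE r41_frmE; ring. Qed.

Lemma r42_solvable s : solvable_lie (r42 F s).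
Proof. by table_solv 4%N (@r42_quadratic F s) r42_brE 1%N 3%N. Qed.

Lemma r42_center s : isotropic_center (r42 F s).
Proof. by center 4%N r42_brE r42_frmE; ring. Qed.

Lemma r5_solvable s : solvable_lie (r5 F s).
Proof. by table_solv 5%N (@r5_quadratic F s) r5_brE 2%N 5%N. Qed.

Lemma r5_center s : isotropic_center (r5 F s).
Proof. by center 5%N r5_brE r5_frmE; ring. Qed.

Lemma r61_solvable : solvable_lie (r61 F).
Proof. by table_solv 6%N (@r61_quadratic F) r61_brE 1%N 5%N. Qed.

Lemma r61_center : isotropic_center (r61 F).
Proof. by center 6%N r61_brE r61_frmE; ring. Qed.

Lemma r62_solvable l : solvable_lie (r62 l).
Proof. by table_solv 6%N (@r62_quadratic F l) r62_brE 1%N 5%N. Qed.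

Lemma r62_center l : l != 0 -> isotropic_center (r62 l).
Proof. move=> l0; by center 6%N r62_brE r62_frmE; ring. Qed.

Lemma r63_solvable : solvable_lie (r63 F).
Proof. by table_solv 6%N (@r63_quadratic F) r63_brE 1%N 5%N. Qed.

Lemma r63_center : isotropic_center (r63 F).
Proof. by center 6%N r63_brE r63_frmE; ring. Qed.

Lemma r64_solvable l s : solvable_lie (r64 l s).
Proof. by table_solv 6%N (@r64_quadratic F l s) r64_brE 1%N 5%N. Qed.

Lemma r64_center l s : l != 0 -> isotropic_center (r64 l s).
Proof. move=> l0; by center 6%N r64_brE r64_frmE; ring. Qed.

Lemma r65_solvable l e s : solvable_lie (r65 l e s).
Proof. by table_solv 6%N (@r65_quadratic F l e s) r65_brE 1%N 5%N. Qed.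

Lemma r65_center l e s : l != 0 -> isotropic_center (r65 l e s).
Proof.
move=> l0; have l1 : (-1) ^+ e * l != 0 by rewrite mulf_neq0 ?signr_neq0.
by center 6%N r65_brE r65_frmE; ring.
Qed.

Lemma r66_solvable s : solvable_lie (r66 F s).
Proof. by table_solv 6%N (@r66_quadratic F s) r66_brE 1%N 5%N. Qed.

Lemma r66_center s : isotropic_center (r66 F s).
Proof. by center 6%N r66_brE r66_frmE; ring. Qed.

Lemma r67_solvable l : solvable_lie (r67 l).
Proof. by table_solv 6%N (@r67_quadratic F l) r67_brE 1%N 5%N. Qed.

(** The equations couple the coordinates of x1 and y1, so testing one basis vector does not isolate
    a coordinate; the system is solved through 1 + l^2, which is positive. *)
Lemma r67_center l : l != 0 -> isotropic_center (r67 l).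
Proof.
move=> l0 x; coords 6%N x => c; rewrite r67_frmE.
have := c (vec 6 [:: 1; 0; 0; 0; 0; 0]); rewrite /= r67_brE vec0 => /vec_eq E.
injection (E erefl erefl) => {E} _ _ E3 _ E1.
have := c (vec 6 [:: 0; 1; 0; 0; 0; 0]); rewrite /= r67_brE vec0 => /vec_eq E.
injection (E erefl erefl) => {E} _ _ _ _ E0.
have e0 : s0 = 0 by lra.
have e3 : s3 = l * s1 by lra.
have e1 : (1 + l ^+ 2) * s1 = 0 by rewrite -[RHS]oppr0 -[in RHS]E1 e3; ring.
have e1' : s1 = 0.
  by apply: mulr0_inv e1; rewrite gt_eqF // ltr_pwDl // sqr_ge0.
by rewrite e0 e3 e1'; ring.
Qed.

Lemma r71_solvable s : solvable_lie (r71 F s).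
Proof. by table_solv 7%N (@r71_quadratic F s) r71_brE 1%N 6%N. Qed.

Lemma r71_center s : isotropic_center (r71 F s).
Proof. by center 7%N r71_brE r71_frmE; ring. Qed.

Lemma r72_solvable s : solvable_lie (r72 F s).
Proof. by table_solv 7%N (@r72_quadratic F s) r72_brE 1%N 6%N. Qed.

Lemma r72_center s : isotropic_center (r72 F s).
Proof. by center 7%N r72_brE r72_frmE; ring. Qed.

Lemma r73_solvable e s : solvable_lie (r73 F e s).
Proof. by table_solv 7%N (@r73_quadratic F e s) r73_brE 1%N 6%N. Qed.

Lemma r73_center e s : isotropic_center (r73 F e s).
Proof. by center 7%N r73_brE r73_frmE; ring. Qed.

Lemma r75_solvable s : solvable_lie (r75 F s).
Proof. by table_solv 7%N (@r75_quadratic F s) r75_brE 1%N 3%N. Qed.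

Lemma r75_center s : isotropic_center (r75 F s).
Proof. by center 7%N r75_brE r75_frmE; ring. Qed.

Lemma r76_solvable s : solvable_lie (r76 F s).
Proof. by table_solv 7%N (@r76_quadratic F s) r76_brE 1%N 3%N. Qed.

Lemma r76_center s : isotropic_center (r76 F s).
Proof. by center 7%N r76_brE r76_frmE; ring. Qed.

Definition label_dim (i : label F) : nat :=
  match i with
  | R1 _ => 1 | R41 | R42 _ => 4 | R5 _ => 5
  | R61 | R62 _ | R63 | R64 _ _ | R65 _ _ _ | R66 _ | R67 _ => 6
  | R71 _ | R72 _ | R73 _ _ | R75 _ | R76 _ => 7
  end.

Lemma dim_algebra i : \dim {: algebra i} = label_dim i.
Proof. by case: i => *; rewrite dimvf /dim /= mul1n. Qed.

Lemma algebra_quadratic i : quadratic_lie (algebra i).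
Proof.
case: i => *; [exact: r1_quadratic | exact: r41_quadratic | exact: r42_quadratic |
  exact: r5_quadratic | exact: r61_quadratic | exact: r62_quadratic | exact: r63_quadratic |
  exact: r64_quadratic | exact: r65_quadratic | exact: r66_quadratic | exact: r67_quadratic |
  exact: r71_quadratic | exact: r72_quadratic | exact: r73_quadratic | exact: r75_quadratic |
  exact: r76_quadratic].
Qed.

Lemma algebra_solvable i : solvable_lie (algebra i).
Proof.
case: i => *; [exact: r1_solvable | exact: r41_solvable | exact: r42_solvable |
  exact: r5_solvable | exact: r61_solvable | exact: r62_solvable | exact: r63_solvable |
  exact: r64_solvable | exact: r65_solvable | exact: r66_solvable | exact: r67_solvable |
  exact: r71_solvable | exact: r72_solvable | exact: r73_solvable | exact: r75_solvable |
  exact: r76_solvable].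
Qed.

Lemma algebra_center i : admissible i -> (1 < label_dim i)%N ->
  isotropic_center (algebra i).
Proof.
have ge1_neq0 (l : F) : 1 <= l -> l != 0 by move=> l1; rewrite gt_eqF // (lt_le_trans ltr01).
case: i => [s||s|s||l||l s|l e s|s|l|s|s|e s|s|s] //= adm _;
  [exact: r41_center | exact: r42_center | exact: r5_center | exact: r61_center |
   apply: r62_center; exact: ge1_neq0 | exact: r63_center |
   apply: r64_center; exact: lt0r_neq0 | apply: r65_center; exact: ge1_neq0 |
   exact: r66_center | apply: r67_center; exact: lt0r_neq0 | exact: r71_center |
   exact: r72_center | exact: r73_center | exact: r75_center | exact: r76_center].
Qed.

Lemma algebra_indecomposable i : admissible i -> indecomposable (algebra i).
Proof.
move=> adm; have [d1|d1] := eqVneq (label_dim i) 1%N.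
  move=> [I [_ I0 I1 _]]; move/negP: I1; apply; rewrite eqEdim subvf dim_algebra d1.
  by rewrite lt0n dimv_eq0.
apply: (isotropic_center_indecomposable (algebra_quadratic i) (algebra_solvable i)).
  by apply: algebra_center adm _; case: i d1.
by rewrite dim_algebra; case: (i).
Qed.

Theorem listed_class i : admissible i ->
  [/\ quadratic_lie (algebra i), solvable_lie (algebra i), indecomposable (algebra i)
    & (1 <= \dim {: algebra i} <= 7)%N].
Proof.
move=> adm; split; [exact: algebra_quadratic | exact: algebra_solvable |
  exact: algebra_indecomposable | by rewrite dim_algebra; case: (i)].
Qed.

End ListedClass.

(** * Distinguishing the listed algebras *)

Tactic Notation "coords1" hyp(u) ident(a0) :=
  let s := fresh "s" in elim/vec_ind: u => s;
  destruct s as [|a0 s]; [discriminate|];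
  destruct s; [move=> _ | discriminate].

Tactic Notation "coords4" hyp(u) ident(a0) ident(a1) ident(a2) ident(a3) :=
  let s := fresh "s" in elim/vec_ind: u => s;
  destruct s as [|a0 s]; [discriminate|];  destruct s as [|a1 s]; [discriminate|];
  destruct s as [|a2 s]; [discriminate|];  destruct s as [|a3 s]; [discriminate|];
  destruct s; [move=> _ | discriminate].

Tactic Notation "coords5" hyp(u) ident(a0) ident(a1) ident(a2) ident(a3) ident(a4) :=
  let s := fresh "s" in elim/vec_ind: u => s;
  destruct s as [|a0 s]; [discriminate|];  destruct s as [|a1 s]; [discriminate|];
  destruct s as [|a2 s]; [discriminate|];  destruct s as [|a3 s]; [discriminate|];
  destruct s as [|a4 s]; [discriminate|];
  destruct s; [move=> _ | discriminate].

Tactic Notation "coords6" hyp(u) ident(a0) ident(a1) ident(a2) ident(a3) ident(a4) ident(a5) :=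
  let s := fresh "s" in elim/vec_ind: u => s;
  destruct s as [|a0 s]; [discriminate|];  destruct s as [|a1 s]; [discriminate|];
  destruct s as [|a2 s]; [discriminate|];  destruct s as [|a3 s]; [discriminate|];
  destruct s as [|a4 s]; [discriminate|];  destruct s as [|a5 s]; [discriminate|];
  destruct s; [move=> _ | discriminate].

Tactic Notation "coords7" hyp(u) ident(a0) ident(a1) ident(a2) ident(a3) ident(a4) ident(a5) ident(a6) :=
  let s := fresh "s" in elim/vec_ind: u => s;
  destruct s as [|a0 s]; [discriminate|];  destruct s as [|a1 s]; [discriminate|];
  destruct s as [|a2 s]; [discriminate|];  destruct s as [|a3 s]; [discriminate|];
  destruct s as [|a4 s]; [discriminate|];  destruct s as [|a5 s]; [discriminate|];
  destruct s as [|a6 s]; [discriminate|];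
  destruct s; [move=> _ | discriminate].

Ltac eig_coords brL :=
  let k0 := fresh "k0" in let E := fresh "E" in
  move=> k0; cbv zeta; rewrite !brL vecZ // vecD //= => /vec_eq E;
  injection (E erefl erefl); clear E; intros;
  match goal with |- ?x0 = 0 /\ _ =>
    have Z : x0 = 0 by [apply: (mulr0_inv k0); lra];
    clear k0; subst x0; split; [reflexivity|];
    repeat (split; [intros; subst; lra|]);
    repeat split;
    match goal with H : _ = ?R |- _ = ?R => rewrite -H; ring end
  end.

(** * The square of ad u in coordinates *)

Section Eig.
Variable F : rcfType.
Implicit Types (l k : F) (e s : bool).

(** This lemma and its analogues: a nonzero k forces the a-coordinate of x to be 0; then on the
    middle coordinates the square of ad u is u0^2 times that of ad a, and the z-coordinate follows
    from the others. Taking y = 0 handles eigenvectors, general y Jordan chains. *)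
Lemma r41_eig  k u0 u1 u2 u3 x0 x1 x2 x3 y1 y2 y3 : k != 0 ->
  let u := vec 4 [:: u0; u1; u2; u3] in
  let x := vec 4 [:: x0; x1; x2; x3] in
  let y := vec 4 [:: 0; y1; y2; y3] in
  @br F (r41 F) u (@br F (r41 F) u x) = k *: x + y ->
  x0 = 0 /\ (x1 = 0 -> x2 = 0 -> k * x3 + y3 = 0) /\
  u0 ^+ 2 * x1 = k * x1 + y1 /\
  u0 ^+ 2 * x2 = k * x2 + y2.
Proof. by eig_coords r41_brE. Qed.

Lemma r42_eig s k u0 u1 u2 u3 x0 x1 x2 x3 y1 y2 y3 : k != 0 ->
  let u := vec 4 [:: u0; u1; u2; u3] in
  let x := vec 4 [:: x0; x1; x2; x3] in
  let y := vec 4 [:: 0; y1; y2; y3] in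
  @br F (r42 F s) u (@br F (r42 F s) u x) = k *: x + y ->
  x0 = 0 /\ (x1 = 0 -> x2 = 0 -> k * x3 + y3 = 0) /\
  u0 ^+ 2 * (- x1) = k * x1 + y1 /\
  u0 ^+ 2 * (- x2) = k * x2 + y2.
Proof. by eig_coords r42_brE. Qed.

Lemma r61_eig  k u0 u1 u2 u3 u4 u5 x0 x1 x2 x3 x4 x5 y1 y2 y3 y4 y5 : k != 0 ->
  let u := vec 6 [:: u0; u1; u2; u3; u4; u5] in
  let x := vec 6 [:: x0; x1; x2; x3; x4; x5] in
  let y := vec 6 [:: 0; y1; y2; y3; y4; y5] in
  @br F (r61 F) u (@br F (r61 F) u x) = k *: x + y ->
  x0 = 0 /\ (x1 = 0 -> x2 = 0 -> x3 = 0 -> x4 = 0 -> k * x5 + y5 = 0) /\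
  u0 ^+ 2 * 0 = k * x1 + y1 /\
  u0 ^+ 2 * 0 = k * x2 + y2 /\
  u0 ^+ 2 * 0 = k * x3 + y3 /\
  u0 ^+ 2 * 0 = k * x4 + y4.
Proof. by eig_coords r61_brE. Qed.

Lemma r62_eig l k u0 u1 u2 u3 u4 u5 x0 x1 x2 x3 x4 x5 y1 y2 y3 y4 y5 : k != 0 ->
  let u := vec 6 [:: u0; u1; u2; u3; u4; u5] in
  let x := vec 6 [:: x0; x1; x2; x3; x4; x5] in
  let y := vec 6 [:: 0; y1; y2; y3; y4; y5] in
  @br F (r62 l) u (@br F (r62 l) u x) = k *: x + y ->
  x0 = 0 /\ (x1 = 0 -> x2 = 0 -> x3 = 0 -> x4 = 0 -> k * x5 + y5 = 0) /\
  u0 ^+ 2 * x1 = k * x1 + y1 /\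
  u0 ^+ 2 * x2 = k * x2 + y2 /\
  u0 ^+ 2 * (l ^+ 2 * x3) = k * x3 + y3 /\
  u0 ^+ 2 * (l ^+ 2 * x4) = k * x4 + y4.
Proof. by eig_coords r62_brE. Qed.

Lemma r63_eig  k u0 u1 u2 u3 u4 u5 x0 x1 x2 x3 x4 x5 y1 y2 y3 y4 y5 : k != 0 ->
  let u := vec 6 [:: u0; u1; u2; u3; u4; u5] in
  let x := vec 6 [:: x0; x1; x2; x3; x4; x5] in
  let y := vec 6 [:: 0; y1; y2; y3; y4; y5] in
  @br F (r63 F) u (@br F (r63 F) u x) = k *: x + y ->
  x0 = 0 /\ (x1 = 0 -> x2 = 0 -> x3 = 0 -> x4 = 0 -> k * x5 + y5 = 0) /\
  u0 ^+ 2 * x1 = k * x1 + y1 /\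
  u0 ^+ 2 * (x2 + 2 * x1) = k * x2 + y2 /\
  u0 ^+ 2 * x3 = k * x3 + y3 /\
  u0 ^+ 2 * (x4 + 2 * x3) = k * x4 + y4.
Proof. by eig_coords r63_brE. Qed.

Lemma r64_eig l s k u0 u1 u2 u3 u4 u5 x0 x1 x2 x3 x4 x5 y1 y2 y3 y4 y5 : k != 0 ->
  let u := vec 6 [:: u0; u1; u2; u3; u4; u5] in
  let x := vec 6 [:: x0; x1; x2; x3; x4; x5] in
  let y := vec 6 [:: 0; y1; y2; y3; y4; y5] in
  @br F (r64 l s) u (@br F (r64 l s) u x) = k *: x + y ->
  x0 = 0 /\ (x1 = 0 -> x2 = 0 -> x3 = 0 -> x4 = 0 -> k * x5 + y5 = 0) /\
  u0 ^+ 2 * x1 = k * x1 + y1 /\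
  u0 ^+ 2 * x2 = k * x2 + y2 /\
  u0 ^+ 2 * (- (l ^+ 2 * x3)) = k * x3 + y3 /\
  u0 ^+ 2 * (- (l ^+ 2 * x4)) = k * x4 + y4.
Proof. by eig_coords r64_brE. Qed.

Lemma r65_eig l e s k u0 u1 u2 u3 u4 u5 x0 x1 x2 x3 x4 x5 y1 y2 y3 y4 y5 : k != 0 ->
  let u := vec 6 [:: u0; u1; u2; u3; u4; u5] in
  let x := vec 6 [:: x0; x1; x2; x3; x4; x5] in
  let y := vec 6 [:: 0; y1; y2; y3; y4; y5] in
  @br F (r65 l e s) u (@br F (r65 l e s) u x) = k *: x + y ->
  x0 = 0 /\ (x1 = 0 -> x2 = 0 -> x3 = 0 -> x4 = 0 -> k * x5 + y5 = 0) /\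
  u0 ^+ 2 * (- x1) = k * x1 + y1 /\
  u0 ^+ 2 * (- x2) = k * x2 + y2 /\
  u0 ^+ 2 * (- (l ^+ 2 * x3)) = k * x3 + y3 /\
  u0 ^+ 2 * (- (l ^+ 2 * x4)) = k * x4 + y4.
Proof. by eig_coords r65_brE. Qed.

Lemma r66_eig s k u0 u1 u2 u3 u4 u5 x0 x1 x2 x3 x4 x5 y1 y2 y3 y4 y5 : k != 0 ->
  let u := vec 6 [:: u0; u1; u2; u3; u4; u5] in
  let x := vec 6 [:: x0; x1; x2; x3; x4; x5] in
  let y := vec 6 [:: 0; y1; y2; y3; y4; y5] in
  @br F (r66 F s) u (@br F (r66 F s) u x) = k *: x + y ->
  x0 = 0 /\ (x1 = 0 -> x2 = 0 -> x3 = 0 -> x4 = 0 -> k * x5 + y5 = 0) /\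
  u0 ^+ 2 * (- x1) = k * x1 + y1 /\
  u0 ^+ 2 * (- x2 - 2 * x3) = k * x2 + y2 /\
  u0 ^+ 2 * (- x3) = k * x3 + y3 /\
  u0 ^+ 2 * (- x4 - 2 * x1) = k * x4 + y4.
Proof. by eig_coords r66_brE. Qed.

Lemma r67_eig l k u0 u1 u2 u3 u4 u5 x0 x1 x2 x3 x4 x5 y1 y2 y3 y4 y5 : k != 0 ->
  let u := vec 6 [:: u0; u1; u2; u3; u4; u5] in
  let x := vec 6 [:: x0; x1; x2; x3; x4; x5] in
  let y := vec 6 [:: 0; y1; y2; y3; y4; y5] in
  @br F (r67 l) u (@br F (r67 l) u x) = k *: x + y ->
  x0 = 0 /\ (x1 = 0 -> x2 = 0 -> x3 = 0 -> x4 = 0 -> k * x5 + y5 = 0) /\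
  u0 ^+ 2 * ((1 - l ^+ 2) * x1 + 2 * l * x3) = k * x1 + y1 /\
  u0 ^+ 2 * ((1 - l ^+ 2) * x2 + 2 * l * x4) = k * x2 + y2 /\
  u0 ^+ 2 * ((1 - l ^+ 2) * x3 - 2 * l * x1) = k * x3 + y3 /\
  u0 ^+ 2 * ((1 - l ^+ 2) * x4 - 2 * l * x2) = k * x4 + y4.
Proof. by eig_coords r67_brE. Qed.

Lemma r71_eig s k u0 u1 u2 u3 u4 u5 u6 x0 x1 x2 x3 x4 x5 x6 y1 y2 y3 y4 y5 y6 : k != 0 ->
  let u := vec 7 [:: u0; u1; u2; u3; u4; u5; u6] in
  let x := vec 7 [:: x0; x1; x2; x3; x4; x5; x6] in
  let y := vec 7 [:: 0; y1; y2; y3; y4; y5; y6] in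
  @br F (r71 F s) u (@br F (r71 F s) u x) = k *: x + y ->
  x0 = 0 /\ (x1 = 0 -> x2 = 0 -> x3 = 0 -> x4 = 0 -> x5 = 0 -> k * x6 + y6 = 0) /\
  u0 ^+ 2 * 0 = k * x1 + y1 /\
  u0 ^+ 2 * 0 = k * x2 + y2 /\
  u0 ^+ 2 * x1 = k * x3 + y3 /\
  u0 ^+ 2 * x2 = k * x4 + y4 /\
  u0 ^+ 2 * x3 = k * x5 + y5.
Proof. by eig_coords r71_brE. Qed.

Lemma r72_eig s k u0 u1 u2 u3 u4 u5 u6 x0 x1 x2 x3 x4 x5 x6 y1 y2 y3 y4 y5 y6 : k != 0 ->
  let u := vec 7 [:: u0; u1; u2; u3; u4; u5; u6] in
  let x := vec 7 [:: x0; x1; x2; x3; x4; x5; x6] in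
  let y := vec 7 [:: 0; y1; y2; y3; y4; y5; y6] in
  @br F (r72 F s) u (@br F (r72 F s) u x) = k *: x + y ->
  x0 = 0 /\ (x1 = 0 -> x2 = 0 -> x3 = 0 -> x4 = 0 -> x5 = 0 -> k * x6 + y6 = 0) /\
  u0 ^+ 2 * x1 = k * x1 + y1 /\
  u0 ^+ 2 * x2 = k * x2 + y2 /\
  u0 ^+ 2 * 0 = k * x3 + y3 /\
  u0 ^+ 2 * 0 = k * x4 + y4 /\
  u0 ^+ 2 * x3 = k * x5 + y5.
Proof. by eig_coords r72_brE. Qed.

Lemma r73_eig e s k u0 u1 u2 u3 u4 u5 u6 x0 x1 x2 x3 x4 x5 x6 y1 y2 y3 y4 y5 y6 : k != 0 ->
  let u := vec 7 [:: u0; u1; u2; u3; u4; u5; u6] in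
  let x := vec 7 [:: x0; x1; x2; x3; x4; x5; x6] in
  let y := vec 7 [:: 0; y1; y2; y3; y4; y5; y6] in
  @br F (r73 F e s) u (@br F (r73 F e s) u x) = k *: x + y ->
  x0 = 0 /\ (x1 = 0 -> x2 = 0 -> x3 = 0 -> x4 = 0 -> x5 = 0 -> k * x6 + y6 = 0) /\
  u0 ^+ 2 * 0 = k * x1 + y1 /\
  u0 ^+ 2 * 0 = k * x2 + y2 /\
  u0 ^+ 2 * x1 = k * x3 + y3 /\
  u0 ^+ 2 * (- x4) = k * x4 + y4 /\
  u0 ^+ 2 * (- x5) = k * x5 + y5.
Proof. by eig_coords r73_brE. Qed.

End Eig.

Lemma isometric_sym (F : rcfType) (L1 L2 : quad_datum F) : isometric L1 L2 -> isometric L2 L1.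
Proof.
move=> [f [[g fK gK] fb ff]].
have glin : linear g by move=> k x y; apply: (can_inj fK); rewrite linearP !gK.
pose h : {linear L2 -> L1} := HB.pack g (GRing.isLinear.Build F _ _ *:%R g glin).
exists h; split; first by exists f.
- by move=> x y; apply: (can_inj fK); rewrite /h /= fb !gK.
- by move=> x y; rewrite /h /= -ff !gK.
Qed.

(** * Properties carried over by isometries *)

Section Predicates.
Variable F : rcfType.
Implicit Types (k m c d : F) (L : quad_datum F).

Definition eigen k L := exists u x : L, x <> 0 /\ br u (br u x) = k *: x.

Definition jordan k c L := exists u x y : L,
  [/\ br u (br u x) = k *: x + y, br u (br u y) = k *: y & frm x y = c].

(** Both eigenvalues belong to the same u, so rescaling u cannot change their ratio. *)
Definition eigen_forms k c m d L := exists u x y : L,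
  [/\ br u (br u x) = k *: x, frm x x = c, br u (br u y) = m *: y & frm y y = d].

Definition eigen_nil k c d L := exists u x v : L,
  [/\ br u (br u x) = k *: x, frm x x = c, br u (br u (br u v)) = 0
    & frm (br u v) (br u v) = d].

(** x and y are the real and imaginary parts of an eigenvector of ad u for 1 + im. *)
Definition complex_eigen m L := exists u x y : L,
  [/\ x <> 0, br u x = x - m *: y & br u y = m *: x + y].

Definition engel4 L := forall u x : L, br u (br u (br u (br u x))) = 0.

Definition metabelian_nil L := forall a b c d e : L, br (br (br a b) (br c d)) e = 0.

Definition norm_br d L := exists u v : L, frm (br u v) (br u v) = d.

Definition norm_br2 d L := exists u v : L, frm (br u (br u v)) (br u (br u v)) = d.

Definition norm_derived d L := exists a b a' b' : L,
  frm (br (br a b) (br a' b')) (br (br a b) (br a' b')) = d.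

Section Transport.
Variables (L1 L2 : quad_datum F).
Hypothesis iso : isometric L1 L2.

Lemma iso_eigen k : eigen k L1 -> eigen k L2.
Proof.
have [f [/bij_inj fi fb _]] := iso; move=> [u [x [x0 E]]]; exists (f u), (f x); split.
  by rewrite -(linear0 f) => /fi.
by rewrite -!fb E linearZ.
Qed.

Lemma iso_jordan k c : jordan k c L1 -> jordan k c L2.
Proof.
have [f [_ fb ff]] := iso; move=> [u [x [y [E1 E2 E3]]]]; exists (f u), (f x), (f y).
by rewrite -!fb E1 E2 linearD !linearZ ff.
Qed.

Lemma iso_eigen_forms k c m d : eigen_forms k c m d L1 -> eigen_forms k c m d L2.
Proof.
have [f [_ fb ff]] := iso; move=> [u [x [y [E1 E2 E3 E4]]]]; exists (f u), (f x), (f y).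
by rewrite -!fb E1 E3 !linearZ !ff.
Qed.

Lemma iso_eigen_nil k c d : eigen_nil k c d L1 -> eigen_nil k c d L2.
Proof.
have [f [_ fb ff]] := iso; move=> [u [x [y [E1 E2 E3 E4]]]]; exists (f u), (f x), (f y).
by rewrite -!fb E1 E3 linearZ linear0 !ff.
Qed.

Lemma iso_complex_eigen m : complex_eigen m L1 -> complex_eigen m L2.
Proof.
have [f [/bij_inj fi fb _]] := iso; move=> [u [x [y [E1 E2 E3]]]]; exists (f u), (f x), (f y).
by rewrite -!fb E2 E3 linearB linearD !linearZ; split=> //; rewrite -(linear0 f) => /fi.
Qed.

Lemma iso_engel4 : engel4 L2 -> engel4 L1.
Proof.
have [f [/bij_inj fi fb _]] := iso; move=> H u x; apply: fi.
by rewrite !fb H linear0.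
Qed.

Lemma iso_metabelian_nil : metabelian_nil L2 -> metabelian_nil L1.
Proof.
have [f [/bij_inj fi fb _]] := iso; move=> H a b c d e; apply: fi.
by rewrite !fb H linear0.
Qed.

Lemma iso_norm_br d : norm_br d L1 -> norm_br d L2.
Proof.
by have [f [_ fb ff]] := iso; move=> [u [v E]]; exists (f u), (f v); rewrite -!fb ff.
Qed.

Lemma iso_norm_br2 d : norm_br2 d L1 -> norm_br2 d L2.
Proof.
by have [f [_ fb ff]] := iso; move=> [u [v E]]; exists (f u), (f v); rewrite -!fb ff.
Qed.

Lemma iso_norm_derived d : norm_derived d L1 -> norm_derived d L2.
Proof.
have [f [_ fb ff]] := iso; move=> [a [b [a' [b' E]]]]; exists (f a), (f b), (f a'), (f b').
by rewrite -!fb ff.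
Qed.

End Transport.

End Predicates.

Ltac nonzero_vec := let E := fresh "E" in
  rewrite vec0 => /vec_eq E; move: (E erefl erefl) => /eqP;
  rewrite /= !eqseq_cons ?oner_eq0 ?andbF.

Ltac compute_vec brL := rewrite !brL ?vecZ // ?vecD //=; apply: congr1; list_ring.

Section Eigen.
Variable F : rcfType.
Implicit Types (l k : F) (e s : bool).

Lemma eig_sign (c k x : F) : 0 <= c -> k < 0 -> c * x = k * x -> x = 0.
Proof.
move=> c0 k0 E; apply: (@mulr0_inv F (c - k)); first by rewrite gt_eqF //; lra.
by rewrite mulrBl E subrr.
Qed.

(** The labels for which ad u can have a nonzero real eigenvalue, as [neg] are those for which it
    can have a purely imaginary one. [R64] has both; [R67] and the nilpotent algebras have
    neither. *)
Definition pos (i : label F) := match i with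
  R41 | R62 _ | R63 | R64 _ _ | R72 _ | R75 _ => true | _ => false end.

Definition neg (i : label F) := match i with
  R42 _ | R64 _ _ | R65 _ _ _ | R66 _ | R73 _ _ | R76 _ => true | _ => false end.

Lemma eigen_pos i : pos i -> eigen 1 (algebra i).
Proof.
case: i => [s||s|s||l||l s|l e s|s|l|s|s|e s|s|s] //= _.
- exists (vec 4 [:: 1; 0; 0; 0]), (vec 4 [:: 0; 1; 0; 0]); split; first by nonzero_vec.
  by compute_vec r41_brE.
- exists (vec 6 [:: 1; 0; 0; 0; 0; 0]), (vec 6 [:: 0; 1; 0; 0; 0; 0]); split; first by nonzero_vec.
  by compute_vec r62_brE.
- exists (vec 6 [:: 1; 0; 0; 0; 0; 0]), (vec 6 [:: 0; 0; 1; 0; 0; 0]); split; first by nonzero_vec.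
  by compute_vec r63_brE.
- exists (vec 6 [:: 1; 0; 0; 0; 0; 0]), (vec 6 [:: 0; 1; 0; 0; 0; 0]); split; first by nonzero_vec.
  by compute_vec r64_brE.
- exists (vec 7 [:: 1; 0; 0; 0; 0; 0; 0]), (vec 7 [:: 0; 1; 0; 0; 0; 0; 0]).
  split; first by nonzero_vec.
  by compute_vec r72_brE.
- exists (vec 7 [:: 1; 0; 0; 0; 0; 0; 0]), (vec 7 [:: 0; 0; 0; 0; 1; 0; 0]).
  split; first by nonzero_vec.
  by compute_vec r75_brE.
Qed.

Lemma eigen_neg i : admissible i -> neg i -> eigen (-1) (algebra i).
Proof.
case: i => [s||s|s||l||l s|l e s|s|l|s|s|e s|s|s] //= l0 _.
- exists (vec 4 [:: 1; 0; 0; 0]), (vec 4 [:: 0; 1; 0; 0]); split; first by nonzero_vec.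
  by compute_vec r42_brE.
- have {}l0 : l != 0 by rewrite gt_eqF.
  exists (vec 6 [:: l^-1; 0; 0; 0; 0; 0]), (vec 6 [:: 0; 0; 0; 1; 0; 0]).
  split; first by nonzero_vec.
  by compute_vec r64_brE.
- exists (vec 6 [:: 1; 0; 0; 0; 0; 0]), (vec 6 [:: 0; 1; 0; 0; 0; 0]); split; first by nonzero_vec.
  by compute_vec r65_brE.
- exists (vec 6 [:: 1; 0; 0; 0; 0; 0]), (vec 6 [:: 0; 0; 1; 0; 0; 0]); split; first by nonzero_vec.
  by compute_vec r66_brE.
- exists (vec 7 [:: 1; 0; 0; 0; 0; 0; 0]), (vec 7 [:: 0; 0; 0; 0; 1; 0; 0]).
  split; first by nonzero_vec.
  by compute_vec r73_brE.
- exists (vec 7 [:: 1; 0; 0; 0; 0; 0; 0]), (vec 7 [:: 0; 0; 0; 0; 1; 0; 0]).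
  split; first by nonzero_vec.
  by compute_vec r76_brE.
Qed.

End Eigen.

Lemma add_vec0 (F : rcfType) n (a b : 'rV[F]_n) : a = b -> a = b + vec n (nseq n 0).
Proof. by rewrite -vec0 addr0. Qed.

Ltac all_zero := rewrite vec0; apply: congr1; rewrite /=; repeat (apply: cons_eq; first by []);
  reflexivity.

Section NoEigen.
Variable F : rcfType.
Implicit Types (l k : F) (e s : bool).

Lemma neg_eig (c x : F) : 0 <= c -> c * x = - x -> x = 0.
Proof. by move=> c0 E; apply: (@eig_sign F c (-1)) => //; lra. Qed.

Lemma r1_no_eigen s k : k != 0 -> ~ eigen k (r1 F s).
Proof.
move=> k0 [u [x [x0]]]; move: x0.
coords1 u u0.
coords1 x x0.
move=> x'.
rewrite !r1_brE vecZ //= => /vec_eq /(_ erefl erefl) [] /esym/(mulr0_inv k0) E0; subst.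
by case: x'; all_zero.
Qed.

Lemma r41_no_eigen : ~ eigen (-1) (r41 F).
Proof.
move=> [u [x [x']]]; move: x'.
coords4 u u0 u1 u2 u3.
coords4 x x0 x1 x2 x3.
move=> x' /add_vec0/=.
case/r41_eig => [|E0 [Ez [E1 E2]]]; first by rewrite oppr_eq0 oner_neq0.
have u00 := sqr_ge0 u0.
have Z1 : x1 = 0 by apply: (neg_eig u00); lra.
have Z2 : x2 = 0 by apply: (neg_eig u00); lra.
have Z3 := Ez Z1 Z2; have {}Z3 : x3 = 0 by lra.
by subst; case: x'; all_zero.
Qed.

Lemma r42_no_eigen s : ~ eigen 1 (r42 F s).
Proof.
move=> [u [x [x']]]; move: x'.
coords4 u u0 u1 u2 u3.
coords4 x x0 x1 x2 x3.
move=> x' /add_vec0/=.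
case/r42_eig => [|E0 [Ez [E1 E2]]]; first by rewrite oner_neq0.
have u00 := sqr_ge0 u0.
have Z1 : x1 = 0 by apply: (neg_eig u00); lra.
have Z2 : x2 = 0 by apply: (neg_eig u00); lra.
have Z3 := Ez Z1 Z2; have {}Z3 : x3 = 0 by lra.
by subst; case: x'; all_zero.
Qed.

Lemma r5_no_eigen s k : k != 0 -> ~ eigen k (r5 F s).
Proof.
move=> k0 [u [x [x']]]; move: x'.
coords5 u u0 u1 u2 u3 u4.
coords5 x x0 x1 x2 x3 x4.
move=> x'.
rewrite !r5_brE vecZ //= => /vec_eq /(_ erefl erefl) [].
move=> /esym/(mulr0_inv k0) E0; subst; move=> /esym/(mulr0_inv k0) E0; subst => E2 E3 E4.
have Z2 : x2 = 0 by apply: (mulr0_inv k0); rewrite -E2; ring.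
subst; have Z3 : x3 = 0 by apply: (mulr0_inv k0); rewrite -E3; ring.
subst; have Z4 : x4 = 0 by apply: (mulr0_inv k0); rewrite -E4; ring.
by subst; case: x'; all_zero.
Qed.

Lemma r61_no_eigen k : k != 0 -> ~ eigen k (r61 F).
Proof.
move=> k0 [u [x [x']]]; move: x'.
coords6 u u0 u1 u2 u3 u4 u5.
coords6 x x0 x1 x2 x3 x4 x5.
move=> x' /add_vec0/=.
case/(r61_eig k0) => E0 [Ez [E1 [E2 [E3 E4]]]].
have Z1 : x1 = 0 by apply: (mulr0_inv k0); lra.
have Z2 : x2 = 0 by apply: (mulr0_inv k0); lra.
have Z3 : x3 = 0 by apply: (mulr0_inv k0); lra.
have Z4 : x4 = 0 by apply: (mulr0_inv k0); lra.
have Z5 := Ez Z1 Z2 Z3 Z4; have {}Z5 : x5 = 0 by apply: (mulr0_inv k0); lra.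
by subst; case: x'; all_zero.
Qed.

Lemma r62_no_eigen l : ~ eigen (-1) (r62 l).
Proof.
move=> [u [x [x']]]; move: x'.
coords6 u u0 u1 u2 u3 u4 u5.
coords6 x x0 x1 x2 x3 x4 x5.
move=> x' /add_vec0/=.
case/r62_eig => [|E0 [Ez [E1 [E2 [E3 E4]]]]]; first by rewrite oppr_eq0 oner_neq0.
have u00 := sqr_ge0 u0; have ul0 : 0 <= u0 ^+ 2 * l ^+ 2 by rewrite mulr_ge0 ?sqr_ge0.
have Z1 : x1 = 0 by apply: (neg_eig u00); lra.
have Z2 : x2 = 0 by apply: (neg_eig u00); lra.
have Z3 : x3 = 0 by apply: (neg_eig ul0); lra.
have Z4 : x4 = 0 by apply: (neg_eig ul0); lra.
have Z5 := Ez Z1 Z2 Z3 Z4; have {}Z5 : x5 = 0 by lra.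
by subst; case: x'; all_zero.
Qed.

Lemma r63_no_eigen : ~ eigen (-1) (r63 F).
Proof.
move=> [u [x [x']]]; move: x'.
coords6 u u0 u1 u2 u3 u4 u5.
coords6 x x0 x1 x2 x3 x4 x5.
move=> x' /add_vec0/=.
case/r63_eig => [|E0 [Ez [E1 [E2 [E3 E4]]]]]; first by rewrite oppr_eq0 oner_neq0.
have u00 := sqr_ge0 u0.
have Z1 : x1 = 0 by apply: (neg_eig u00); lra.
have Z3 : x3 = 0 by apply: (neg_eig u00); lra.
subst; have Z2 : x2 = 0 by apply: (neg_eig u00); lra.
have Z4 : x4 = 0 by apply: (neg_eig u00); lra.
have Z5 := Ez erefl Z2 erefl Z4; have {}Z5 : x5 = 0 by lra.
by subst; case: x'; all_zero.
Qed.

Lemma r65_no_eigen l e s : ~ eigen 1 (r65 l e s).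
Proof.
move=> [u [x [x']]]; move: x'.
coords6 u u0 u1 u2 u3 u4 u5.
coords6 x x0 x1 x2 x3 x4 x5.
move=> x' /add_vec0/=.
case/r65_eig => [|E0 [Ez [E1 [E2 [E3 E4]]]]]; first by rewrite oner_neq0.
have u00 := sqr_ge0 u0; have ul0 : 0 <= u0 ^+ 2 * l ^+ 2 by rewrite mulr_ge0 ?sqr_ge0.
have Z1 : x1 = 0 by apply: (neg_eig u00); lra.
have Z2 : x2 = 0 by apply: (neg_eig u00); lra.
have Z3 : x3 = 0 by apply: (neg_eig ul0); lra.
have Z4 : x4 = 0 by apply: (neg_eig ul0); lra.
have Z5 := Ez Z1 Z2 Z3 Z4; have {}Z5 : x5 = 0 by lra.
by subst; case: x'; all_zero.
Qed.

Lemma r66_no_eigen s : ~ eigen 1 (r66 F s).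
Proof.
move=> [u [x [x']]]; move: x'.
coords6 u u0 u1 u2 u3 u4 u5.
coords6 x x0 x1 x2 x3 x4 x5.
move=> x' /add_vec0/=.
case/r66_eig => [|E0 [Ez [E1 [E2 [E3 E4]]]]]; first by rewrite oner_neq0.
have u00 := sqr_ge0 u0.
have Z1 : x1 = 0 by apply: (neg_eig u00); lra.
have Z3 : x3 = 0 by apply: (neg_eig u00); lra.
subst; have Z2 : x2 = 0 by apply: (neg_eig u00); lra.
have Z4 : x4 = 0 by apply: (neg_eig u00); lra.
have Z5 := Ez erefl Z2 erefl Z4; have {}Z5 : x5 = 0 by lra.
by subst; case: x'; all_zero.
Qed.

(* A rotation-dilation x + iy has the nonreal square (1 + il)^2, so its square has no real
   eigenvector: cross-multiplying the two equations leaves 2 l u0^2 (x1^2 + x3^2) = 0. *)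
Lemma rotation_no_eigen (c l k x y : F) : l != 0 -> k != 0 ->
  c * ((1 - l ^+ 2) * x + 2 * l * y) = k * x ->
  c * ((1 - l ^+ 2) * y - 2 * l * x) = k * y -> x = 0 /\ y = 0.
Proof.
move=> l0 k0 E1 E2; have : (2 * l) * (c * (x ^+ 2 + y ^+ 2)) = 0.
  have -> : (2 * l) * (c * (x ^+ 2 + y ^+ 2)) = (c * ((1 - l ^+ 2) * x + 2 * l * y)) * y -
    (c * ((1 - l ^+ 2) * y - 2 * l * x)) * x by ring.
  by rewrite E1 E2; ring.
move/mulr0_inv => /(_ (mulf_neq0 (lt0r_neq0 (ltr0n _ 2)) l0)) /eqP.
rewrite mulf_eq0 paddr_eq0 ?sqr_ge0 // !sqrf_eq0 => /orP[/eqP c0|/andP[/eqP -> /eqP ->] //].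
by split; apply: (mulr0_inv k0); [rewrite -E1 | rewrite -E2]; rewrite c0 mul0r.
Qed.

Lemma r67_no_eigen l k : l != 0 -> k != 0 -> ~ eigen k (r67 l).
Proof.
move=> l0 k0 [u [x [x']]]; move: x'.
coords6 u u0 u1 u2 u3 u4 u5.
coords6 x x0 x1 x2 x3 x4 x5.
move=> x' /add_vec0/=.
case/(r67_eig k0) => E0 [Ez [E1 [E2 [E3 E4]]]]; rewrite !addr0 in E1 E2 E3 E4.
have [Z1 Z3] := rotation_no_eigen l0 k0 E1 E3.
have [Z2 Z4] := rotation_no_eigen l0 k0 E2 E4.
have Z5 := Ez Z1 Z2 Z3 Z4; have {}Z5 : x5 = 0 by apply: (mulr0_inv k0); lra.
by subst; case: x'; all_zero.
Qed.

Lemma r71_no_eigen s k : k != 0 -> ~ eigen k (r71 F s).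
Proof.
move=> k0 [u [x [x']]]; move: x'.
coords7 u u0 u1 u2 u3 u4 u5 u6.
coords7 x x0 x1 x2 x3 x4 x5 x6.
move=> x' /add_vec0/=.
case/(r71_eig k0) => E0 [Ez [E1 [E2 [E3 [E4 E5]]]]].
have Z1 : x1 = 0 by apply: (mulr0_inv k0); lra.
have Z2 : x2 = 0 by apply: (mulr0_inv k0); lra.
subst; have Z3 : x3 = 0 by apply: (mulr0_inv k0); lra.
have Z4 : x4 = 0 by apply: (mulr0_inv k0); lra.
subst; have Z5 : x5 = 0 by apply: (mulr0_inv k0); lra.
have Z6 := Ez erefl erefl erefl erefl Z5; have {}Z6 : x6 = 0 by apply: (mulr0_inv k0); lra.
by subst; case: x'; all_zero.
Qed.

Lemma r72_no_eigen s : ~ eigen (-1) (r72 F s).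
Proof.
move=> [u [x [x']]]; move: x'.
coords7 u u0 u1 u2 u3 u4 u5 u6.
coords7 x x0 x1 x2 x3 x4 x5 x6.
move=> x' /add_vec0/=.
case/r72_eig => [|E0 [Ez [E1 [E2 [E3 [E4 E5]]]]]]; first by rewrite oppr_eq0 oner_neq0.
have u00 := sqr_ge0 u0.
have Z1 : x1 = 0 by apply: (neg_eig u00); lra.
have Z2 : x2 = 0 by apply: (neg_eig u00); lra.
have Z3 : x3 = 0 by lra.
have Z4 : x4 = 0 by lra.
subst; have Z5 : x5 = 0 by lra.
have Z6 := Ez erefl erefl erefl erefl Z5; have {}Z6 : x6 = 0 by lra.
by subst; case: x'; all_zero.
Qed.

Lemma r73_no_eigen e s : ~ eigen 1 (r73 F e s).
Proof.
move=> [u [x [x']]]; move: x'.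
coords7 u u0 u1 u2 u3 u4 u5 u6.
coords7 x x0 x1 x2 x3 x4 x5 x6.
move=> x' /add_vec0/=.
case/r73_eig => [|E0 [Ez [E1 [E2 [E3 [E4 E5]]]]]]; first by rewrite oner_neq0.
have u00 := sqr_ge0 u0.
have Z1 : x1 = 0 by lra.
have Z2 : x2 = 0 by lra.
subst; have Z3 : x3 = 0 by lra.
have Z4 : x4 = 0 by apply: (neg_eig u00); lra.
have Z5 : x5 = 0 by apply: (neg_eig u00); lra.
have Z6 := Ez erefl erefl Z3 Z4 Z5; have {}Z6 : x6 = 0 by lra.
by subst; case: x'; all_zero.
Qed.

Lemma r75_no_eigen s : ~ eigen (-1) (r75 F s).
Proof.
move=> [u [x [x']]]; move: x'.
coords7 u u0 u1 u2 u3 u4 u5 u6.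
coords7 x x0 x1 x2 x3 x4 x5 x6.
move=> x'.
rewrite !r75_brE vecZ //= => /vec_eq /(_ erefl erefl) [] E0 E1 E2 E3 E4 E5 E6.
have u00 := sqr_ge0 u0.
have Z0 : x0 = 0 by lra.
subst; have Z1 : x1 = 0 by apply: (neg_eig u00); lra.
have Z2 : x2 = 0 by apply: (neg_eig u00); lra.
subst; have Z3 : x3 = 0 by lra.
subst; have Z4 : x4 = 0 by apply: (neg_eig u00); lra.
have Z5 : x5 = 0 by apply: (neg_eig u00); lra.
subst; have Z6 : x6 = 0 by lra.
by subst; case: x'; all_zero.
Qed.

Lemma r76_no_eigen s : ~ eigen 1 (r76 F s).
Proof.
move=> [u [x [x']]]; move: x'.
coords7 u u0 u1 u2 u3 u4 u5 u6.
coords7 x x0 x1 x2 x3 x4 x5 x6.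
move=> x'.
rewrite !r76_brE vecZ //= => /vec_eq /(_ erefl erefl) [] E0 E1 E2 E3 E4 E5 E6.
have u00 := sqr_ge0 u0.
have Z0 : x0 = 0 by lra.
subst; have Z1 : x1 = 0 by apply: (neg_eig u00); lra.
have Z2 : x2 = 0 by apply: (neg_eig u00); lra.
subst; have Z3 : x3 = 0 by lra.
subst; have Z4 : x4 = 0 by apply: (neg_eig u00); lra.
have Z5 : x5 = 0 by apply: (neg_eig u00); lra.
subst; have Z6 : x6 = 0 by lra.
by subst; case: x'; all_zero.
Qed.

Lemma eigen_posE (i : label F) : admissible i -> eigen 1 (algebra i) <-> pos i.
Proof.
move=> adm; split; last exact: eigen_pos.
case: i adm => [s||s|s||l||l s|l e s|s|l|s|s|e s|s|s] //= adm.
- by move/r1_no_eigen; rewrite oner_neq0 => /(_ isT).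
- by move/r42_no_eigen.
- by move/r5_no_eigen; rewrite oner_neq0 => /(_ isT).
- by move/r61_no_eigen; rewrite oner_neq0 => /(_ isT).
- by move/r65_no_eigen.
- by move/r66_no_eigen.
- by move/r67_no_eigen; rewrite oner_neq0 gt_eqF //= => /(_ isT isT).
- by move/r71_no_eigen; rewrite oner_neq0 => /(_ isT).
- by move/r73_no_eigen.
- by move/r76_no_eigen.
Qed.

Lemma eigen_negE (i : label F) : admissible i -> eigen (-1) (algebra i) <-> neg i.
Proof.
move=> adm; split; last exact: eigen_neg.
have m1 : -1 != 0 :> F by rewrite oppr_eq0 oner_neq0.
case: i adm => [s||s|s||l||l s|l e s|s|l|s|s|e s|s|s] //= adm.
- by move/r1_no_eigen => /(_ m1).
- by move/r41_no_eigen.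
- by move/r5_no_eigen => /(_ m1).
- by move/r61_no_eigen => /(_ m1).
- by move/r62_no_eigen.
- by move/r63_no_eigen.
- by move/r67_no_eigen; rewrite gt_eqF //= => /(_ isT m1).
- by move/r71_no_eigen => /(_ m1).
- by move/r72_no_eigen.
- by move/r75_no_eigen.
Qed.

End NoEigen.

(** * Separating the families *)

Section Separate.
Variable F : rcfType.
Implicit Types (k l c x y : F) (e s : bool).

(** The common end of the sign arguments: w is a square, a sum of squares, or a nonnegative multiple
    of one. *)
Lemma sign_sq s s' (w : F) : 0 <= w -> (-1) ^+ s = (-1) ^+ s' * w -> s = s'.
Proof. by case: s; case: s'; rewrite ?expr0 ?expr1 // => w0; lra. Qed.

Lemma nil_scal (a x : F) : a * (a * x) = 0 -> a * x = 0.
Proof. by move/eqP; rewrite mulf_eq0 => /orP[/eqP ->|/eqP //]; rewrite mul0r. Qed.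

Lemma r61_engel4 : engel4 (r61 F).
Proof.
move=> u x.
coords6 u u0 u1 u2 u3 u4 u5.
coords6 x x0 x1 x2 x3 x4 x5.
by rewrite !r61_brE vec0; apply: congr1 => /=; list_ring.
Qed.

Lemma r67_engel4 l : ~ engel4 (r67 l).
Proof.
move=> /(_ (vec 6 [:: 1; 0; 0; 0; 0; 0]) (vec 6 [:: 0; 1; 0; 0; 0; 0])).
rewrite !r67_brE vec0 => /vec_eq /(_ erefl erefl) [] E1 _ E3 _ _.
(* The real part of (1 + il)^4, and next its imaginary part; the sum of their squares is (1 +
   l^2)^4, which is not 0. *)
have re : 1 - 6 * l ^+ 2 + l ^+ 4 = 0 by rewrite -E1; ring.
have im : 4 * l * (1 - l ^+ 2) = 0 by rewrite -[RHS]oppr0 -E3; ring.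
have : (1 + l ^+ 2) ^+ 4 = 0.
  rewrite (_ : _ ^+ 4 = (1 - 6 * l ^+ 2 + l ^+ 4) ^+ 2 + (4 * l * (1 - l ^+ 2)) ^+ 2); last by ring.
  by rewrite re im expr0n addr0.
by apply/eqP; rewrite expf_neq0 // gt_eqF // ltr_wpDr ?sqr_ge0.
Qed.

(** The square of ad u is diagonal on the middle coordinates, so the nilpotent part y of a Jordan
    chain vanishes there, and the pairing with x is 0. *)
Lemma r62_no_jordan l c : c != 0 -> ~ jordan 1 c (r62 l).
Proof.
move=> c0 [u [x [y]]].
coords6 u u0 u1 u2 u3 u4 u5.
coords6 x x0 x1 x2 x3 x4 x5.
coords6 y y0 y1 y2 y3 y4 y5.
move=> -[+ /add_vec0/=].
move=> + /(r62_eig (@oner_neq0 F)) [] Y0 [Yz [Y1 [Y2 [Y3 Y4]]]]; subst.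
move=> /(r62_eig (@oner_neq0 F)) [] X0 [Xz [X1 [X2 [X3 X4]]]]; subst; rewrite r62_frmE.
have W1 : y1 = 0.
  have E : y1 = (u0 ^+ 2 - 1) * x1 by lra.
  by rewrite E; apply: nil_scal; rewrite -E; lra.
have W2 : y2 = 0.
  have E : y2 = (u0 ^+ 2 - 1) * x2 by lra.
  by rewrite E; apply: nil_scal; rewrite -E; lra.
have W3 : y3 = 0.
  have E : y3 = (u0 ^+ 2 * l ^+ 2 - 1) * x3 by lra.
  by rewrite E; apply: nil_scal; rewrite -E; lra.
have W4 : y4 = 0.
  have E : y4 = (u0 ^+ 2 * l ^+ 2 - 1) * x4 by lra.
  by rewrite E; apply: nil_scal; rewrite -E; lra.
have W5 := Yz W1 W2 W3 W4; subst => E.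
by move/eqP: c0; apply; rewrite -E; lra.
Qed.

Lemma r63_jordan : jordan 1 4 (r63 F).
Proof.
exists (vec 6 [:: 1; 0; 0; 0; 0; 0]), (vec 6 [:: 0; 1; 0; 1; 0; 0]), (vec 6 [:: 0; 0; 2; 0; 2; 0]).
by split; [compute_vec r63_brE | compute_vec r63_brE | rewrite r63_frmE; ring].
Qed.

Lemma r65_no_jordan l e s c : c != 0 -> ~ jordan (-1) c (r65 l e s).
Proof.
have m1 : -1 != 0 :> F by rewrite oppr_eq0 oner_neq0.
move=> c0 [u [x [y]]].
coords6 u u0 u1 u2 u3 u4 u5.
coords6 x x0 x1 x2 x3 x4 x5.
coords6 y y0 y1 y2 y3 y4 y5.
move=> -[+ /add_vec0/=].
move=> + /(r65_eig m1) [] Y0 [Yz [Y1 [Y2 [Y3 Y4]]]]; subst.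
move=> /(r65_eig m1) [] X0 [Xz [X1 [X2 [X3 X4]]]]; subst; rewrite r65_frmE.
have W1 : y1 = 0.
  have E : y1 = (1 - u0 ^+ 2) * x1 by lra.
  by rewrite E; apply: nil_scal; rewrite -E; lra.
have W2 : y2 = 0.
  have E : y2 = (1 - u0 ^+ 2) * x2 by lra.
  by rewrite E; apply: nil_scal; rewrite -E; lra.
have W3 : y3 = 0.
  have E : y3 = (1 - u0 ^+ 2 * l ^+ 2) * x3 by lra.
  by rewrite E; apply: nil_scal; rewrite -E; lra.
have W4 : y4 = 0.
  have E : y4 = (1 - u0 ^+ 2 * l ^+ 2) * x4 by lra.
  by rewrite E; apply: nil_scal; rewrite -E; lra.
have W5 := Yz W1 W2 W3 W4; subst => E.
by move/eqP: c0; apply; rewrite -E; ring.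
Qed.

Lemma r66_jordan s : jordan (-1) (- 2 * (-1) ^+ s) (r66 F s).
Proof.
exists (vec 6 [:: 1; 0; 0; 0; 0; 0]), (vec 6 [:: 0; 1; 0; 0; 0; 0]), (vec 6 [:: 0; 0; 0; 0; -2; 0]).
by split; [compute_vec r66_brE | compute_vec r66_brE | rewrite r66_frmE; ring].
Qed.

(** The nilpotent part of the square of ad u sends x1, y1 to multiples of y2, x2, so the pairing of
    x with its image is a definite form in the coordinates of x along x1 and y1. *)
Lemma r66_jordan_sign s c : jordan (-1) c (r66 F s) -> exists2 w : F, 0 <= w & c = - 2 * (-1) ^+ s * w.
Proof.
have m1 : -1 != 0 :> F by rewrite oppr_eq0 oner_neq0.
move=> [u [x [y]]].
coords6 u u0 u1 u2 u3 u4 u5.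
coords6 x x0 x1 x2 x3 x4 x5.
coords6 y y0 y1 y2 y3 y4 y5.
move=> -[+ /add_vec0/=].
move=> + /(r66_eig m1) [] Y0 [Yz [Y1 [Y2 [Y3 Y4]]]]; subst.
move=> /(r66_eig m1) [] X0 [Xz [X1 [X2 [X3 X4]]]]; subst; rewrite r66_frmE => <-.
have W1 : y1 = 0.
  have E : y1 = (1 - u0 ^+ 2) * x1 by lra.
  by rewrite E; apply: nil_scal; rewrite -E; lra.
have W3 : y3 = 0.
  have E : y3 = (1 - u0 ^+ 2) * x3 by lra.
  by rewrite E; apply: nil_scal; rewrite -E; lra.
subst; have X2' : (1 - u0 ^+ 2) * x2 = 0.
  apply: nil_scal.
  have -> : (1 - u0 ^+ 2) * x2 = y2 + 2 * u0 ^+ 2 * x3 by lra.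
  rewrite (_ : _ * _ = (1 - u0 ^+ 2) * y2 + 2 * u0 ^+ 2 * ((1 - u0 ^+ 2) * x3)); last by ring.
  by rewrite (_ : _ * x3 = 0); lra.
have X4' : (1 - u0 ^+ 2) * x4 = 0.
  apply: nil_scal.
  have -> : (1 - u0 ^+ 2) * x4 = y4 + 2 * u0 ^+ 2 * x1 by lra.
  rewrite (_ : _ * _ = (1 - u0 ^+ 2) * y4 + 2 * u0 ^+ 2 * ((1 - u0 ^+ 2) * x1)); last by ring.
  by rewrite (_ : _ * x1 = 0); lra.
exists (u0 ^+ 2 * (x1 ^+ 2 + x3 ^+ 2)).
  by rewrite mulr_ge0 ?addr_ge0 ?sqr_ge0.
have -> : y2 = - 2 * u0 ^+ 2 * x3 by lra.
have -> : y4 = - 2 * u0 ^+ 2 * x1 by lra.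
by ring.
Qed.

Lemma r72_metabelian_nil s : metabelian_nil (r72 F s).
Proof.
move=> a b c d f.
coords7 a a0 a1 a2 a3 a4 a5 a6.
coords7 b b0 b1 b2 b3 b4 b5 b6.
coords7 c c0 c1 c2 c3 c4 c5 c6.
coords7 d d0 d1 d2 d3 d4 d5 d6.
coords7 f f0 f1 f2 f3 f4 f5 f6.
by rewrite !r72_brE vec0; apply: congr1 => /=; list_ring.
Qed.

Lemma r73_metabelian_nil e s : metabelian_nil (r73 F e s).
Proof.
move=> a b c d f.
coords7 a a0 a1 a2 a3 a4 a5 a6.
coords7 b b0 b1 b2 b3 b4 b5 b6.
coords7 c c0 c1 c2 c3 c4 c5 c6.
coords7 d d0 d1 d2 d3 d4 d5 d6.
coords7 f f0 f1 f2 f3 f4 f5 f6.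
by rewrite !r73_brE vec0; apply: congr1 => /=; list_ring.
Qed.

Lemma r75_metabelian_nil s : ~ metabelian_nil (r75 F s).
Proof.
move=> /(_ (vec 7 [:: 1; 0; 0; 0; 0; 0; 0]) (vec 7 [:: 0; 1; 0; 0; 0; 0; 0])
  (vec 7 [:: 1; 0; 0; 0; 0; 0; 0]) (vec 7 [:: 0; 0; 1; 0; 0; 0; 0]) (vec 7 [:: 0; 1; 0; 0; 0; 0; 0])).
by rewrite !r75_brE vec0 => /vec_eq /(_ erefl erefl) []; intros; lra.
Qed.

Lemma r76_metabelian_nil s : ~ metabelian_nil (r76 F s).
Proof.
move=> /(_ (vec 7 [:: 1; 0; 0; 0; 0; 0; 0]) (vec 7 [:: 0; 1; 0; 0; 0; 0; 0])
  (vec 7 [:: 1; 0; 0; 0; 0; 0; 0]) (vec 7 [:: 0; 0; 1; 0; 0; 0; 0]) (vec 7 [:: 0; 1; 0; 0; 0; 0; 0])).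
by rewrite !r76_brE vec0 => /vec_eq /(_ erefl erefl) []; intros; lra.
Qed.

Definition tag (i : label F) : nat := match i with
  | R1 _ => 0 | R41 => 1 | R42 _ => 2 | R5 _ => 3 | R61 => 4 | R62 _ => 5 | R63 => 6
  | R64 _ _ => 7 | R65 _ _ _ => 8 | R66 _ => 9 | R67 _ => 10 | R71 _ => 11 | R72 _ => 12
  | R73 _ _ => 13 | R75 _ => 14 | R76 _ => 15 end.

Lemma isometric_dim (L1 L2 : quad_datum F) : isometric L1 L2 -> \dim {: L1} = \dim {: L2}.
Proof.
move=> [f [bf _ _]]; rewrite -(@limg_dim_eq _ _ _ (linfun f) fullv).
  congr (\dim _); apply/eqP; rewrite eqEsubv subvf; apply/subvP=> v _.
  by case: bf => g _ gK; rewrite -[v]gK -lfunE memv_img ?memvf.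
apply/eqP; rewrite -subv0; apply/subvP=> v; rewrite memv_cap memv_ker lfunE memvf /= memv0.
by case: bf => g fK _ /eqP fv; rewrite -(fK v) fv -(linear0 f) fK.
Qed.

(** Dimension and the eigenvalues 1 and -1 leave five pairs of families: [R61] and [R67] differ by
    nilpotency, [R62] and [R63], [R65] and [R66] by Jordan chains, [R72] and [R75], [R73] and [R76]
    by centrality of the second derived algebra. *)
Lemma isometric_tag (i j : label F) : admissible i -> admissible j ->
  isometric (algebra i) (algebra j) -> tag i = tag j.
Proof.
move=> ai aj ij; have ji := isometric_sym ij.
have /eqP d : label_dim i = label_dim j by rewrite -!dim_algebra; apply: isometric_dim.
have /eqP p : pos i = pos j.
  by apply/idP/idP=> /eigen_posE; [move=> /(_ ai)/(iso_eigen ij) | move=> /(_ aj)/(iso_eigen ji)];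
    move/eigen_posE; apply.
have /eqP q : neg i = neg j.
  by apply/idP/idP=> /eigen_negE; [move=> /(_ ai)/(iso_eigen ij) | move=> /(_ aj)/(iso_eigen ji)];
    move/eigen_negE; apply.
have c4 : 4 != 0 :> F by rewrite pnatr_eq0.
have cs s : -2 * (-1) ^+ s != 0 :> F by rewrite mulf_neq0 ?signr_eq0 // oppr_eq0 pnatr_eq0.
case: i j ai aj ij ji d p q => [s||s|s||l||l s|l e s|s|l|s|s|e s|s|s]
  [s'||s'|s'||l'||l' s'|l' e' s'|s'|l'|s'|s'|e' s'|s'|s'] //= ai aj ij ji _ _ _.
- by case: (r67_engel4 (iso_engel4 ji r61_engel4)).
- by case: (r62_no_jordan c4 (iso_jordan ji r63_jordan)).
- by case: (r62_no_jordan c4 (iso_jordan ij r63_jordan)).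
- by case: (r65_no_jordan (cs _) (iso_jordan ji (r66_jordan _))).
- by case: (r65_no_jordan (cs _) (iso_jordan ij (r66_jordan _))).
- by case: (r67_engel4 (iso_engel4 ij r61_engel4)).
- by case: (r75_metabelian_nil (iso_metabelian_nil ji (@r72_metabelian_nil _))).
- by case: (r76_metabelian_nil (iso_metabelian_nil ji (@r73_metabelian_nil _ _))).
- by case: (r75_metabelian_nil (iso_metabelian_nil ij (@r72_metabelian_nil _))).
- by case: (r76_metabelian_nil (iso_metabelian_nil ij (@r73_metabelian_nil _ _))).
Qed.

End Separate.

(** * Recovering signs and parameters inside a family *)

Section Families.
Variable F : rcfType.
Implicit Types (k l c x y : F) (e s : bool).

Lemma r1_sign s s' : isometric (r1 F s) (r1 F s') -> s = s'.
Proof.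
move=> iso; have /(iso_eigen_forms iso)[u [x [_ [_ + _ _]]]] :
    eigen_forms 0 ((-1) ^+ s) 0 ((-1) ^+ s) (r1 F s).
  by exists (vec 1 [:: 0]), (vec 1 [:: 1]), (vec 1 [:: 1]); split;
    first [compute_vec (@r1_brE F) | rewrite r1_frmE; ring].
coords1 x x0.
rewrite r1_frmE -expr2 => /esym/sign_sq; apply; exact: sqr_ge0.
Qed.

Lemma r42_sign s s' : isometric (r42 F s) (r42 F s') -> s = s'.
Proof.
move=> iso; have /(iso_eigen_forms iso)[u [x [_ [+ + _ _]]]] :
    eigen_forms (-1) ((-1) ^+ s) (-1) ((-1) ^+ s) (r42 F s).
  by exists (vec 4 [:: 1; 0; 0; 0]), (vec 4 [:: 0; 1; 0; 0]), (vec 4 [:: 0; 1; 0; 0]); split;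
    first [compute_vec (@r42_brE F) | rewrite r42_frmE; ring].
coords4 u u0 u1 u2 u3.
coords4 x x0 x1 x2 x3.
move=> /add_vec0/= /r42_eig[|E0 _]; first by rewrite oppr_eq0 oner_neq0.
rewrite r42_frmE E0 => /esym/sign_sq; apply.
by rewrite mul0r mulr0 addr0 add0r -!expr2 addr_ge0 ?sqr_ge0.
Qed.

Lemma r5_sign s s' : isometric (r5 F s) (r5 F s') -> s = s'.
Proof.
move=> iso; have /(iso_norm_br iso)[u [v]] : norm_br ((-1) ^+ s) (r5 F s).
  exists (vec 5 [:: 1; 0; 0; 0; 0]), (vec 5 [:: 0; 1; 0; 0; 0]).
  by rewrite r5_brE r5_frmE; ring.
coords5 u u0 u1 u2 u3 u4.
coords5 v v0 v1 v2 v3 v4.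
rewrite r5_brE r5_frmE => /esym/sign_sq; apply.
by rewrite !mul0r !mulr0 addr0 subr0 add0r -expr2 sqr_ge0.
Qed.

(** The eigenvalues 1 and l^2 of one square of ad u must be among u0^2 and u0^2 l'^2; both may be
    the same one, which gives l = 1. The converse isometry settles that case in [r62_param]. *)
Lemma r62_half l l' : 1 <= l -> 1 <= l' -> isometric (r62 l) (r62 l') -> l = 1 \/ l = l'.
Proof.
move=> l1 l1' iso; have /(iso_eigen_forms iso)[u [x [y]]] : eigen_forms 1 2 (l ^+ 2) 2 (r62 l).
  exists (vec 6 [:: 1; 0; 0; 0; 0; 0]), (vec 6 [:: 0; 1; 1; 0; 0; 0]),
    (vec 6 [:: 0; 0; 0; 1; 1; 0]).
  by split; first [compute_vec (@r62_brE F) | rewrite r62_frmE; ring].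
have l20 : l ^+ 2 != 0 by rewrite expf_neq0 // gt_eqF //; lra.
coords6 u u0 u1 u2 u3 u4 u5.
coords6 x x0 x1 x2 x3 x4 x5.
coords6 y y0 y1 y2 y3 y4 y5.
move=> -[/add_vec0/= /(r62_eig (oner_neq0 F)) [X0 [_ [X1 [X2 [X3 X4]]]]] +
  /add_vec0/= /(r62_eig l20) [Y0 [_ [Y1 [Y2 [Y3 Y4]]]]]]; subst; rewrite !r62_frmE => fx fy.
have tx : u0 ^+ 2 = 1 \/ u0 ^+ 2 * l' ^+ 2 = 1.
  have [/eqP|t] := boolP (u0 ^+ 2 - 1 == 0); first by left; lra.
  have [/eqP|t'] := boolP (u0 ^+ 2 * l' ^+ 2 - 1 == 0); first by right; lra.
  have Z1 : x1 = 0 by apply: (mulr0_inv t); lra.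
  have Z3 : x3 = 0 by apply: (mulr0_inv t'); lra.
  by subst; lra.
have ty : u0 ^+ 2 = l ^+ 2 \/ u0 ^+ 2 * l' ^+ 2 = l ^+ 2.
  have [/eqP|t] := boolP (u0 ^+ 2 - l ^+ 2 == 0); first by left; lra.
  have [/eqP|t'] := boolP (u0 ^+ 2 * l' ^+ 2 - l ^+ 2 == 0); first by right; lra.
  have Z1 : y1 = 0 by apply: (mulr0_inv t); lra.
  have Z3 : y3 = 0 by apply: (mulr0_inv t'); lra.
  by subst; lra.
have l2 : 1 <= l ^+ 2 by rewrite exprn_ege1.
have l2' : 1 <= l' ^+ 2 by rewrite exprn_ege1.
have sq1 : l ^+ 2 = 1 -> l = 1.
  by move=> E; apply/eqP; rewrite -(@eqrXn2 _ 2) ?expr1n ?E //; lra.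
case: tx ty => [-> | E] [E' | E'].
- by left; apply: sq1.
- by right; apply/eqP; rewrite -(@eqrXn2 _ 2) -?E' ?mul1r //; lra.
- by left; apply: sq1; rewrite E' in E; nra.
- by left; apply: sq1; rewrite -E'.
Qed.

Lemma r62_param l l' : 1 <= l -> 1 <= l' -> isometric (r62 l) (r62 l') -> l = l'.
Proof.
move=> l1 l1' iso; have [E|//] := r62_half l1 l1' iso.
by have [E'|//] := r62_half l1' l1 (isometric_sym iso); rewrite E E'.
Qed.

(** Only the hyperbolic plane of the target has a positive eigenvalue, which pins u0^2 = 1; the
    negative eigenvalue then gives l, and the length of its eigenvector gives the sign. *)
Lemma r64_param l l' s s' : 0 < l -> 0 < l' ->
  isometric (r64 l s) (r64 l' s') -> l = l' /\ s = s'.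
Proof.
move=> l0 l0' iso; have /(iso_eigen_forms iso)[u [x [y]]] :
    eigen_forms 1 (2 * (-1) ^+ s) (- l ^+ 2) ((-1) ^+ s) (r64 l s).
  exists (vec 6 [:: 1; 0; 0; 0; 0; 0]), (vec 6 [:: 0; 1; 1; 0; 0; 0]),
    (vec 6 [:: 0; 0; 0; 1; 0; 0]).
  by split; first [compute_vec (@r64_brE F) | rewrite r64_frmE; ring].
have l20 : - l ^+ 2 != 0 by rewrite oppr_eq0 expf_neq0 // gt_eqF.
coords6 u u0 u1 u2 u3 u4 u5.
coords6 x x0 x1 x2 x3 x4 x5.
coords6 y y0 y1 y2 y3 y4 y5.
move=> -[/add_vec0/= /(r64_eig (oner_neq0 F)) [X0 [_ [X1 [X2 [X3 X4]]]]] +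
  /add_vec0/= /(r64_eig l20) [Y0 [_ [Y1 [Y2 [Y3 Y4]]]]]]; subst; rewrite !r64_frmE => fx fy.
have ul0 : 0 <= u0 ^+ 2 * l' ^+ 2 by rewrite mulr_ge0 ?sqr_ge0.
have Z3 : x3 = 0 by apply: (neg_eig ul0); lra.
have Z4 : x4 = 0 by apply: (neg_eig ul0); lra.
have t1 : u0 ^+ 2 = 1.
  have [/eqP|t] := boolP (u0 ^+ 2 - 1 == 0); first by lra.
  have Z1 : x1 = 0 by apply: (mulr0_inv t); lra.
  subst; case/eqP: (@signr_neq0 F s); apply: (@mulr0_inv F 2); first by rewrite pnatr_eq0.
  by rewrite -fx; ring.
have l2 : 0 < l ^+ 2 by rewrite exprn_gt0.
rewrite t1 in Y1 Y2 Y3 Y4.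
have W1 : y1 = 0 by apply: (@mulr0_inv F (1 + l ^+ 2)); [rewrite gt_eqF //; lra | lra].
have W2 : y2 = 0 by apply: (@mulr0_inv F (1 + l ^+ 2)); [rewrite gt_eqF //; lra | lra].
subst; split.
  apply/eqP; rewrite -(@eqrXn2 _ 2) ?ltW //; apply/eqP.
  have [/eqP|t] := boolP (l ^+ 2 - l' ^+ 2 == 0); first by lra.
  have W3 : y3 = 0 by apply: (mulr0_inv t); lra.
  have W4 : y4 = 0 by apply: (mulr0_inv t); lra.
  by subst; case/eqP: (@signr_neq0 F s); rewrite -fy; ring.
apply: (@sign_sq F s s' (y3 ^+ 2 + y4 ^+ 2)); first by rewrite addr_ge0 ?sqr_ge0.
by rewrite -fy; ring.
Qed.

Lemma r66_sign s s' : isometric (r66 F s) (r66 F s') -> s = s'.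
Proof.
move=> iso; have [w w0 E] := r66_jordan_sign (iso_jordan iso (@r66_jordan F s)).
apply: (sign_sq w0); lra.
Qed.

Lemma complex_block (t l l' x1 x3 y1 y3 : F) : 0 < l -> 0 < l' ->
  t * (x1 + l' * x3) = x1 - l * y1 -> t * (x3 - l' * x1) = x3 - l * y3 ->
  t * (y1 + l' * y3) = l * x1 + y1 -> t * (y3 - l' * y1) = l * x3 + y3 ->
  x1 = 0 /\ x3 = 0 \/ l = l'.
Proof.
move=> l0 l0' E1 E2 E3 E4.
(* With xi = x1 + i x3, eta = y1 + i y3 and w = A - iB, the equations read w xi = -l eta and w eta =
   l xi. Hence (w^2 + l^2) xi = 0, and w^2 + l^2 = C - iD. *)
pose A := t - 1; pose B := t * l'; pose C := A ^+ 2 - B ^+ 2 + l ^+ 2; pose D := 2 * A * B.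
have P1 : C * x1 + D * x3 = 0.
  rewrite (_ : _ + _ = A * (A * x1 + B * x3) + B * (A * x3 - B * x1) + l ^+ 2 * x1);
    last by rewrite /C /D; ring.
  have -> : A * x1 + B * x3 = - l * y1 by rewrite /A /B; lra.
  have -> : A * x3 - B * x1 = - l * y3 by rewrite /A /B; lra.
  rewrite (_ : _ + _ = l * (l * x1 - (A * y1 + B * y3))); last by ring.
  by rewrite (_ : _ - _ = 0) ?mulr0 // /A /B; lra.
have P3 : C * x3 - D * x1 = 0.
  rewrite (_ : _ - _ = A * (A * x3 - B * x1) - B * (A * x1 + B * x3) + l ^+ 2 * x3);
    last by rewrite /C /D; ring.
  have -> : A * x1 + B * x3 = - l * y1 by rewrite /A /B; lra.
  have -> : A * x3 - B * x1 = - l * y3 by rewrite /A /B; lra.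
  rewrite (_ : _ + _ = l * (l * x3 - (A * y3 - B * y1))); last by ring.
  by rewrite (_ : _ - (A * _ - _) = 0) ?mulr0 // /A /B; lra.
have [CD|CD] := eqVneq (C ^+ 2 + D ^+ 2) 0; last first.
  left; split; apply: (mulr0_inv CD).
    rewrite (_ : _ * x1 = C * (C * x1 + D * x3) - D * (C * x3 - D * x1)); last by ring.
    by rewrite P1 P3 !mulr0 subrr.
  rewrite (_ : _ * x3 = D * (C * x1 + D * x3) + C * (C * x3 - D * x1)); last by ring.
  by rewrite P1 P3 !mulr0 addr0.
right; move/eqP: CD; rewrite paddr_eq0 ?sqr_ge0 // !sqrf_eq0 => /andP[/eqP C0].
rewrite !mulf_eq0 (gt_eqF l0') pnatr_eq0 /= orbF.
have l20 : 0 < l ^+ 2 by rewrite exprn_gt0.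
have A2 := sqr_ge0 A; move: C0; rewrite /C => C0 /orP[/eqP A0|/eqP t0]; last first.
  by move: C0; rewrite /B t0 mul0r; lra.
have t1 : t = 1 by move: A0; rewrite /A; lra.
move: C0; rewrite A0 /B t1 mul1r => C0; apply/eqP; rewrite -(@eqrXn2 _ 2) ?ltW //.
by apply/eqP; lra.
Qed.

Lemma r67_param l l' : 0 < l -> 0 < l' -> isometric (r67 l) (r67 l') -> l = l'.
Proof.
move=> l0 l0' iso; have /(iso_complex_eigen iso)[u [x [y]]] : complex_eigen l (r67 l).
  exists (vec 6 [:: 1; 0; 0; 0; 0; 0]), (vec 6 [:: 0; 1; 0; 0; 0; 0]),
    (vec 6 [:: 0; 0; 0; 1; 0; 0]).
  split; first by nonzero_vec.
    by rewrite -scaleNr; compute_vec (@r67_brE F).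
  by compute_vec (@r67_brE F).
rewrite -scaleNr.
coords6 u u0 u1 u2 u3 u4 u5.
coords6 x x0 x1 x2 x3 x4 x5.
coords6 y y0 y1 y2 y3 y4 y5.
move=> -[x'].
rewrite !r67_brE ?vecZ // ?vecD //=.
move=> /vec_eq/(_ erefl erefl)[] X0 X1 X2 X3 X4 X5 /vec_eq/(_ erefl erefl)[] Y0 Y1 Y2 Y3 Y4 Y5.
have l2 : 1 + l ^+ 2 != 0 by rewrite gt_eqF // ltr_wpDr ?sqr_ge0.
have cx z w : 0 = z - l * w -> 0 = l * z + w -> z = 0 /\ w = 0.
  move=> E1 E2; have z0 : z = 0.
    apply: (mulr0_inv l2); have -> : z = l * w by lra.
    by rewrite (_ : _ * _ = l * (l * (l * w) + w)); [nra | ring].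
  by subst; split=> //; lra.
have [||Z0 W0] := cx x0 y0; [lra | lra | subst].
have [||||[Z1 Z3]|//] := @complex_block u0 l l' x1 x3 y1 y3 l0 l0'; [lra | lra | lra | lra |].
(* On x2, y2 the operator ad a has real part -1, hence the opposite sign of t. *)
have [||||[Z2 Z4]|//] := @complex_block (- u0) l l' x2 x4 y2 y4 l0 l0'; [lra | lra | lra | lra |].
have ly y : 0 = 0 - l * y -> y = 0 by move=> E; apply: (mulr0_inv (lt0r_neq0 l0)); lra.
subst; have W1 : y1 = 0 by apply: ly; lra.
have W2 : y2 = 0 by apply: ly; lra.
have W3 : y3 = 0 by apply: ly; lra.
have W4 : y4 = 0 by apply: ly; lra.
subst; have [||Z5 W5] := cx x5 y5; [lra | lra | subst].
by case: x'; all_zero.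
Qed.

Lemma r71_sign s s' : isometric (r71 F s) (r71 F s') -> s = s'.
Proof.
move=> iso; have /(iso_norm_br2 iso)[u [v]] : norm_br2 (- (-1) ^+ s) (r71 F s).
  exists (vec 7 [:: 1; 0; 0; 0; 0; 0; 0]), (vec 7 [:: 0; 1; 0; 0; 0; 0; 0]).
  by rewrite !r71_brE r71_frmE; ring.
coords7 u u0 u1 u2 u3 u4 u5 u6.
coords7 v v0 v1 v2 v3 v4 v5 v6.
rewrite !r71_brE r71_frmE => E.
apply: (@sign_sq F s s' ((u0 * (u0 * v1 - u1 * v0)) ^+ 2)); first exact: sqr_ge0.
by apply: oppr_inj; rewrite -E; ring.
Qed.

(** The eigenvector forces u0 to be nonzero; then the vanishing of (ad u)^3 v removes the hyperbolic
    part of [u, v], whose length becomes (-1)^s' times a square. *)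
Lemma r72_sign s s' : isometric (r72 F s) (r72 F s') -> s = s'.
Proof.
move=> iso; have /(iso_eigen_nil iso)[u [x [v]]] :
    eigen_nil 1 (2 * (-1) ^+ s) ((-1) ^+ s) (r72 F s).
  exists (vec 7 [:: 1; 0; 0; 0; 0; 0; 0]), (vec 7 [:: 0; 1; 1; 0; 0; 0; 0]),
    (vec 7 [:: 0; 0; 0; 1; 0; 0; 0]).
  split; rewrite ?vec0; first [compute_vec (@r72_brE F) | rewrite ?r72_brE r72_frmE; ring].
coords7 u u0 u1 u2 u3 u4 u5 u6.
coords7 x x0 x1 x2 x3 x4 x5 x6.
coords7 v v0 v1 v2 v3 v4 v5 v6.
move=> -[/add_vec0/= /(r72_eig (oner_neq0 F)) [X0 [_ [X1 [X2 [X3 [X4 X5]]]]]]].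
have Z3 : x3 = 0 by lra.
have Z4 : x4 = 0 by lra.
subst; rewrite r72_frmE !r72_brE r72_frmE => fx.
have t0 : u0 ^+ 2 != 0.
  apply/eqP=> t0; have Z1 : x1 = 0 by rewrite t0 in X1; lra.
  have Z2 : x2 = 0 by rewrite t0 in X2; lra.
  subst; case/eqP: (@signr_neq0 F s); apply: (@mulr0_inv F 2); first by rewrite pnatr_eq0.
  by rewrite -fx; ring.
rewrite vec0 => /vec_eq/(_ erefl erefl)[]; rewrite ?(mul0r, mulr0, subr0) => E1 E2 _ _ _.
have -> : u0 * v1 - u1 * v0 = 0 by apply: (mulr0_inv t0); lra.
have -> : u0 * v2 - u2 * v0 = 0 by apply: (mulr0_inv t0); lra.
move=> E; apply: (@sign_sq F s s' ((u0 * v3 - u3 * v0) ^+ 2)); first exact: sqr_ge0.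
by rewrite -E; ring.
Qed.

(** The nilpotent block gives s as for [r72_sign]; the eigenvector lies in the rotation plane, where
    the form has sign (-1)^(e + s), and this gives e. *)
Lemma r73_sign e e' s s' : isometric (r73 F e s) (r73 F e' s') -> e = e' /\ s = s'.
Proof.
have m1 : -1 != 0 :> F by rewrite oppr_eq0 oner_neq0.
move=> iso; have /(iso_eigen_nil iso)[u [x [v]]] :
    eigen_nil (-1) ((-1) ^+ e * (-1) ^+ s) ((-1) ^+ s) (r73 F e s).
  exists (vec 7 [:: 1; 0; 0; 0; 0; 0; 0]), (vec 7 [:: 0; 0; 0; 0; 1; 0; 0]),
    (vec 7 [:: 0; 1; 0; 0; 0; 0; 0]).
  split; rewrite ?vec0; first [compute_vec (@r73_brE F) | rewrite ?r73_brE r73_frmE; ring].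
coords7 u u0 u1 u2 u3 u4 u5 u6.
coords7 x x0 x1 x2 x3 x4 x5 x6.
coords7 v v0 v1 v2 v3 v4 v5 v6.
move=> -[/add_vec0/= /(r73_eig m1) [X0 [_ [X1 [X2 [X3 [X4 X5]]]]]]].
have Z1 : x1 = 0 by lra.
have Z2 : x2 = 0 by lra.
subst; rewrite r73_frmE !r73_brE r73_frmE => fx.
have t0 : u0 ^+ 2 != 0.
  apply/eqP=> t0; have Z4 : x4 = 0 by rewrite t0 in X4; lra.
  have Z5 : x5 = 0 by rewrite t0 in X5; lra.
  subst; case/eqP: (mulf_neq0 (@signr_neq0 F e) (@signr_neq0 F s)).
  by rewrite -fx; ring.
rewrite vec0 => /vec_eq/(_ erefl erefl)[]; rewrite ?(mul0r, mulr0, subr0) => _ _ E4 E5 _.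
have -> : u0 * v4 - u4 * v0 = 0 by apply: (mulr0_inv t0); lra.
have -> : u0 * v5 - u5 * v0 = 0 by apply: (mulr0_inv t0); lra.
move=> E; have Es : s = s'.
  apply: (@sign_sq F s s' ((u0 * v1 - u1 * v0) ^+ 2)); first exact: sqr_ge0.
  by rewrite -E; ring.
split=> //; subst s'; apply: (@sign_sq F e e' (x4 ^+ 2 + x5 ^+ 2)).
  by rewrite addr_ge0 ?sqr_ge0.
by apply: (mulfI (@signr_neq0 F s)); rewrite mulrC -fx; ring.
Qed.

(** On the second derived algebra the first three coordinates vanish, so its form reduces to the
    square of the y-coordinate. *)
Lemma r75_sign s s' : isometric (r75 F s) (r75 F s') -> s = s'.
Proof.
move=> iso; have /(iso_norm_derived iso)[a [b [c [d]]]] : norm_derived ((-1) ^+ s) (r75 F s).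
  exists (vec 7 [:: 1; 0; 0; 0; 0; 0; 0]), (vec 7 [:: 0; 1; 0; 0; 0; 0; 0]),
    (vec 7 [:: 1; 0; 0; 0; 0; 0; 0]), (vec 7 [:: 0; 0; 1; 0; 0; 0; 0]).
  by rewrite !r75_brE r75_frmE; ring.
coords7 a a0 a1 a2 a3 a4 a5 a6.
coords7 b b0 b1 b2 b3 b4 b5 b6.
coords7 c c0 c1 c2 c3 c4 c5 c6.
coords7 d d0 d1 d2 d3 d4 d5 d6.
rewrite !r75_brE r75_frmE => /esym/sign_sq; apply.
by rewrite ?(mul0r, mulr0, oppr0, subr0, add0r, addr0) -expr2 sqr_ge0.
Qed.

Lemma r76_sign s s' : isometric (r76 F s) (r76 F s') -> s = s'.
Proof.
move=> iso; have /(iso_norm_derived iso)[a [b [c [d]]]] : norm_derived ((-1) ^+ s) (r76 F s).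
  exists (vec 7 [:: 1; 0; 0; 0; 0; 0; 0]), (vec 7 [:: 0; 1; 0; 0; 0; 0; 0]),
    (vec 7 [:: 1; 0; 0; 0; 0; 0; 0]), (vec 7 [:: 0; 0; 1; 0; 0; 0; 0]).
  by rewrite !r76_brE r76_frmE; ring.
coords7 a a0 a1 a2 a3 a4 a5 a6.
coords7 b b0 b1 b2 b3 b4 b5 b6.
coords7 c c0 c1 c2 c3 c4 c5 c6.
coords7 d d0 d1 d2 d3 d4 d5 d6.
rewrite !r76_brE r76_frmE => /esym/sign_sq; apply.
by rewrite ?(mul0r, mulr0, oppr0, subr0, add0r, addr0) -expr2 sqr_ge0.
Qed.

End Families.

(** * The family [R65], with its coincidence at l = 1 *)

Section Definite.
Variable F : rcfType.
Implicit Types (l t : F) (e s : bool).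

(* X, Z (resp. Y, W) are the squared lengths of the components of the images of x_1 (resp. y_1)
   in the two planes of the target, and t is the square of the a-coordinate of the image of a. *)
Lemma r65_planes l l' e e' s s' : 1 <= l ->
  isometric (r65 l e s) (r65 l' e' s') -> exists t X Z Y W : F,
  [/\ [/\ 0 <= X, 0 <= Z, 0 <= Y & 0 <= W],
      [/\ (t - 1) * X = 0, (t * l' ^+ 2 - 1) * Z = 0,
          (t - l ^+ 2) * Y = 0 & (t * l' ^+ 2 - l ^+ 2) * W = 0],
      (-1) ^+ s = (-1) ^+ s' * (X + (-1) ^+ e' * Z)
    & (-1) ^+ e * (-1) ^+ s = (-1) ^+ s' * (Y + (-1) ^+ e' * W)].
Proof.
move=> l1 iso; have /(iso_eigen_forms iso)[u [x [y]]] :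
    eigen_forms (-1) ((-1) ^+ s) (- l ^+ 2) ((-1) ^+ e * (-1) ^+ s) (r65 l e s).
  exists (vec 6 [:: 1; 0; 0; 0; 0; 0]), (vec 6 [:: 0; 1; 0; 0; 0; 0]),
    (vec 6 [:: 0; 0; 0; 1; 0; 0]).
  by split; first [compute_vec (@r65_brE F) | rewrite r65_frmE; ring].
have m1 : -1 != 0 :> F by rewrite oppr_eq0 oner_neq0.
have l20 : - l ^+ 2 != 0 by rewrite oppr_eq0 expf_neq0 // gt_eqF //; lra.
coords6 u u0 u1 u2 u3 u4 u5.
coords6 x x0 x1 x2 x3 x4 x5.
coords6 y y0 y1 y2 y3 y4 y5.
move=> -[/add_vec0/= /(r65_eig m1) [X0 [_ [X1 [X2 [X3 X4]]]]] +
  /add_vec0/= /(r65_eig l20) [Y0 [_ [Y1 [Y2 [Y3 Y4]]]]]]; subst; rewrite !r65_frmE => fx fy.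
have prop (a b c : F) : a * - b = - c * b + 0 -> (a - c) * b ^+ 2 = 0.
  by move=> E; rewrite (_ : _ * _ = - (a * - b + c * b) * b); [rewrite E; ring | ring].
exists (u0 ^+ 2), (x1 ^+ 2 + x2 ^+ 2), (x3 ^+ 2 + x4 ^+ 2), (y1 ^+ 2 + y2 ^+ 2),
  (y3 ^+ 2 + y4 ^+ 2); split; first by split; rewrite addr_ge0 ?sqr_ge0.
- by split; rewrite mulrDr !prop ?addr0 //; lra.
- by rewrite -fx; ring.
- by rewrite -fy; ring.
Qed.

(** When l' = 1 both target planes turn at the same speed, so t equals 1 and l^2 at once. *)
Lemma r65_one l l' e e' s s' : 1 <= l -> isometric (r65 l e s) (r65 l' e' s') -> l' = 1 -> l = 1.
Proof.
move=> l1 iso l1'; have [t [X [Z [Y [W [_ [E1 E2 E3 E4] fx fy]]]]]] := r65_planes l1 iso.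
subst l'; rewrite expr1n mulr1 in E2 E4.
have t1 : t = 1.
  have [/eqP|t1] := boolP (t - 1 == 0); first by lra.
  have X0 := mulr0_inv t1 E1; have Z0 := mulr0_inv t1 E2; subst.
  by case/eqP: (@signr_neq0 F s); rewrite fx; ring.
have tl : t = l ^+ 2.
  have [/eqP|tl] := boolP (t - l ^+ 2 == 0); first by lra.
  have Y0 := mulr0_inv tl E3; have W0 := mulr0_inv tl E4; subst.
  by case/eqP: (mulf_neq0 (@signr_neq0 F e) (@signr_neq0 F s)); rewrite fy; ring.
apply/eqP; rewrite -(@eqrXn2 _ 2) ?expr1n -?tl ?t1 //; lra.
Qed.

(** If t = 1 each source plane goes to its counterpart, and the parameters and signs match one by
    one. Otherwise the planes are exchanged, which requires l^2 l'^2 = 1 with both factors above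
    1. *)
Lemma r65_other l l' e e' s s' : 1 <= l -> 1 <= l' ->
  isometric (r65 l e s) (r65 l' e' s') -> l != 1 -> l' != 1 -> [/\ l = l', e = e' & s = s'].
Proof.
have sq (x y : F) : 1 <= x -> 1 <= y -> x ^+ 2 = y ^+ 2 -> x = y.
  by move=> x1 y1 E; apply/eqP; rewrite -(@eqrXn2 _ 2) ?E //; lra.
move=> l1 l1' iso ne ne'.
have [t [X [Z [Y [W [[X0 Z0 Y0 W0] [E1 E2 E3 E4] fx fy]]]]]] := r65_planes l1 iso.
have l2 : l ^+ 2 != 1 by apply: contra ne => /eqP E; apply/eqP; apply: sq; rewrite ?expr1n.
have l2' : l' ^+ 2 != 1 by apply: contra ne' => /eqP E; apply/eqP; apply: sq; rewrite ?expr1n.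
have l21 : 1 <= l ^+ 2 by rewrite exprn_ege1.
have l21' : 1 <= l' ^+ 2 by rewrite exprn_ege1.
have [/eqP t1|t1] := boolP (t - 1 == 0).
  have {}t1 : t = 1 by lra.
  subst t; rewrite mul1r in E2 E4.
  have Zz : Z = 0 by apply: (mulr0_inv _ E2); rewrite subr_eq0.
  have Yz : Y = 0 by apply: (mulr0_inv _ E3); rewrite subr_eq0 eq_sym.
  subst; have Es : s = s' by apply: (sign_sq X0); rewrite fx; ring.
  split=> //.
    have [/eqP|m] := boolP (l' ^+ 2 - l ^+ 2 == 0).
      by move=> m; apply: sq => //; lra.
    have Wz := mulr0_inv m E4; subst.
    by case/eqP: (mulf_neq0 (@signr_neq0 F e) (@signr_neq0 F s')); rewrite fy; ring.
  subst s'; apply: (sign_sq W0); apply: (mulfI (@signr_neq0 F s)); rewrite mulrC fy; ring.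
have Xz := mulr0_inv t1 E1.
have [/eqP m|m] := boolP (t * l' ^+ 2 - 1 == 0); last first.
  have Zz := mulr0_inv m E2; subst.
  by case/eqP: (@signr_neq0 F s); rewrite fx; ring.
have Wz : W = 0 by apply: (mulr0_inv _ E4); rewrite subr_eq0 (_ : t * _ = 1) 1?eq_sym //; lra.
have [/eqP n|n] := boolP (t - l ^+ 2 == 0); last first.
  have Yz := mulr0_inv n E3; subst.
  by case/eqP: (mulf_neq0 (@signr_neq0 F e) (@signr_neq0 F s)); rewrite fy; ring.
have tl : t = l ^+ 2 by lra.
case/eqP: l2; subst t; apply/eqP; rewrite eq_le l21 andbT.
have -> : 1 = l ^+ 2 * l' ^+ 2 by lra.
by rewrite ler_peMr // ltW // (lt_le_trans ltr01).
Qed.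

(** All the squared lengths enter with the sign of s', as the form is definite on the two target
    planes. *)
Lemma r65_definite l l' e s s' : 1 <= l -> isometric (r65 l e s) (r65 l' false s') ->
  e = false /\ s = s'.
Proof.
move=> l1 iso; have [t [X [Z [Y [W [[X0 Z0 Y0 W0] _ fx fy]]]]]] := r65_planes l1 iso.
have Es : s = s' by apply: (@sign_sq F s s' (X + Z)); [rewrite addr_ge0 | rewrite fx; ring].
subst s'; split=> //; apply: (@sign_sq F e false (Y + W)); first by rewrite addr_ge0.
by apply: (mulfI (@signr_neq0 F s)); rewrite mulrC fy; ring.
Qed.

Lemma r65_param l l' e e' s s' : 1 <= l -> 1 <= l' -> isometric (r65 l e s) (r65 l' e' s') ->
  [/\ l = l', e = e' & s = s'] \/ [/\ l = 1, l' = 1, e = true, e' = true & s' = ~~ s].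
Proof.
move=> l1 l1' iso; have iso' := isometric_sym iso.
have [E|ne] := eqVneq l 1; have [E'|ne'] := eqVneq l' 1; first last.
- by left; apply: r65_other.
- by case/eqP: ne; apply: (r65_one l1 iso).
- by case/eqP: ne'; apply: (r65_one l1' iso').
subst; case: e e' iso iso' => -[] iso iso'.
- have [->|ne] := eqVneq s s'; first by left.
  by right; split=> //; move: ne; clear; case: s; case: s'.
- by have [] := r65_definite l1 iso.
- by have [] := r65_definite l1 iso'.
- by have [_ ->] := r65_definite l1 iso; left.
Qed.

Theorem listed_distinct (i j : label F) : admissible i -> admissible j -> i <> j ->
  ~ (exists s : bool, i = R65 1 true s /\ j = R65 1 true (~~ s)) ->
  ~ isometric (algebra i) (algebra j).
Proof.
move=> ai aj ij ex iso; have := isometric_tag ai aj iso.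
case: i j ai aj ij ex iso => [s||s|s||l||l s|l e s|s|l|s|s|e s|s|s]
  [s'||s'|s'||l'||l' s'|l' e' s'|s'|l'|s'|s'|e' s'|s'|s'] //= ai aj ij ex iso _; apply: ij.
- by rewrite (r1_sign iso).
- by rewrite (r42_sign iso).
- by rewrite (r5_sign iso).
- by rewrite (r62_param ai aj iso).
- by have [-> ->] := r64_param ai aj iso.
- have [[-> -> -> //]|[E1 E2 E3 E4 E5]] := r65_param ai aj iso.
  by case: ex; exists s; rewrite E1 E2 E3 E4 E5.
- by rewrite (r66_sign iso).
- by rewrite (r67_param ai aj iso).
- by rewrite (r71_sign iso).
- by rewrite (r72_sign iso).
- by have [-> ->] := r73_sign iso.
- by rewrite (r75_sign iso).
- by rewrite (r76_sign iso).
Qed.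

End Definite.

Theorem theorem4p5 (F : rcfType) :
  [/\ (* every listed algebra belongs to the class *)
      forall i : label F, admissible i ->
        [/\ quadratic_lie (algebra i), solvable_lie (algebra i),
            indecomposable (algebra i)
          & (1 <= \dim {: algebra i} <= 7)%N],
      (* the list is exhaustive *)
      forall L : quad_datum F,
        quadratic_lie L -> solvable_lie L -> indecomposable L ->
        (1 <= \dim {: L} <= 7)%N ->
        exists2 i : label F, admissible i & isometric L (algebra i)
    & (* pairwise non-isometric, up to the coincidence proved in [r65_swap] *)
      forall i j : label F, admissible i -> admissible j -> i <> j ->
        ~ (exists s : bool, i = R65 1 true s /\ j = R65 1 true (~~ s)) ->
        ~ isometric (algebra i) (algebra j)].
Proof.
split; [exact: listed_class | exact: classification | exact: listed_distinct].
Qed.
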